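(* Let $Q$ be a quiver with vertex set $I=\{1,\dots,n\}$ without loops and oriented $2$-cycles, $W$ a finite potential on $Q$, and $\mathbf{k}=(k_1,\dots,k_l)\in I^l$ such that $(Q^{\mathrm{pf}},W)$ is successively f-mutatable with respect to $\mathbf{k}$. Then for every vertex $i\in I$, the components of the vector ${}^{\mathrm t}g_{\mathbf{k},i}$ are either all non-negative, or all non-positive.
   Context: $Q(i,j)$ is the number of arrows $i\to j$ in $Q$; $\bar Q(i,j):=Q(j,i)-Q(i,j)$. The quiver with principal framing $Q^{\mathrm{pf}}$ has vertices $I\sqcup I^*$, $I^*=\{1^*,\dots,n^*\}$, and arrows those of $Q$ together with one arrow $i^*\to i$ for each $i\in I$. Quiver mutation. $\mu_k^{\mathrm{pre}}Q$ is obtained from $Q$ by adding an arrow $[\beta\alpha]:u\to v$ for each pair $u\xrightarrow{\alpha}k\xrightarrow{\beta}v$ and replacing each arrow $a$ incident to $k$ by an opposite arrow $a^*$; $\mu_kQ$ is obtained by then removing a maximal collection of disjoint oriented $2$-cycles. Seeds. The mutation at $k$ of a seed $(Q\mid\underline u)$ is $(\mu_kQ\mid\underline u^{\mathrm{new}})$, where $u_k$ is replaced by $u_k^{-1}(\prod_iu_i^{Q(i,k)}+\prod_iu_i^{Q(k,i)})$ and other variables are unchanged. $\mathrm{FZ}_{\mathbf{k},i}(\underline x)$ is the $i$-th variable of $\mu_{k_l}\cdots\mu_{k_1}(Q\mid(x_1,\dots,x_n))$, and $\mathrm{FZ}^{\mathrm{pf}}_{\mathbf{k},i}(\underline X)$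 the variable at $i$ of $\mu_{k_l}\cdots\mu_{k_1}(Q^{\mathrm{pf}}\mid\underline X)$, with initial variables $X_j,X_{j^*}$ ($j\in I$). The $F$-polynomial is $F_{\mathbf{k},i}(\underline y):=\mathrm{FZ}^{\mathrm{pf}}_{\mathbf{k},i}(\underline X)|_{X_j=1,\,X_{j^*}=y_j}$. The $g$-vector $g_{\mathbf{k},i}\in\mathbb{Z}^n$ is characterized by $\mathrm{FZ}_{\mathbf{k},i}(\underline x)=\mathbf{x}^{g_{\mathbf{k},i}}\cdot F_{\mathbf{k},i}(y_1^{-1},\dots,y_n^{-1})$, where $y_j=\prod_ix_i^{\bar Q(i,j)}$ and $\mathbf{x}^{g}=\prod_ix_i^{g_i}$. ${}^{\mathrm t}g_{\mathbf{k},i}$ is the $i$-th row of the matrix whose columns are the $g$-vectors: $({}^{\mathrm t}g_{\mathbf{k},i})_j:=(g_{\mathbf{k},j})_i$. QP mutation. A finite potential $W$ is a finite linear combination of oriented cycles (up to rotation); a potential on $Q$ is also one on $Q^{\mathrm{pf}}$. The Jacobi algebra is $\mathbb{C}Q/\langle\partial_aW\rangle$ with $\partial_a(a_1\cdots a_m)=\sum_i\delta_{a,a_i}a_{i+1}\cdots a_ma_1\cdots a_{i-1}$. $\mu_k^{\mathrm{pre}}W:=[W]+\Delta$, where $[W]$ replaces each composition of $\alpha,\beta$ through $k$ by $[\beta\alpha]$ and $\Delta$ is the sum of the $3$-cycles formed by $[\beta\alpha],\beta^*,\alpha^*$. Two finite QPs are right f-equivalent if there is an algebra isomorphism of their (uncompleted)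 path algebras, fixing vertices, taking one potential to the other. A potential is reduced if it has no cycles of length $<3$; a QP is trivial if its Jacobi algebra is spanned by the vertex idempotents. A finite QP is f-reducible if right f-equivalent to a direct sum (union of arrow sets, sum of potentials) of a finite reduced QP and a finite trivial QP; $\mu_k(Q,W)$ is the reduced part of $(\mu_k^{\mathrm{pre}}Q,\mu_k^{\mathrm{pre}}W)$. $(Q,W)$ is f-mutatable at $k$ if $(\mu_k^{\mathrm{pre}}Q,\mu_k^{\mathrm{pre}}W)$ is f-reducible and the quiver of $\mu_k(Q,W)$ is $\mu_kQ$; it is successively f-mutatable with respect to $\mathbf{k}$ if $\mu_{k_{s-1}}\cdots\mu_{k_1}(Q,W)$ is f-mutatable at $k_s$ for all $s\le l$. *)

(* Defs.v *)
From HB Require Import structures.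
From mathcomp Require Import all_boot all_order all_algebra.
From mathcomp Require Import generic_quotient fraction freeg mpoly.

Set Implicit Arguments.
Unset Strict Implicit.
Unset Printing Implicit Defensive.

Import GRing.Theory.

Local Open Scope ring_scope.
Local Open Scope quotient_scope.

Local Notation "x %:F" := (tofrac x) : ring_scope.

(* -------------------------------------------------------------------- *)
Record quiver (V : finType) := Quiver {
  arrow : finType;
  src : arrow -> V;
  tgt : arrow -> V
}.

Section Quivers.
Context {V : finType}.
Implicit Types (P Q : quiver V) (k : V).

Definition narrows Q (i j : V) : nat :=
  #|[set a : arrow Q | (src a == i) && (tgt a == j)]|.

Definition Qbar Q (i j : V) : int := (narrows Q j i)%:Z - (narrows Q i j)%:Z.

Definition loop_free Q := forall a : arrow Q, src a != tgt a.

Definition two_cycle_free Q :=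
  forall a b : arrow Q, a != b -> ~~ ((src a == tgt b) && (tgt a == src b)).

(* Isomorphisms are the identity on vertices. *)
Definition quiver_iso P Q :=
  exists2 f : arrow P -> arrow Q, bijective f &
    forall a, src (f a) = src a /\ tgt (f a) = tgt a.

(* The arrow [beta alpha] is [inr (beta, alpha)]; the arrow [inl a] is a
   itself if a is not incident to k, and the opposite arrow a^* otherwise. *)
Definition through Q k :=
  {p : arrow Q * arrow Q | (src p.1 == k) && (tgt p.2 == k)}.

Definition incident Q k (a : arrow Q) := (src a == k) || (tgt a == k).

Definition mu_pre k Q : quiver V :=
  @Quiver V (arrow Q + through Q k)%type
    (fun x => match x with
              | inl a => if incident k a then tgt a else src a
              | inr p => src (val p).2
              end)
    (fun x => match x with
              | inl a => if incident k a then src a else tgt a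
              | inr p => tgt (val p).1
              end).

Definition is_two_cycle Q (c : {set arrow Q}) : bool :=
  [exists a, exists b,
    [&& a != b, src a == tgt b, tgt a == src b & c == [set a; b]]].

Definition disjoint_two_cycles Q (C : {set {set arrow Q}}) : bool :=
  [forall c in C, is_two_cycle c] && trivIset C.

(* The choice of the maximal collection only affects the result up to
   [quiver_iso]. *)
Definition max_two_cycles Q : {set {set arrow Q}} :=
  odflt set0 [pick C | maxset (@disjoint_two_cycles Q) C].

Definition cancel_two_cycles Q : quiver V :=
  @Quiver V {a : arrow Q | a \notin cover (max_two_cycles Q)}
    (fun a => src (val a)) (fun a => tgt (val a)).

Definition mu k Q : quiver V := cancel_two_cycles (mu_pre k Q).

End Quivers.

(* Principal framing: [inl i] is the vertex i, [inr i] is the vertex i^*. *)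
Definition framed (I : finType) (Q : quiver I) : quiver (I + I)%type :=
  @Quiver (I + I)%type (arrow Q + I)%type
    (fun x => match x with inl a => inl (src a) | inr i => inr i end)
    (fun x => match x with inl a => inl (tgt a) | inr i => inl i end).

(* -------------------------------------------------------------------- *)
Section Paths.
Context {V : finType} (Q : quiver V).

(* Paths compose from right to left, like maps: the word a_1 ... a_m is a
   path when src a_i = tgt a_(i+1), from src a_m to tgt a_1. *)
Definition composable : rel (arrow Q) := fun a b => src a == tgt b.

(* A path is given by its target and its word; (v, [::]) is the idempotent
   at v. *)
Definition is_qpath (x : V * seq (arrow Q)) : bool :=
  if x.2 is a :: s then (tgt a == x.1) && path composable a s else true.

Record qpath := QPath { qpval :> V * seq (arrow Q); qpvalP : is_qpath qpval }.

HB.instance Definition _ := [isSub for qpval].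
HB.instance Definition _ := [Choice of qpath by <:].

Definition ptgt (p : qpath) : V := p.1.
Definition word (p : qpath) : seq (arrow Q) := p.2.
Definition psrc (p : qpath) : V := last (ptgt p) (map (@src V Q) (word p)).

Definition qpcomp (p q : qpath) : option qpath :=
  if psrc p == ptgt q then insub (ptgt p, word p ++ word q) else None.

Lemma is_qpath_cat v s t :
  is_qpath (v, s ++ t) =
  is_qpath (v, s) && is_qpath (last v (map (@src V Q) s), t).
Proof.
rewrite /is_qpath /=; case: s => [|a s] //=.
rewrite cat_path last_map -andbA; congr (_ && (_ && _)).
by case: t => //= b t; rewrite /composable eq_sym.
Qed.

Definition qpidem (v : V) : qpath := @QPath (v, [::]) isT.

Lemma qpcompS p q (r : qpath) :
  (qpcomp p q = Some r) <->
  (psrc p = ptgt q /\ qpval r = (ptgt p, word p ++ word q)).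
Proof.
rewrite /qpcomp; case: eqP => [e|ne]; last by split=> // -[].
have ok : is_qpath (ptgt p, word p ++ word q).
  rewrite is_qpath_cat -/(psrc p) e.
  by case: p {e} => -[? ?] /= ->; case: q => -[? ?] /= ->.
case: insubP => [u _ eu|]; last by rewrite ok.
split=> [[<-]|[_ er]]; first by split.
by congr Some; apply: val_inj; rewrite /= eu er.
Qed.

Lemma qpcompN p q : psrc p <> ptgt q -> qpcomp p q = None.
Proof. by rewrite /qpcomp; case: eqP. Qed.

Lemma qpcomp_ex p q : psrc p = ptgt q -> exists r, qpcomp p q = Some r.
Proof.
move=> e; have ok : is_qpath (ptgt p, word p ++ word q).
  rewrite is_qpath_cat -/(psrc p) e.
  by case: p {e} => -[? ?] /= ->; case: q => -[? ?] /= ->.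
by exists (QPath ok); apply/qpcompS.
Qed.

Lemma qpcomp_src p q r : qpcomp p q = Some r -> psrc r = psrc q.
Proof.
move/qpcompS => [e er].
rewrite /psrc /ptgt /word er /= map_cat last_cat.
by move: e; rewrite /psrc /ptgt /word => ->.
Qed.

Lemma qpcomp_tgt p q r : qpcomp p q = Some r -> ptgt r = ptgt p.
Proof. by move/qpcompS => [e er]; rewrite /ptgt er. Qed.

Lemma qpcompA p q r :
  obind (qpcomp p) (qpcomp q r) = obind (qpcomp^~ r) (qpcomp p q).
Proof.
have [epq|npq] := (psrc p =P ptgt q); have [eqr|nqr] := (psrc q =P ptgt r).
- have [u eu] := qpcomp_ex epq; have [w ew] := qpcomp_ex eqr.
  rewrite eu ew /=.
  have /qpcomp_ex[x ex] : psrc u = ptgt r by rewrite (qpcomp_src eu).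
  rewrite ex; apply/qpcompS; split; first by rewrite (qpcomp_tgt ew).
  move/qpcompS: ex => [_ ->]; move/qpcompS: eu => [_ eu].
  by move/qpcompS: ew => [_ ew]; rewrite /ptgt /word eu ew /= catA.
- rewrite (qpcompN nqr) /=; have [u eu] := qpcomp_ex epq.
  by rewrite eu /= qpcompN // (qpcomp_src eu).
- rewrite (qpcompN npq) /=; have [w ew] := qpcomp_ex eqr.
  by rewrite ew /= qpcompN // (qpcomp_tgt ew).
- by rewrite (qpcompN npq) (qpcompN nqr).
Qed.

Lemma qpcomp1p v p :
  qpcomp (qpidem v) p = if v == ptgt p then Some p else None.
Proof.
case: eqP => [e|]; last by move=> ne; rewrite qpcompN.
by apply/qpcompS; split=> //=; rewrite e /ptgt /word; case: (qpval p).
Qed.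

Lemma qpcompp1 v p :
  qpcomp p (qpidem v) = if v == psrc p then Some p else None.
Proof.
case: eqP => [e|ne]; last by rewrite qpcompN // => e; case: ne; rewrite e.
by apply/qpcompS; split=> //=; rewrite cats0 /ptgt /word; case: (qpval p).
Qed.

End Paths.

(* -------------------------------------------------------------------- *)
Section FreegLinear.
Context (K : fieldType) (T : choiceType) (M : lmodType K).

Lemma fglift_is_linear (f : T -> M) : linear (fglift f).
Proof.
have addf : {morph fglift f : x y / x - y} := lift_is_additive f.
have f0 : fglift f 0 = 0 by rewrite -(subrr 0) addf subrr.
have fN x : fglift f (- x) = - fglift f x by rewrite -sub0r addf f0 sub0r.
have fD x y : fglift f (x + y) = fglift f x + fglift f y.
  by rewrite -[y in LHS]opprK addf fN opprK.
have fS (I : Type) (r : seq I) F :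
    fglift f (\sum_(i <- r) F i) = \sum_(i <- r) fglift f (F i).
  by elim: r => [|i r IH]; rewrite ?big_nil // !big_cons fD IH.
move=> c x y; rewrite fD; congr (_ + _).
rewrite -[x in RHS]freeg_sumE [_ *: x]/(fgscale c x) /fgscale !fS scaler_sumr.
by apply: eq_bigr => z _; rewrite !liftU scalerA.
Qed.

HB.instance Definition _ (f : T -> M) :=
  GRing.isLinear.Build K {freeg T / K} M *:%R (fglift f) (fglift_is_linear f).

Lemma fgliftE (f : T -> M) x :
  fglift f x = \sum_(t <- dom x) coeff t x *: f t.
Proof.
rewrite -[x in LHS]freeg_sumE linear_sum.
by apply: eq_bigr => t _; exact: liftU.
Qed.

Lemma fgliftU1 (f : T -> M) t : fglift f << t >> = f t.
Proof. by rewrite liftU scale1r. Qed.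

Lemma freegZE c (t : T) : << c *g t >> = c *: << t >> :> {freeg T / K}.
Proof. by apply/eqP/freeg_eqP => x; rewrite coeffZ !coeffU mul1r. Qed.

Lemma eq_linear_freeg (f g : {linear {freeg T / K} -> M}) :
  (forall t, f << t >> = g << t >>) -> forall x, f x = g x.
Proof.
move=> efg x; rewrite -[x]freeg_sumE !linear_sum.
by apply: eq_bigr => t _; rewrite freegZE !linearZ /= efg.
Qed.

End FreegLinear.

(* -------------------------------------------------------------------- *)
Section PathAlgebra.
Context (K : fieldType) {V : finType} (Q : quiver V).

Definition path_algebra := {freeg (qpath Q) / K}.

HB.instance Definition _ :=
  GRing.Lmodule.copy path_algebra {freeg (qpath Q) / K}.

Definition pvec (o : option (qpath Q)) : path_algebra :=
  if o is Some p then << p >> else 0.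

Definition pamul (x y : path_algebra) : path_algebra :=
  fglift (fun p => fglift (fun q => pvec (qpcomp p q)) y) x.

(* The idempotent e_v. *)
Definition idem (v : V) : path_algebra := << qpidem Q v >>.

Definition paone : path_algebra := \sum_v idem v.

Lemma pamulUl p y : pamul << p >> y = fglift (fun q => pvec (qpcomp p q)) y.
Proof. by rewrite /pamul fgliftU1. Qed.

Lemma pamul_linl y : linear (pamul^~ y).
Proof. by move=> c x x' /=; rewrite /pamul linearP. Qed.

Lemma pamul_linr x : linear (pamul x).
Proof.
move=> c y y'; rewrite /pamul !(fgliftE _ x) scaler_sumr -big_split.
by apply: eq_bigr => p _; rewrite linearP scalerDr !scalerA mulrC.
Qed.


HB.instance Definition _ x := GRing.isLinear.Build K path_algebra path_algebra
  *:%R (pamul x) (pamul_linr x).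

Definition pamulr y x := pamul x y.
HB.instance Definition _ y := GRing.isLinear.Build K path_algebra path_algebra
  *:%R (pamulr y) (pamul_linl y).

Lemma pamulUU p q : pamul << p >> << q >> = pvec (qpcomp p q).
Proof. by rewrite pamulUl fgliftU1. Qed.

Lemma pamul0r x : pamul x 0 = 0. Proof. exact: linear0. Qed.
Lemma pamul0l x : pamul 0 x = 0. Proof. exact: (linear0 (pamulr x)). Qed.

Lemma pamulA : associative pamul.
Proof.
move=> x y z.
apply: (eq_linear_freeg (f := pamulr (pamul y z) : {linear _ -> path_algebra})
  (g := pamulr z \o pamulr y : {linear _ -> path_algebra}) _ x) => p /=.
rewrite /pamulr.
apply: (eq_linear_freeg
  (f := pamul << p >> \o pamulr z : {linear _ -> path_algebra})
  (g := pamulr z \o pamul << p >> : {linear _ -> path_algebra}) _ y) => q /=.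
rewrite /pamulr.
apply: (eq_linear_freeg
  (f := pamul << p >> \o pamul << q >> : {linear _ -> path_algebra})
  (g := pamul (pamul << p >> << q >>) : {linear _ -> path_algebra}) _ z) => r /=.
rewrite !pamulUU; move: (qpcompA p q r).
case: (qpcomp q r) => [u|]; case: (qpcomp p q) => [w|] /=.
- by rewrite !pamulUU => ->.
- by rewrite !pamulUU pamul0l => ->.
- by rewrite !pamulUU pamul0r => <-.
- by rewrite pamul0l pamul0r.
Qed.

Lemma pamul1l : left_id paone pamul.
Proof.
move=> x; apply: (eq_linear_freeg (f := pamul paone : {linear _ -> path_algebra})
  (g := idfun : {linear _ -> path_algebra}) _ x) => p /=.
rewrite -/(pamulr _ _) linear_sum (bigD1 (ptgt p)) //= big1 => [|v /negbTE ne].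
  by rewrite addr0 /pamulr pamulUU qpcomp1p eqxx.
by rewrite /pamulr pamulUU qpcomp1p ne.
Qed.

Lemma pamul1r : right_id paone pamul.
Proof.
move=> x; apply: (eq_linear_freeg
  (f := pamulr paone : {linear _ -> path_algebra})
  (g := idfun : {linear _ -> path_algebra}) _ x) => p /=.
rewrite /pamulr linear_sum (bigD1 (psrc p)) //= big1 => [|v /negbTE ne].
  by rewrite addr0 pamulUU qpcompp1 eqxx.
by rewrite pamulUU qpcompp1 ne.
Qed.

Lemma pamulDl : left_distributive pamul +%R.
Proof. by move=> x y z; exact: (linearD (pamulr z)). Qed.

Lemma pamulDr : right_distributive pamul +%R.
Proof. by move=> x y z; exact: linearD. Qed.

HB.instance Definition _ := GRing.Zmodule_isPzRing.Build path_algebra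
  pamulA pamul1l pamul1r pamulDl pamulDr.

End PathAlgebra.

(* -------------------------------------------------------------------- *)
Section Necklaces.
Context {V : finType} (Q : quiver V).

Definition is_cycle (s : seq (arrow Q)) : bool :=
  (s != [::]) && cycle (@composable V Q) s.

Record cycle_word := CycleWord {
  cwval :> seq (arrow Q);
  cwvalP : is_cycle cwval
}.

HB.instance Definition _ := [isSub for cwval].
HB.instance Definition _ := [Choice of cycle_word by <:].

Definition rotation_eq (s t : cycle_word) : bool :=
  [exists i : 'I_(size s).+1, rot i s == t :> seq _].

Lemma rotation_eqP (s t : cycle_word) :
  reflect (exists i, rot i s = t :> seq _) (rotation_eq s t).
Proof.
apply: (iffP existsP) => [[i /eqP e]|[i e]]; first by exists i.
have [lt|ge] := ltnP i (size s).
  by exists (Ordinal (leqW lt)); rewrite /= e.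
by exists ord0; rewrite /= rot0 -e rot_oversize.
Qed.

Lemma rotation_eq_refl : reflexive rotation_eq.
Proof. by move=> s; apply/rotation_eqP; exists 0%N; rewrite rot0. Qed.

Lemma rotation_eq_sym : ssrbool.symmetric rotation_eq.
Proof.
suff imp s t : rotation_eq s t -> rotation_eq t s.
  by move=> s t; apply/idP/idP; exact: imp.
case/rotation_eqP => i e; apply/rotation_eqP; exists (size t - i)%N.
by rewrite -e; exact: rotK.
Qed.

Lemma rotation_eq_trans : transitive rotation_eq.
Proof.
move=> t s u /rotation_eqP[i ei] /rotation_eqP[j ej].
apply/rotation_eqP; rewrite -ej -ei.
have [lei|/ltnW gei] := leqP i (size s); last first.
  by exists j; rewrite (rot_oversize gei).
have [lej|/ltnW gej] := leqP j (size s); last first.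
  by exists i; rewrite (@rot_oversize _ j) // size_rot.
rewrite (rot_add_mod lei lej).
by case: leqP => _; eexists.
Qed.

Canonical rotation_equiv :=
  EquivRel rotation_eq rotation_eq_refl rotation_eq_sym rotation_eq_trans.

Definition necklace := {eq_quot rotation_eq}.

HB.instance Definition _ := Choice.on necklace.
HB.instance Definition _ := Quotient.on necklace.

Definition nword (c : necklace) : seq (arrow Q) := cwval (repr c).

End Necklaces.

Section Potentials.
Context (K : fieldType) {V : finType} (Q : quiver V).

Definition potential := {freeg (necklace Q) / K}.

HB.instance Definition _ :=
  GRing.Lmodule.copy potential {freeg (necklace Q) / K}.

(* The potential given by a word, which is 0 unless the word is an
   oriented cycle. *)
Definition cyc (s : seq (arrow Q)) : potential :=
  if insub s is Some w then << \pi_(necklace Q) w >> else 0.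

(* The path with target v and word s, 0 if there is no such path. *)
Definition path_of (v : V) (s : seq (arrow Q)) : path_algebra K Q :=
  pvec K (insub (v, s)).

Definition path_of_potential (W : potential) : path_algebra K Q :=
  fglift (fun c => if nword c is a :: s then path_of (tgt a) (a :: s) else 0) W.

(* The class of an element of the path algebra up to rotation: the paths
   that are not cycles vanish.  So do the trivial paths, which an isomorphism
   fixing the vertices never creates when there are no loops. *)
Definition potential_of_path (x : path_algebra K Q) : potential :=
  fglift (fun p => cyc (word p)) x.

Definition cyclic_derivative (a : arrow Q) (W : potential) : path_algebra K Q :=
  fglift (fun c =>
    \sum_(i < size (nword c) | nth a (nword c) i == a)
       path_of (src a) (behead (rot i (nword c)))) W.

Definition in_jacobian_ideal (W : potential) (x : path_algebra K Q) :=
  exists s : seq (path_algebra K Q * arrow Q * path_algebra K Q),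
    x = \sum_(t <- s) t.1.1 * cyclic_derivative t.1.2 W * t.2.

(* The Jacobi algebra is spanned by the classes of the idempotents. *)
Definition trivial_potential (W : potential) :=
  forall x : path_algebra K Q, exists c : V -> K,
    in_jacobian_ideal W (x - \sum_v c v *: idem K Q v).

Definition reduced_potential (W : potential) :=
  forall c, c \in dom W -> (3 <= size (nword c))%N.

End Potentials.

(* To be used with maps f compatible with sources and targets; the words that
   f does not send to cycles are dropped. *)
Definition potential_map (K : fieldType) (V V' : finType) (Q : quiver V)
    (Q' : quiver V') (f : arrow Q -> arrow Q') (W : potential K Q) :
    potential K Q' :=
  fglift (fun c => cyc K (map f (nword c))) W.

(* -------------------------------------------------------------------- *)
Record qp (K : fieldType) (V : finType) := QP {
  qp_quiver : quiver V;
  qp_potential : potential K qp_quiver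
}.

Section QuiversWithPotential.
Context {K : fieldType} {V : finType}.
Implicit Types (P Q : quiver V) (S T : qp K V) (k : V).

(* In a cyclic word neither starting nor ending at k, replace every
   consecutive pair beta alpha through k by the arrow [beta alpha]. *)
Fixpoint contract k Q (s : seq (arrow Q)) : seq (arrow (mu_pre k Q)) :=
  match s with
  | [::] => [::]
  | b :: s1 =>
    match s1 with
    | [::] => [:: inl b]
    | a :: s2 =>
      if (insub (b, a) : option (through Q k)) is Some p
      then inr p :: contract k s2 else inl b :: contract k s1
    end
  end.

(* The word is first rotated so that its target (hence also its source) is
   not k, which is possible since there are no loops at k. *)
Definition bracket k Q (W : potential K Q) : potential K (mu_pre k Q) :=
  fglift (fun c =>
    let s := nword c in
    cyc K (contract k (rot (find (fun a => tgt a != k) s) s))) W.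

(* The 3-cycles alpha^* beta^* [beta alpha]. *)
Definition Delta k Q : potential K (mu_pre k Q) :=
  \sum_(p : through Q k)
    cyc K ([:: inl (val p).2; inl (val p).1; inr p] :
             seq (arrow (mu_pre k Q))).

Definition qp_mu_pre k S : qp K V :=
  QP (bracket k (qp_potential S) + Delta k (qp_quiver S)).

Definition quiver_sum P Q : quiver V :=
  @Quiver V (arrow P + arrow Q)%type
    (fun x => match x with inl a => src a | inr a => src a end)
    (fun x => match x with inl a => tgt a | inr a => tgt a end).

Definition qp_sum S T : qp K V :=
  let P := qp_quiver S in let Q := qp_quiver T in
  @QP K V (quiver_sum P Q)
    (potential_map (inl : arrow P -> arrow (quiver_sum P Q)) (qp_potential S) +
     potential_map (inr : arrow Q -> arrow (quiver_sum P Q)) (qp_potential T)).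

Definition right_f_equivalent S T :=
  exists phi : {rmorphism path_algebra K (qp_quiver S) ->
                          path_algebra K (qp_quiver T)},
    [/\ scalable phi, bijective phi,
        forall v, phi (idem K (qp_quiver S) v) = idem K (qp_quiver T) v &
        potential_of_path (phi (path_of_potential (qp_potential S))) =
          qp_potential T].

(* R is a reduced part of S.  It is not claimed to be unique. *)
Definition is_reduced_part S R :=
  reduced_potential (qp_potential R) /\
  exists2 T, trivial_potential (qp_potential T) &
             right_f_equivalent S (qp_sum R T).

(* R is mu_k S and the quiver of R is mu_k of the quiver of S: S is
   f-mutatable at k when there is such an R. *)
Definition is_f_mutation k S R :=
  is_reduced_part (qp_mu_pre k S) R /\
  quiver_iso (qp_quiver R) (mu k (qp_quiver S)).

Fixpoint successively_f_mutatable S (ks : seq V) : Prop :=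
  if ks is k :: ks' then
    exists2 R, is_f_mutation k S R & successively_f_mutatable R ks'
  else True.

End QuiversWithPotential.

Definition framed_qp (K : fieldType) (I : finType) (Q : quiver I)
    (W : potential K Q) : qp K (I + I)%type :=
  @QP K (I + I)%type (framed Q)
    (potential_map (inl : arrow Q -> arrow (framed Q)) W).

(* -------------------------------------------------------------------- *)
Section Seeds.
Context {V : finType} {F : fieldType}.

Record seed := Seed { seed_quiver : quiver V; seed_var : V -> F }.

Definition seed_mu (k : V) (s : seed) : seed :=
  let: Seed Q u := s in
  Seed (mu k Q) (fun j =>
    if j == k then
      (u k)^-1 * (\prod_i u i ^+ narrows Q i k + \prod_i u i ^+ narrows Q k i)
    else u j).

(* The mutation at the first vertex of the sequence is applied first. *)
Definition seed_mu_seq (ks : seq V) (s : seed) : seed :=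
  foldl (fun s k => seed_mu k s) s ks.

End Seeds.

Section GVectors.
Context {n : nat}.
Implicit Types (Q : quiver 'I_n) (ks : seq 'I_n) (i : 'I_n).

(* The mutations have integer coefficients, so that all the identities between
   cluster variables live over the rationals. *)
Definition ratfun (m : nat) := {fraction {mpoly rat[m]}}.

Definition FZ Q ks i : ratfun n :=
  seed_var (seed_mu_seq ks (Seed Q (fun j => ('X_j)%:F))) i.

(* The variable of index [lshift n j] is X_j, that of index [rshift n j] is
   X_(j^* ). *)
Definition FZ_pf Q ks i : ratfun (n + n) :=
  seed_var (seed_mu_seq [seq inl k | k <- ks]
    (Seed (framed Q) (fun v => match v with
                               | inl j => ('X_(lshift n j))%:F
                               | inr j => ('X_(rshift n j))%:F
                               end))) (inl i).

(* The substitution X_j := 1, X_(j^* ) := y_j. *)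
Definition pf_subst : (n + n).-tuple {mpoly rat[n]} :=
  [tuple match split v with inl _ => 1 | inr j => 'X_j end | v < n + n].

(* F is obtained from the rational function f by the above substitution:
   f can be written with a denominator that does not vanish under it. *)
Definition specializes_to (f : ratfun (n + n)) (F : {mpoly rat[n]}) :=
  exists p q : {mpoly rat[n + n]},
    [/\ q \mPo pf_subst != 0, f = p%:F / q%:F &
        F * (q \mPo pf_subst) = p \mPo pf_subst].

Definition is_F_polynomial Q ks i (F : {mpoly rat[n]}) :=
  specializes_to (FZ_pf Q ks i) F.

Definition xmonomial (g : 'I_n -> int) : ratfun n :=
  \prod_i (('X_i)%:F : ratfun n) ^ g i.

Definition yvar Q (j : 'I_n) : ratfun n := xmonomial (fun i => Qbar Q i j).

Definition is_g_vector Q ks i (g : 'cV[int]_n) :=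
  exists2 F, is_F_polynomial Q ks i F &
    FZ Q ks i =
      xmonomial (fun j => g j 0) * mmap ratr (fun j => (yvar Q j)^-1) F.

End GVectors.

(* Main.v *)
(* The g-vectors are identified with the weights (the class of the generators
   minus that of the relations) of two-term complexes P_- -> P_+ of projective
   modules over the Jacobian algebra.  A family of such complexes, pairwise
   without morphisms to shifts, has sign-coherent weights: after cancelling the
   invertible entries at a vertex v, two complexes with e_v P_+ in the first one
   and e_v P_- in the second one would have a nonzero Hom(f, g[1]).

   Mutation of a quiver with potential carries a compatible family to a
   compatible family whose weights are given by the piecewise linear rule
   [mut_step].  Since the mutations are only finite, all this is done modulo
   every power of the arrow ideal instead of over a completed algebra.
   Starting from the projectives at the time s and mutating up to t gives an
   integer matrix D_(s,t); starting from the shifted projectives at the time t and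
   mutating back to s gives -R_(s,t).  All the rows of these matrices are
   sign-coherent, and by the tropical duality of Nakanishi and Zelevinsky,
   R_(s,t) D_(s,t) = 1, by induction on t - s.

   On the other hand D_(0,t) is the C-matrix, so that the separation formula,
   checked at every positive rational point, shows that the inverse of D_(0,t)
   is the matrix of the g-vectors.  Hence the latter is R_(0,l), whose rows are
   sign-coherent. *)

Require Import Defs.
From HB Require Import structures.
From mathcomp Require Import all_boot all_order all_algebra.
From mathcomp Require Import boolp reals complex.
From mathcomp Require Import generic_quotient fraction freeg mpoly.
From mathcomp Require Import zify ring.

Set Implicit Arguments.
Unset Strict Implicit.
Unset Printing Implicit Defensive.

Import Order.TTheory GRing.Theory Num.Theory.
Local Open Scope ring_scope.
Local Open Scope quotient_scope.

(** Cancelling an entry of a presentation requires the corner of the algebra at the vertex to be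
    local, which an uncompleted Jacobian algebra need not be; modulo a power of the arrow ideal it
    is. Such a quotient is not stable under mutation: a pair of arrows through k may become a single
    arrow, so that lengths are halved. Hence a family is required at every precision N, with weights
    independent of N, and the step to precision N starts from 2N + 1.

    A mutation gives no map between the Jacobian algebras, only one between their parts away from k;
    the projective at k has to be rebuilt from the arrows at k. This works when k labels no relation
    or, dually, no generator, and sign-coherence at k ensures that one of the two holds for all
    members of a compatible family at once. So coherence is both the result and what makes each step
    possible.

    D is defined by extension of the window at t and R by extension at s. The duality is therefore
    proved for all windows, the extension at the opposite end being read off from shorter ones. *)

Lemma choice_on (X Y : Type) (y0 : Y) (C : X -> Prop) (P : X -> Y -> Prop) :
  (forall x, C x -> exists y, P x y) ->
  exists F : X -> Y, forall x, C x -> P x (F x).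
Proof.
move=> ex; have /choice[F FP] : forall x, exists y, C x -> P x y.
  by move=> x; case: (pselect (C x)) => [/ex[y Py]|nC]; [exists y | exists y0].
by exists F.
Qed.

(** * Presentations over a ring with idempotents *)

Section Typed.
Variables (V : finType) (B : pzRingType) (e : V -> B).
Hypothesis eE : forall u v, e u * e v = if u == v then e u else 0.

Definition typed (u v : V) (x : B) := e u * x * e v = x.

Lemma typedl u v x : typed u v x -> e u * x = x.
Proof. by move=> <-; rewrite !mulrA eE eqxx. Qed.

Lemma typedr u v x : typed u v x -> x * e v = x.
Proof. by move=> <-; rewrite -!mulrA eE eqxx. Qed.

Lemma typedP u v x : e u * x = x -> x * e v = x -> typed u v x.
Proof. by rewrite /typed => -> ->. Qed.

Lemma typed0 u v : typed u v 0.
Proof. by rewrite /typed mulr0 mul0r. Qed.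

Lemma typedD u v x y : typed u v x -> typed u v y -> typed u v (x + y).
Proof. by rewrite /typed mulrDr mulrDl => -> ->. Qed.

Lemma typedN u v x : typed u v x -> typed u v (- x).
Proof. by rewrite /typed mulrN mulNr => ->. Qed.

Lemma typedB u v x y : typed u v x -> typed u v y -> typed u v (x - y).
Proof. by move=> tx ty; apply/typedD/typedN. Qed.

Lemma typed_sum u v (I : Type) (r : seq I) (P : pred I) F :
  (forall i, P i -> typed u v (F i)) -> typed u v (\sum_(i <- r | P i) F i).
Proof. by move=> tF; apply: big_ind => //; [exact: typed0 | exact: typedD]. Qed.

Lemma typedM u v v' w x y : typed u v x -> typed v' w y -> typed u w (x * y).
Proof.
move=> tx ty; apply: typedP; first by rewrite mulrA (typedl tx).
by rewrite -mulrA (typedr ty).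
Qed.

Lemma typed_idem u : typed u u (e u).
Proof. by rewrite /typed !eE eqxx eE eqxx. Qed.

(* A presentation is the matrix of a map between projective modules: the
   active rows are the relations, the active columns the generators. *)
Record pres := Pres {
  rix : finType; cix : finType;
  rlab : rix -> V; clab : cix -> V;
  ract : {set rix}; cact : {set cix};
  pmx : rix -> cix -> B }.

Definition ptyped (f : pres) :=
  forall p q, typed (rlab p) (clab q) (pmx (p := f) p q).

Definition net (f : pres) (v : V) : int :=
  (#|[set q in cact f | clab q == v]|)%:Z -
  (#|[set p in ract f | rlab p == v]|)%:Z.

(* The vanishing of Hom(f, g[1]) in the homotopy category. *)
Definition compat (f g : pres) :=
  forall h : rix f -> cix g -> B,
    (forall p q, typed (rlab p) (clab q) (h p q)) ->
  exists (y : cix f -> cix g -> B) (x : rix f -> rix g -> B),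
    [/\ forall p q, typed (clab p) (clab q) (y p q),
        forall p q, typed (rlab p) (rlab q) (x p q) &
        forall p q, p \in ract f -> q \in cact g ->
          h p q = \sum_(q' in cact f) pmx p q' * y q' q +
                  \sum_(p' in ract g) x p p' * pmx p' q].

(** * Gaussian elimination of an invertible entry *)

Section Elimination.
Variables (f : pres) (p0 : rix f) (q0 : cix f) (k : V) (w : B).
Hypotheses (ft : ptyped f) (p0f : p0 \in ract f) (q0f : q0 \in cact f).
Hypotheses (p0k : rlab p0 = k) (q0k : clab q0 = k) (wt : typed k k w).
Hypotheses (fw : pmx p0 q0 * w = e k) (wf : w * pmx p0 q0 = e k).

(** The Schur complement of the pivot: up to homotopy it splits off a contractible summand P_k ->
    P_k. The index types stay the same and only the active sets shrink, so that labels and typing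
    are untouched. *)
Definition elim_pres : pres :=
  Pres (@rlab f) (@clab f) (ract f :\ p0) (cact f :\ q0)
    (fun p q => pmx p q - pmx p q0 * w * pmx p0 q).

Lemma elim_typed : ptyped elim_pres.
Proof.
move=> p q /=; apply: typedB; first exact: ft.
apply: typedM (ft p0 q); apply: (typedM (ft p q0)); exact: wt.
Qed.

Lemma elim_net v : net elim_pres v = net f v.
Proof.
rewrite /net /=.
have cE : #|[set q in cact f | clab q == v]| =
    ((k == v) + #|[set q in cact f :\ q0 | clab q == v]|)%N.
  rewrite (cardsD1 q0) inE q0f q0k; congr (_ + _)%N; apply: eq_card => q.
  by rewrite !inE andbA.
have rE : #|[set q in ract f | rlab q == v]| =
    ((k == v) + #|[set q in ract f :\ p0 | rlab q == v]|)%N.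
  rewrite (cardsD1 p0) inE p0f p0k; congr (_ + _)%N; apply: eq_card => q.
  by rewrite !inE andbA.
by rewrite cE rE !PoszD opprD addrACA subrr add0r.
Qed.

(** A map h on the remaining rows is extended by 0 to the row p0. In a homotopy for the extension,
    the row p0 expresses y at q0 by the other entries, because w inverts the pivot; substituting
    this in the other rows produces the Schur complement and a corrected x. *)
Lemma elim_compatl g : ptyped g -> compat f g -> compat elim_pres g.
Proof.
move=> gt fg h ht.
pose h1 p q := if p == p0 then 0 else h p q.
have [|y [x [yt xt E]]] := fg h1.
  by move=> p q; rewrite /h1; case: eqP => _; [exact: typed0 | exact: ht].
exists y, (fun p p' => x p p' - pmx p q0 * w * x p0 p'); split=> //.
  move=> p q /=; apply: typedB; first exact: xt.
  by apply: typedM (xt p0 q); apply: (typedM (ft p q0)); exact: wt.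
move=> p q; rewrite 2!inE => /andP[pp0 pf] qg.
have := E _ _ pf qg; rewrite {1}/h1 (negbTE pp0) => ->.
have := E _ _ p0f qg; rewrite {1}/h1 eqxx (big_setD1 q0) //= => E0.
have y0 : y q0 q = - (w * (\sum_(i in cact f :\ q0) pmx p0 i * y i q +
      \sum_(p' in ract g) x p0 p' * pmx p' q)).
  have tq := yt q0 q; rewrite q0k in tq.
  rewrite -(typedl tq) -wf -mulrA; apply/eqP; rewrite -subr_eq0 opprK -mulrDr.
  by rewrite addrA -E0 mulr0.
rewrite (big_setD1 q0) //= y0 mulrN mulrA mulrDr opprD.
under [in RHS]eq_bigr => i _ do rewrite mulrBl.
rewrite sumrB.
under [X in _ = _ + X]eq_bigr => i _ do rewrite mulrBl.
rewrite sumrB [RHS]addrACA -[LHS]addrA [LHS]addrC; congr (_ + (- _ - _)).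
  by rewrite mulr_sumr; apply: eq_bigr => i _; rewrite !mulrA.
by rewrite mulr_sumr; apply: eq_bigr => i _; rewrite !mulrA.
Qed.

(** The same argument on columns: h is extended by 0 to the column q0, which then determines x at
    p0. *)
Lemma elim_compatr g : ptyped g -> compat g f -> compat g elim_pres.
Proof.
move=> gt gf h ht.
pose h1 p q := if q == q0 then 0 else h p q.
have [|y [x [yt xt E]]] := gf h1.
  by move=> p q; rewrite /h1; case: eqP => _; [exact: typed0 | exact: ht].
exists (fun p q => y p q - y p q0 * w * pmx p0 q), x; split=> //.
  move=> p q /=; apply: typedB; first exact: yt.
  by apply: typedM (ft p0 q); apply: (typedM (yt p q0)); exact: wt.
move=> p q pg; rewrite 2!inE => /andP[qq0 qf].
have := E _ _ pg qf; rewrite {1}/h1 (negbTE qq0) => ->.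
have := E _ _ pg q0f; rewrite {1}/h1 eqxx [X in _ + X](big_setD1 p0) //= => E0.
have x0 : x p p0 = - ((\sum_(i in cact g) pmx p i * y i q0 +
      \sum_(p' in ract f :\ p0) x p p' * pmx p' q0) * w).
  have tq := xt p p0; rewrite p0k in tq.
  rewrite -(typedr tq) -fw mulrA; apply/eqP; rewrite -subr_eq0 opprK -mulrDl.
  by rewrite addrCA -E0 mul0r.
rewrite [X in _ + X = _](big_setD1 p0) //= x0 mulNr !mulrDl opprD.
under [X in _ = X + _]eq_bigr => i _ do rewrite mulrBr.
rewrite sumrB.
under [X in _ = _ + X]eq_bigr => i _ do rewrite mulrBr.
rewrite sumrB [RHS]addrACA [X in _ + X = _]addrC [LHS]addrA.
congr (_ + _ + (- _ - _)).
  by rewrite !mulr_suml; apply: eq_bigr => i _; rewrite !mulrA.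
by rewrite !mulr_suml; apply: eq_bigr => i _; rewrite !mulrA.
Qed.

End Elimination.

(** * Reduction at a vertex and the sign dichotomy *)

Section Reduction.
Variables (K : fieldType) (k : V) (sc : B -> K).
Hypotheses (scD : {morph sc : x y / x + y}) (scM : {morph sc : x y / x * y}).
Hypotheses (sck : sc (e k) = 1) (scv : forall v, v != k -> sc (e v) = 0).
Hypothesis sc_inv : forall x, typed k k x -> sc x != 0 ->
  exists w, [/\ typed k k w, x * w = e k & w * x = e k].

Definition reduced_at (f : pres) :=
  forall p q, p \in ract f -> q \in cact f -> rlab p = k -> clab q = k ->
    sc (pmx p q) = 0.

(** Every elimination of an entry from k to k with nonzero scalar part removes an active relation,
    so the process stops. Nothing is cancelled at other vertices, since the mutation at k only
    replaces the projective at k. *)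
Lemma reduce_pres (f : pres) : ptyped f ->
  exists f', [/\ ptyped f', reduced_at f', forall v, net f' v = net f v,
    forall g, ptyped g -> compat f g -> compat f' g &
    forall g, ptyped g -> compat g f -> compat g f'].
Proof.
have [m] := ubnP #|ract f|; elim: m f => // m IH f; rewrite ltnS => lef ft.
have [red|] := pselect (reduced_at f); first by exists f.
move=> /existsNP[p0] /existsNP[q0].
rewrite !not_implyE => -[p0f [q0f [p0k [q0k /eqP nz]]]].
have tx := ft p0 q0; rewrite p0k q0k in tx.
have [w [wt fw wf]] := sc_inv tx nz.
have t1 : ptyped (elim_pres p0 q0 w) by exact: elim_typed ft wt.
have lt : (#|ract (elim_pres p0 q0 w)| < m)%N.
  by rewrite /= (leq_trans _ lef) // [X in (_ < X)%N](cardsD1 p0) p0f.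
have [f' [t' r' n' cl cr]] := IH _ lt t1.
exists f'; split=> // [v|g gt fg|g gt gf].
- by rewrite n' (elim_net w p0f q0f p0k q0k).
- exact/cl/(elim_compatl ft p0f q0f _ wt wf).
- exact/cr/(elim_compatr ft p0f q0f _ wt fw).
Qed.

Lemma sc0 : sc 0 = 0.
Proof. by apply: (addrI (sc 0)); rewrite -scD !addr0. Qed.

Lemma sc_sum (I : Type) (r : seq I) (P : pred I) F :
  sc (\sum_(i <- r | P i) F i) = \sum_(i <- r | P i) sc (F i).
Proof. exact: (big_morph sc scD sc0). Qed.

Lemma sc_typedl u v x : u != k -> typed u v x -> sc x = 0.
Proof. by move=> uk tx; rewrite -(typedl tx) scM scv // mul0r. Qed.

(** The map equal to e_k at the single position (p, q) would be a nonzero class of Hom(f, g[1]):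
    every term of a homotopy has scalar part 0, by reducedness when it passes through a label k and
    because [sc] kills the other idempotents otherwise, while e_k has scalar part 1. *)
Lemma reduced_dichotomy f g p q : ptyped f -> ptyped g -> compat f g ->
  reduced_at f -> reduced_at g -> p \in ract f -> q \in cact g ->
  rlab p = k -> clab q = k -> False.
Proof.
move=> ft gt fg rf rg pf qg pk qk.
pose h p1 q1 := if (p1 == p) && (q1 == q) then e k else 0.
have [|y [x [yt xt E]]] := fg h.
  move=> p1 q1; rewrite /h; case: andP => [[/eqP-> /eqP->]|_]; last exact: typed0.
  by rewrite pk qk; exact: typed_idem.
have := E _ _ pf qg; rewrite /h !eqxx /= => /(congr1 sc).
rewrite sck scD !sc_sum !big1 ?addr0 => [/eqP|p' p'g|q' q'f].
- by rewrite oner_eq0.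
- rewrite scM; have [p'k|p'k] := eqVneq (rlab p') k.
    by rewrite (rg _ _ p'g qg) // mulr0.
  by rewrite (sc_typedl p'k (gt p' q)) mulr0.
- rewrite scM; have [q'k|q'k] := eqVneq (clab q') k.
    by rewrite (rf _ _ pf q'f) // mul0r.
  by rewrite (sc_typedl q'k (yt q' q)) mulr0.
Qed.

End Reduction.
End Typed.

(** * Mutation of presentations *)

Section Mutation.
Variables (V : finType) (B B' : pzRingType) (e : V -> B) (e' : V -> B').
Hypothesis eE : forall u v, e u * e v = if u == v then e u else 0.
Hypothesis eE' : forall u v, e' u * e' v = if u == v then e' u else 0.
Variables (k : V) (I J : finType) (s : I -> V) (t : J -> V).
Hypotheses (sk : forall i, s i != k) (tk : forall j, t j != k).
Variables (al : I -> B) (be : J -> B) (ga : I -> J -> B).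
Hypothesis (bet : forall j, typed e (t j) k (be j)).
Hypothesis (alt : forall i, typed e k (s i) (al i)).
Variables (als : I -> B') (bes : J -> B').
Hypothesis (alst : forall i, typed e' (s i) k (als i)).
Hypothesis (best : forall j, typed e' k (t j) (bes j)).
Variable th : {additive B -> B'}.
Hypothesis th_typed : forall u v x, u != k -> v != k ->
  typed e u v x -> typed e' u v (th x).
Hypothesis thM : forall u v w x y, u != k -> v != k -> w != k ->
  typed e u v x -> typed e v w y -> th (x * y) = th x * th y.
Hypothesis th_surj : forall u v x', u != k -> v != k -> typed e' u v x' ->
  exists2 x, typed e u v x & x' = th x.
Variables (T : Type) (c0 : T) (io : T -> B) (io' : T -> B').
Hypothesis io_comm : forall c x, x * io c = io c * x.
Hypothesis io_comm' : forall c x, x * io' c = io' c * x.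
Hypothesis th_io : forall c j, th (io c * e (t j)) = io' c * e' (t j).
Hypothesis inP : forall v y, v != k -> typed e k v y ->
  exists2 z : I -> B, forall i, typed e (s i) v (z i) &
    y = \sum_i al i * z i.
Hypothesis outP : forall u y, u != k -> typed e u k y ->
  exists2 l : J -> B, forall j, typed e u (t j) (l j) &
    y = \sum_j l j * be j.
Hypothesis loopP : forall y, typed e k k y ->
  exists (c : T) (z : I -> J -> B), (forall i j, typed e (s i) (t j) (z i j)) /\
    y = io c * e k + \sum_i \sum_j al i * z i j * be j.
Hypothesis kerP : forall u (l : J -> B), u != k ->
  (forall j, typed e u (t j) (l j)) -> \sum_j l j * be j = 0 ->
  exists2 m : I -> B, forall i, typed e u (s i) (m i) &
    forall j, th (l j) = \sum_i th (m i) * th (ga i j).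
Hypothesis inP' : forall v y, v != k -> typed e' k v y ->
  exists2 z : J -> B', forall j, typed e' (t j) v (z j) &
    y = \sum_j bes j * z j.
Hypothesis relP : forall i j, als i * bes j = - th (ga i j).
Hypothesis rel_in : forall i, \sum_j bes j * th (be j * al i) = 0.

(** Here [al i] is an arrow from [s i] to k, [be j] an arrow from k to [t j], [als] and [bes] stand
    for their opposites, [ga i j] for the second derivative of the potential along [be j] and
    [al i], and [th] compares the algebras away from k. Every generator at k is replaced by the
    complex P_k -> sum of the P_(t j) with entries [bes j], and so turns into a relation at k; an
    entry in its column is replaced by its coefficients [lam] along the arrows [be j]. Outside the
    intended range the entries are 0. *)
Definition mut_pres (f : pres V B) (lam : rix f -> cix f -> J -> B) : pres V B' :=
  @Pres V B' (rix f + cix f)%type (cix f + cix f * J)%type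
    (fun p => match p with inl p => rlab p | inr _ => k end)
    (fun q => match q with inl q => clab q | inr (_, j) => t j end)
    [set p | match p with inl p => p \in ract f
                        | inr q => (q \in cact f) && (clab q == k) end]
    [set q | match q with inl q => (q \in cact f) && (clab q != k)
                        | inr (q, j) => (q \in cact f) && (clab q == k) end]
    (fun p q => match p, q with
      | inl p, inl q =>
          if (rlab p != k) && (clab q != k) then th (pmx p q) else 0
      | inl p, inr (q, j) =>
          if (rlab p != k) && (clab q == k) then th (lam p q j) else 0
      | inr q1, inr (q, j) => if q1 == q then bes j else 0
      | inr _, inl _ => 0
      end).

Definition out_coef (f : pres V B) (lam : rix f -> cix f -> J -> B) :=
  forall p q, rlab p != k -> clab q = k ->
    (forall j, typed e (rlab p) (t j) (lam p q j)) /\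
    pmx p q = \sum_j lam p q j * be j.

Lemma out_coef_ex f : ptyped e f -> exists lam, @out_coef f lam.
Proof.
move=> ft.
have [lam lamP] := choice_on (Y := J -> B) (fun=> 0)
  (C := fun pq : rix f * cix f => rlab pq.1 != k /\ clab pq.2 = k)
  (P := fun pq l => (forall j, typed e (rlab pq.1) (t j) (l j)) /\
     pmx pq.1 pq.2 = \sum_j l j * be j)
  (fun pq pqP => let: conj pk qk := pqP in
     let: ex_intro2 l lt lE :=
       outP pk (eq_ind _ (fun v => typed e _ v _) (ft pq.1 pq.2) _ qk) in
     ex_intro _ l (conj lt lE)).
by exists (fun p q => lam (p, q)) => p q pk qk; exact: (lamP (p, q)).
Qed.

Section Typing.
Variables (f : pres V B) (lam : rix f -> cix f -> J -> B).
Hypotheses (ft : ptyped e f) (lamP : out_coef lam).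

Lemma mut_typed : ptyped e' (mut_pres lam).
Proof.
move=> [p|q] [q1|[q1 j]] /=.
- by case: andP => [[pk qk]|_]; [exact: th_typed | exact: typed0].
- case: andP => [[pk /eqP qk]|_]; last exact: typed0.
  by have [lt _] := lamP pk qk; apply: th_typed.
- exact: typed0.
- by case: eqP => _; [exact: best | exact: typed0].
Qed.

Lemma mut_net v : (forall p, p \in ract f -> rlab p != k) ->
  net (mut_pres lam) v =
    if v == k then - net f k
    else net f v + net f k * (#|[set j | t j == v]|)%:Z.
Proof.
move=> pk; rewrite /net.
have r0 : #|[set p in ract f | rlab p == k]| = 0%N.
  apply/eqP; rewrite cards_eq0; apply/eqP/setP => p; rewrite !inE.
  by case: (boolP (p \in ract f)) => //= /pk /negbTE.
have cardsum (X Y : finType) (D : {set X + Y}) :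
    #|D| = (#|[set x | inl x \in D]| + #|[set y | inr y \in D]|)%N.
  rewrite -!sum1_card big_sumType /=; congr (_ + _)%N;
    by apply: eq_bigl => z; rewrite !inE.
rewrite !cardsum r0 subr0 /=.
have -> : [set x | inl x \in [set q in ract (mut_pres lam) | rlab q == v]] =
    [set p in ract f | rlab p == v] by apply/setP => p; rewrite !inE.
have -> : [set y | inr y \in [set q in ract (mut_pres lam) | rlab q == v]] =
    [set q in cact f | (clab q == k) && (k == v)].
  by apply/setP => p; rewrite !inE /= andbA.
have -> : [set x | inl x \in [set q in cact (mut_pres lam) | clab q == v]] =
    [set q in cact f | (clab q == v) && (v != k)].
  by apply/setP => q; rewrite !inE -!andbA; case: (clab q =P v) => [->|] //=;
     rewrite ?andbT ?andbF.
have -> : [set y | inr y \in [set q in cact (mut_pres lam) | clab q == v]] =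
    setX [set q in cact f | clab q == k] [set j | t j == v].
  by apply/setP => -[q j]; rewrite !inE.
rewrite cardsX; have [->|vk] := eqVneq v k.
  have -> : [set j | t j == k] = set0.
    by apply/setP => j; rewrite !inE (negbTE (tk j)).
  rewrite cards0 muln0 r0 add0n.
  have -> : [set q in cact f | (clab q == k) && ~~ true] = set0.
    by apply/setP => q; rewrite !inE !andbF.
  rewrite cards0 !add0r; congr (- (Posz _)).
  by apply: eq_card => q; rewrite !inE ?eqxx ?andbT.
have -> : [set q in cact f | (clab q == k) && false] = set0.
  by apply/setP => q; rewrite !inE !andbF.
have -> : [set q in cact f | (clab q == v) && true] =
    [set q in cact f | clab q == v] by apply/setP => q; rewrite !inE andbT.
by rewrite cards0 addn0 PoszD PoszM addrAC.
Qed.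

End Typing.

Lemma sum_mut_gen f lam (M : zmodType) (F : cix (@mut_pres f lam) -> M) :
  \sum_(c in cact (mut_pres lam)) F c =
  \sum_(q in cact f | clab q != k) F (inl q) +
  \sum_(q in cact f | clab q == k) \sum_j F (inr (q, j)).
Proof.
rewrite big_sumType /=; congr (_ + _); first by apply: eq_bigl => q; rewrite inE.
rewrite pair_big_dep /=; apply: eq_big => [[q j]|[q j] _] //.
by rewrite inE andbT.
Qed.

Lemma sum_mut_rel f lam (M : zmodType) (F : rix (@mut_pres f lam) -> M) :
  \sum_(c in ract (mut_pres lam)) F c =
  \sum_(p in ract f) F (inl p) +
  \sum_(q in cact f | clab q == k) F (inr q).
Proof.
by rewrite big_sumType /=; congr (_ + _); apply: eq_bigl => q; rewrite inE.
Qed.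

(** Up to a homotopy, h vanishes on the new relations; what remains lives away from k and lifts
    along [th] to a map between f and g. The homotopy found there has to be transported back: its
    entries at k are expanded along the arrows, and the ambiguity of these expansions lies in the
    kernel of multiplication by the [be j], hence comes from [ga], that is, from products of [als]
    and [bes]. *)
Lemma mut_compat (f g : pres V B) lamf lamg :
  ptyped e f -> ptyped e g -> @out_coef f lamf -> @out_coef g lamg ->
  (forall p, p \in ract f -> rlab p != k) ->
  (forall p, p \in ract g -> rlab p != k) ->
  compat e f g -> compat e' (mut_pres lamf) (mut_pres lamg).
Proof.
move=> ft gt lfP lgP fk gk fg h ht.
pose gl := clab (p := mut_pres lamg).
have clabk c : c \in cact (mut_pres lamg) -> gl c != k.
  by case: c => [q|[q j]]; rewrite inE; [case/andP | move=> _; exact: tk].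
(* The row of a new relation consists of the [bes j], and every entry of h in that row factors
   through them; [eta] is the resulting homotopy. *)
have [eta etaP] := choice_on (Y := J -> B') (fun=> 0)
  (C := fun qc : cix f * cix (mut_pres lamg) =>
     gl qc.2 != k)
  (P := fun qc l => (forall j, typed e' (t j) (gl qc.2) (l j)) /\
     h (inr qc.1) qc.2 = \sum_j bes j * l j)
  (fun qc qcP => let: ex_intro2 l lt lE :=
       inP' qcP (ht (inr qc.1) qc.2) in
     ex_intro _ l (conj lt lE)).
have etat q c j : gl c != k -> typed e' (t j) (gl c) (eta (q, c) j).
  by move=> ck; have [tt _] := etaP (q, c) ck; exact: tt.
pose h1 (p : rix f) c := h (inl p) c -
  \sum_(q in cact f | clab q == k) \sum_j th (lamf p q j) * eta (q, c) j.
have h1t p c : rlab p != k -> gl c != k -> typed e' (rlab p) (gl c) (h1 p c).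
  move=> pk ck; apply: typedB; first exact: (ht (inl p) c).
  apply: typed_sum => q /andP[_ /eqP qk]; apply: typed_sum => j _.
  have [lt _] := lfP _ _ pk qk.
  by apply: (typedM eE') (etat q c j ck); apply: th_typed (lt j).
have [h2 h2P] := choice_on (Y := B) 0
  (C := fun pc : rix f * cix (mut_pres lamg) =>
     rlab pc.1 != k /\ gl pc.2 != k)
  (P := fun pc x => typed e (rlab pc.1) (gl pc.2) x /\ h1 pc.1 pc.2 = th x)
  (fun pc pcP => let: conj pk ck := pcP in
     let: ex_intro2 x xt xE := th_surj pk ck (h1t _ _ pk ck) in
     ex_intro _ x (conj xt xE)).
(* A column q of g at k corresponds to the columns (q, j) of its mutation, which are recombined by
   means of the [be j]. *)
pose h3 p q := if rlab p != k then
    if clab q == k then \sum_j h2 (p, inr (q, j)) * be j else h2 (p, inl q)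
  else 0.
have [|y [x [yt xt E]]] := fg h3.
  move=> p q; rewrite /h3; case: ifPn => [pk|_]; last exact: typed0.
  case: ifPn => [/eqP qk|qk].
    rewrite qk; apply: typed_sum => j _; apply: (typedM eE) (bet j).
    by have [tt _] := h2P (p, inr (q, j)) (conj pk (tk j)); exact: tt.
  by have [tt _] := h2P (p, inl q) (conj pk qk); exact: tt.
have [yd ydP] := choice_on (Y := J -> B) (fun=> 0)
  (C := fun qq : cix f * cix g => clab qq.1 != k /\ clab qq.2 = k)
  (P := fun qq l => (forall j, typed e (clab qq.1) (t j) (l j)) /\
     y qq.1 qq.2 = \sum_j l j * be j)
  (fun qq qqP => let: conj qk qk' := qqP in
     let: ex_intro2 l lt lE :=
       outP qk (eq_ind _ (fun v => typed e _ v _) (yt qq.1 qq.2) _ qk') in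
     ex_intro _ l (conj lt lE)).
(* A loop at k is a scalar plus terms that leave k along some [be j] and return along some [al i].
   The scalar part will be compensated by the entries of [x'] between new relations. *)
have yloop (qq : cix f * cix g) : clab qq.1 = k /\ clab qq.2 = k ->
    exists cz : T * (I -> J -> B),
      (forall i j, typed e (s i) (t j) (cz.2 i j)) /\
      y qq.1 qq.2 = io cz.1 * e k + \sum_i \sum_j al i * cz.2 i j * be j.
  move=> [qk qk']; have := yt qq.1 qq.2; rewrite qk qk' => /loopP[c [z [zt zE]]].
  by exists (c, z).
have {yloop}[cz czP] := choice_on (c0, fun _ _ => 0) yloop.
pose yh (q : cix f) (q2 : cix g) j j' : B :=
  (if j == j' then io (cz (q, q2)).1 * e (t j) else 0) +
  \sum_i be j * al i * (cz (q, q2)).2 i j'.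
have yht q q2 j j' : clab q = k -> clab q2 = k -> typed e (t j) (t j') (yh q q2 j j').
  move=> qk q2k; have [zt _] := czP (q, q2) (conj qk q2k); apply: typedD.
    case: eqP => [<-|_]; last exact: typed0.
    apply: (typedP); last by rewrite -mulrA eE eqxx.
    by rewrite mulrA io_comm -mulrA eE eqxx.
  apply: typed_sum => i _; apply: (typedM eE _ (zt i j')).
  exact: (typedM eE (bet j) (alt i)).
have yhE q q2 j : clab q = k -> clab q2 = k ->
    be j * y q q2 = \sum_j' yh q q2 j j' * be j'.
  move=> qk q2k; have [zt zE] := czP (q, q2) (conj qk q2k).
  rewrite [in LHS]zE /= mulrDr mulrA io_comm -mulrA (typedr eE (bet j)).
  under [in RHS]eq_bigr => j' _ do rewrite mulrDl.
  rewrite big_split /= (bigD1 j) //= eqxx -mulrA (typedl eE (bet j)).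
  rewrite [X in _ = _ + X + _]big1 ?addr0 => [|j' nj]; last first.
    by rewrite eq_sym (negbTE nj) mul0r.
  congr (_ + _); rewrite mulr_sumr.
  under [in RHS]eq_bigr => j' _ do rewrite mulr_suml.
  rewrite exchange_big; apply: eq_bigr => i _.
  by rewrite mulr_sumr; apply: eq_bigr => j' _; rewrite !mulrA.
(* The defect of the lifted equation on the level of coefficients; the equation itself only says
   that it vanishes after multiplication by the [be j] and summation. *)
pose cf (p : rix f) (q2 : cix g) j' : B := h2 (p, inr (q2, j')) -
  (\sum_(q in cact f | clab q != k) pmx p q * yd (q, q2) j' +
   \sum_(q in cact f | clab q == k) \sum_j lamf p q j * yh q q2 j j' +
   \sum_(p' in ract g) x p p' * lamg p' q2 j').
have ydt q q2 j : clab q != k -> clab q2 = k -> typed e (clab q) (t j) (yd (q, q2) j).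
  by move=> qk q2k; have [tt _] := ydP (q, q2) (conj qk q2k); exact: tt.
have lft p q j : rlab p != k -> clab q = k -> typed e (rlab p) (t j) (lamf p q j).
  by move=> pk qk; have [tt _] := lfP p q pk qk; exact: tt.
have lgt p q j : rlab p != k -> clab q = k -> typed e (rlab p) (t j) (lamg p q j).
  by move=> pk qk; have [tt _] := lgP p q pk qk; exact: tt.
have cft p q2 j : p \in ract f -> clab q2 = k -> typed e (rlab p) (t j) (cf p q2 j).
  move=> /fk pk q2k; apply: typedB.
    by have [tt _] := h2P (p, inr (q2, j)) (conj pk (tk j)); exact: tt.
  apply: typedD; first apply: typedD; apply: typed_sum.
  - by move=> q /andP[_ qk]; apply: (typedM eE (ft p q) (ydt q q2 j qk q2k)).
  - move=> q /andP[_ /eqP qk]; apply: typed_sum => j' _.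
    exact: (typedM eE (lft p q j' pk qk) (yht q q2 j' j qk q2k)).
  - by move=> p' /gk p'k; apply: (typedM eE (xt p p') (lgt p' q2 j p'k q2k)).
have cf0 p q2 : p \in ract f -> q2 \in cact g -> clab q2 = k ->
    \sum_j cf p q2 j * be j = 0.
  move=> pf qg q2k; have pk := fk _ pf.
  have := E _ _ pf qg; rewrite /h3 pk q2k eqxx => E1.
  under eq_bigr => j _ do rewrite mulrBl.
  rewrite sumrB E1 (bigID (fun q => clab q == k)) /= [X in X + _ - _]addrC.
  apply/eqP; rewrite subr_eq0; apply/eqP.
  under [in RHS]eq_bigr => j _ do rewrite !mulrDl.
  rewrite !big_split /=; congr (_ + _ + _).
  - under [in RHS]eq_bigr => j _ do rewrite mulr_suml.
    rewrite exchange_big; apply: eq_bigr => q /andP[_ qk] /=.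
    have [_ /= ->] := ydP (q, q2) (conj qk q2k).
    by rewrite mulr_sumr; apply: eq_bigr => j _; rewrite mulrA.
  - under [in RHS]eq_bigr => j _ do rewrite mulr_suml.
    rewrite exchange_big; apply: eq_bigr => q /andP[_ /eqP qk] /=.
    have [_ ->] := lfP p q pk qk.
    under [in RHS]eq_bigr => j _ do rewrite mulr_suml.
    rewrite exchange_big mulr_suml; apply: eq_bigr => j _ /=.
    rewrite -mulrA yhE // mulr_sumr.
    by apply: eq_bigr => j' _; rewrite mulrA.
  - under [in RHS]eq_bigr => j _ do rewrite mulr_suml.
    rewrite exchange_big; apply: eq_bigr => p' /gk p'k /=.
    have [_ ->] := lgP p' q2 p'k q2k.
    by rewrite mulr_sumr; apply: eq_bigr => j _; rewrite mulrA.
have [mu muP] := choice_on (Y := I -> B) (fun=> 0)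
  (C := fun pq : rix f * cix g =>
     [/\ pq.1 \in ract f, pq.2 \in cact g & clab pq.2 = k])
  (P := fun pq m => (forall i, typed e (rlab pq.1) (s i) (m i)) /\
     forall j, th (cf pq.1 pq.2 j) = \sum_i th (m i) * th (ga i j))
  (fun pq pqP => let: And3 pf qg qk := pqP in
     let: ex_intro2 m mt mE :=
       kerP (fk _ pf) (fun j => cft _ _ j pf qk) (cf0 _ _ pf qg qk) in
     ex_intro _ m (conj mt mE)).
pose y' (c : cix (mut_pres lamf)) (c2 : cix (mut_pres lamg)) : B' :=
  match c, c2 with
  | inl q, inl q2 => if (clab q != k) && (clab q2 != k) then th (y q q2) else 0
  | inl q, inr (q2, j') =>
      if (clab q != k) && (clab q2 == k) then th (yd (q, q2) j') else 0
  | inr (q, j), inl q2 =>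
      if clab q2 != k then eta (q, inl q2) j +
        (if clab q == k then th (be j * y q q2) else 0) else 0
  | inr (q, j), inr (q2, j') => eta (q, inr (q2, j')) j +
      (if (clab q == k) && (clab q2 == k) then th (yh q q2 j j') else 0)
  end.
(* The entries into the new relations compensate two terms: [mu] removes the defect [cf], through
   [als i * bes j = - th (ga i j)], and the diagonal scalar removes the scalar part of the loops. *)
pose x' (r : rix (mut_pres lamf)) (r2 : rix (mut_pres lamg)) : B' :=
  match r, r2 with
  | inl p, inl p' => if (rlab p != k) && (rlab p' != k) then th (x p p') else 0
  | inl p, inr q2 =>
      if [&& p \in ract f, q2 \in cact g & clab q2 == k]
      then - \sum_i th (mu (p, q2) i) * als i else 0
  | inr q, inr q2 =>
      if (clab q == k) && (clab q2 == k) then - (io' (cz (q, q2)).1 * e' k)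
      else 0
  | inr _, inl _ => 0
  end.
exists y', x'; split.
- move=> [q|[q j]] [q2|[q2 j2]] /=.
  + by case: ifP => [/andP[qk q2k]|_]; [apply: th_typed | exact: typed0].
  + case: ifP => [/andP[qk /eqP q2k]|_]; last exact: typed0.
    by apply: (th_typed qk (tk j2)); exact: ydt.
  + case: ifP => [q2k|_]; last exact: typed0.
    apply: typedD; first exact: (etat q (inl q2) j).
    case: eqP => [qk|_]; last exact: typed0.
    by apply: (th_typed (tk j) q2k); exact: (typedM eE (bet j) (yt q q2)).
  + apply: typedD; first exact: (etat q (inr (q2, j2)) j (tk j2)).
    case: ifP => [/andP[/eqP qk /eqP q2k]|_]; last exact: typed0.
    by apply: (th_typed (tk j) (tk j2)); exact: yht.
- move=> [p|q] [p2|q2] /=.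
  + by case: ifP => [/andP[qk q2k]|_]; [apply: th_typed | exact: typed0].
  + case: ifP => [/and3P[pf qg /eqP q2k]|_]; last exact: typed0.
    apply/typedN/typed_sum => i _; apply: (typedM eE' _ (alst i)).
    have [mt _] := muP (p, q2) (And3 pf qg q2k).
    exact: (th_typed (fk _ pf) (sk i) (mt i)).
  + exact: typed0.
  + case: ifP => [/andP[/eqP qk /eqP q2k]|_]; last exact: typed0.
    apply: typedN; apply: (typedP); last by rewrite -mulrA eE' eqxx.
    by rewrite mulrA io_comm' -mulrA eE' eqxx.
move=> [p|q] [q2|[q2 j2]]; rewrite !inE.
- move=> pf /andP[q2g q2k]; have pk := fk _ pf.
  have -> : h (inl p) (inl q2) = h1 p (inl q2) +
    \sum_(q in cact f | clab q == k) \sum_j th (lamf p q j) * eta (q, inl q2) j.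
    by rewrite /h1 subrK.
  have [_ /= ->] := h2P (p, inl q2) (conj pk q2k).
  have := E _ _ pf q2g; rewrite /h3 pk (negbTE q2k) => ->.
  rewrite raddfD (@sum_mut_gen f lamf) (@sum_mut_rel g lamg) /y' /x' /= ?pk ?q2k.
  have -> : \sum_(q in cact g | clab q == k)
      (if [&& p \in ract f, q \in cact g & clab q == k]
       then - \sum_i th (mu (p, q) i) * als i else 0) * 0 = 0.
    by rewrite big1 // => q _; rewrite mulr0.
  rewrite addr0 addrAC; congr (_ + _); last first.
    rewrite raddf_sum; apply: eq_bigr => p' p'g; have p'k := gk _ p'g.
    by rewrite p'k (thM pk p'k q2k (xt p p') (gt p' q2)).
  rewrite (bigID (fun q => clab q == k)) /= raddfD.
  rewrite [X in _ = _ + X](_ : _ =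
    \sum_(q in cact f | clab q == k) \sum_j th (lamf p q j) * eta (q, inl q2) j +
    \sum_(q in cact f | clab q == k) \sum_j
        th (lamf p q j) * th (be j * y q q2)); last first.
    rewrite -big_split; apply: eq_bigr => q /andP[_ qk] /=; rewrite -big_split.
    by apply: eq_bigr => j _; rewrite qk mulrDr.
  rewrite [LHS]addrC [RHS]addrC -[RHS]addrA; congr (_ + (_ + _)).
    rewrite raddf_sum; apply: eq_bigr => q /andP[_ /eqP qk] /=.
    have [lt ->] := lfP p q pk qk; rewrite mulr_suml raddf_sum.
    apply: eq_bigr => j _; rewrite -mulrA.
    by rewrite (thM pk (tk j) q2k (lt j) (typedM eE (bet j) (yt q q2))).
  rewrite raddf_sum; apply: eq_bigr => q /andP[_ qk]; rewrite qk.
  by rewrite (thM pk qk q2k (ft p q) (yt q q2)).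
- move=> pf /andP[q2g /eqP q2k]; have pk := fk _ pf.
  have -> : h (inl p) (inr (q2, j2)) = h1 p (inr (q2, j2)) +
      \sum_(q in cact f | clab q == k) \sum_j
        th (lamf p q j) * eta (q, inr (q2, j2)) j.
    by rewrite /h1 subrK.
  have [_ /= ->] := h2P (p, inr (q2, j2)) (conj pk (tk j2)).
  have -> : h2 (p, inr (q2, j2)) = cf p q2 j2 +
    (\sum_(q in cact f | clab q != k) pmx p q * yd (q, q2) j2 +
     \sum_(q in cact f | clab q == k) \sum_j lamf p q j * yh q q2 j j2 +
     \sum_(p' in ract g) x p p' * lamg p' q2 j2) by rewrite /cf subrK.
  rewrite (@sum_mut_gen f lamf) (@sum_mut_rel g lamg) /y' /x' /= pk q2k pf eqxx.
  have [mt mE] := muP (p, q2) (And3 pf q2g q2k).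
  rewrite raddfD mE !raddfD /=.
  have -> : \sum_(q in cact g | clab q == k)
      (if [&& true, q \in cact g & clab q == k]
       then - \sum_i th (mu (p, q) i) * als i else 0) *
      (if q == q2 then bes j2 else 0) =
      \sum_i th (mu (p, q2) i) * th (ga i j2).
    rewrite (bigD1 q2) ?q2g ?q2k ?eqxx //= ?q2g ?q2k ?eqxx /= mulNr mulr_suml [X in _ + X]big1.
      rewrite addr0 -sumrN; apply: eq_bigr => i _.
      by rewrite -mulrA relP mulrN opprK.
    by move=> q /andP[_ /negbTE ->]; rewrite mulr0.
  rewrite [RHS]addrA [RHS]addrC -[LHS]addrA; congr (_ + _).
  rewrite addrAC; congr (_ + _); last first.
    rewrite raddf_sum; apply: eq_bigr => p' p'g; have p'k := gk _ p'g.
    by rewrite p'k (thM pk p'k (tk j2) (xt p p') (lgt p' q2 j2 p'k q2k)).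
  rewrite -[LHS]addrA; congr (_ + _).
    rewrite raddf_sum; apply: eq_bigr => q /andP[_ qk]; rewrite qk /=.
    by rewrite (thM pk qk (tk j2) (ft p q) (ydt q q2 j2 qk q2k)).
  rewrite raddf_sum -big_split; apply: eq_bigr => q /andP[_ /eqP qk] /=.
  rewrite raddf_sum -big_split; apply: eq_bigr => j _ /=; rewrite qk eqxx /=.
  rewrite [RHS]mulrDr [RHS]addrC.
  by rewrite (thM pk (tk j) (tk j2) (lft p q j pk qk) (yht q q2 j j2 qk q2k)).
- move=> /andP[qf /eqP qk] /andP[q2g q2k].
  rewrite (@sum_mut_gen f lamf) (@sum_mut_rel g lamg) /y' /x' /=.
  rewrite big1 ?add0r => [|? _]; last by rewrite mul0r.
  rewrite [X in _ = _ + (X + _)]big1 ?add0r => [|? _]; last by rewrite mul0r.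
  rewrite [X in _ = _ + X]big1 ?addr0 => [|? _]; last by rewrite mulr0.
  rewrite (bigD1 q) ?qf ?qk ?eqxx //= [X in _ = _ + X]big1 ?addr0; last first.
    move=> q' /andP[_ nq]; apply: big1 => j _.
    by rewrite eq_sym (negbTE nq) mul0r.
  rewrite ?eqxx ?q2k ?qk ?eqxx /=.
  have [_ /= ->] := etaP (q, inl q2) q2k.
  under [in RHS]eq_bigr => j _ do rewrite mulrDr.
  rewrite big_split /= [X in _ = _ + X](_ : _ = 0) ?addr0 //.
  (* The entry of y factors through the [al i], so that the extra term becomes a multiple of the
     relations [rel_in]. *)
  have := yt q q2; rewrite qk => /(inP q2k)[z zt ->].
  under eq_bigr => j _ do rewrite mulr_sumr raddf_sum mulr_sumr.
  rewrite exchange_big big1 // => i _ /=.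
  under eq_bigr => j _ do rewrite mulrA
    (thM (tk j) (sk i) q2k (typedM eE (bet j) (alt i)) (zt i)) mulrA.
  by rewrite -mulr_suml rel_in mul0r.
- move=> /andP[qf /eqP qk] /andP[q2g /eqP q2k].
  rewrite (@sum_mut_gen f lamf) (@sum_mut_rel g lamg) /y' /x' /=.
  rewrite big1 ?add0r => [|? _]; last by rewrite mul0r.
  rewrite [X in _ = _ + (X + _)]big1 ?add0r => [|? _]; last by rewrite mul0r.
  rewrite (bigD1 q) ?qf ?qk ?eqxx //= [X in _ = _ + X + _]big1 ?addr0; last first.
    move=> q' /andP[_ nq]; apply: big1 => j _.
    by rewrite eq_sym (negbTE nq) mul0r.
  rewrite [X in _ = _ + X](bigD1 q2) ?q2g ?q2k ?eqxx //= [X in _ = _ + (_ + X)]big1 ?addr0; last first.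
    by move=> q' /andP[_ /negbTE ->]; rewrite mulr0.
  rewrite ?eqxx ?q2k ?qk ?eqxx /=.
  have [_ /= ->] := etaP (q, inr (q2, j2)) (tk j2).
  under [in RHS]eq_bigr => j _ do rewrite mulrDr.
  rewrite big_split /= -[RHS]addrA [X in _ = _ + X](_ : _ = 0) ?addr0 //.
  have [zt _] := czP (q, q2) (conj qk q2k).
  under eq_bigr => j _ do rewrite raddfD mulrDr.
  rewrite big_split /= (bigD1 j2) //= eqxx th_io mulrA io_comm' -mulrA.
  rewrite (typedr eE' (best j2)) [X in _ + X + _ + _]big1 ?addr0 => [|j nj]; last first.
    by rewrite (negbTE nj) raddf0 mulr0.
  rewrite mulNr -mulrA (typedl eE' (best j2)) addrAC subrr add0r.
  under eq_bigr => j _ do rewrite raddf_sum mulr_sumr.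
  rewrite exchange_big big1 // => i _ /=.
  under eq_bigr => j _ do rewrite
    (thM (tk j) (sk i) (tk j2) (typedM eE (bet j) (alt i)) (zt i j2)) mulrA.
  by rewrite -mulr_suml rel_in mul0r.
Qed.

End Mutation.

(** * Transposition and change of ring *)

Section Transpose.
Variables (V : finType) (B : pzRingType) (e : V -> B).

Definition cvs (x : B) : B^c := x.

Lemma typed_conv u v x : typed e u v x <-> typed (cvs \o e) v u (cvs x).
Proof. by rewrite /typed /= -[LHS]mulrA. Qed.

(** The duality Hom(-, B): the dual of a presentation lives over the opposite ring, with generators
    and relations exchanged. Hence the weights change sign and Hom(f, g[1]) becomes Hom of the duals
    in the other order. *)
Definition tr_pres (f : pres V B) : pres V B^c :=
  @Pres V B^c (cix f) (rix f) (@clab V B f) (@rlab V B f) (cact f) (ract f)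
    (fun p q => pmx q p).

Definition untr_pres (f : pres V B^c) : pres V B :=
  @Pres V B (cix f) (rix f) (@clab V B^c f) (@rlab V B^c f) (cact f) (ract f)
    (fun p q => pmx q p : B^c).

Lemma tr_typed f : ptyped e f -> ptyped (cvs \o e) (tr_pres f).
Proof. by move=> ft p q; apply/typed_conv; exact: ft. Qed.

Lemma untr_typed f : ptyped (cvs \o e) f -> ptyped e (untr_pres f).
Proof. by move=> ft p q; apply/typed_conv; exact: ft. Qed.

Lemma tr_compat f g : compat e f g -> compat (cvs \o e) (tr_pres g) (tr_pres f).
Proof.
move=> fg h ht; have [|y [x [yt xt E]]] := fg (fun p q => h q p : B^c).
  by move=> p q; apply/typed_conv; exact: ht.
exists (fun p q => x q p), (fun p q => y q p); split=> [p q|p q|p q pg qf].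
- by apply/typed_conv; exact: xt.
- by apply/typed_conv; exact: yt.
- by rewrite [LHS](E _ _ qf pg) addrC.
Qed.

Lemma untr_compat (f g : pres V B^c) :
  compat (cvs \o e) f g -> compat e (untr_pres g) (untr_pres f).
Proof.
move=> fg h ht; have [|y [x [yt xt E]]] := fg (fun p q => h q p : B).
  by move=> p q; apply/typed_conv; exact: ht.
exists (fun p q => x q p : B^c), (fun p q => y q p : B^c).
split=> [p q|p q|p q pg qf].
- by apply/typed_conv; exact: xt.
- by apply/typed_conv; exact: yt.
- by rewrite [LHS](E _ _ qf pg) addrC.
Qed.

Lemma tr_net f v : net (tr_pres f) v = - net f v.
Proof. by rewrite /net opprB. Qed.

Lemma untr_net f v : net (untr_pres f) v = - net f v.
Proof. by rewrite /net opprB. Qed.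

End Transpose.

Section Transport.
Variables (V : finType) (B B' : pzRingType) (e : V -> B) (e' : V -> B').
Variable phi : {additive B -> B'}.
Hypothesis phi_typed : forall u v x, typed e u v x -> typed e' u v (phi x).
Hypothesis phiM : forall u v w x y,
  typed e u v x -> typed e v w y -> phi (x * y) = phi x * phi y.
Hypothesis phi_surj : forall u v x', typed e' u v x' ->
  exists2 x, typed e u v x & x' = phi x.

Definition map_pres (f : pres V B) : pres V B' :=
  @Pres V B' (rix f) (cix f) (@rlab V B f) (@clab V B f) (ract f) (cact f)
    (fun p q => phi (pmx p q)).

Lemma map_typed f : ptyped e f -> ptyped e' (map_pres f).
Proof. by move=> ft p q; exact/phi_typed/ft. Qed.

Lemma map_compat f g : ptyped e f -> ptyped e g ->
  compat e f g -> compat e' (map_pres f) (map_pres g).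
Proof.
move=> ft gt fg h ht.
have /choice[h1 h1P] : forall pq : rix f * cix g,
    exists x, typed e (rlab pq.1) (clab pq.2) x /\ h pq.1 pq.2 = phi x.
  by move=> pq; have [x xt xE] := phi_surj (ht pq.1 pq.2); exists x.
have [|y [x [yt xt E]]] := fg (fun p q => h1 (p, q)).
  by move=> p q; have [tt _] := h1P (p, q); exact: tt.
exists (fun p q => phi (y p q)), (fun p q => phi (x p q)); split.
- by move=> p q; exact/phi_typed/yt.
- by move=> p q; exact/phi_typed/xt.
move=> p q pf qg; have [_ /= ->] := h1P (p, q).
rewrite (E _ _ pf qg) raddfD !raddf_sum; congr (_ + _); apply: eq_bigr => i _ /=.
  exact: phiM (ft p i) (yt i q).
exact: phiM (xt p i) (gt i q).
Qed.

End Transport.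

(** * One mutation step *)

Definition pospart (x : int) : int := Num.max x 0.

(** A positive weight at k spreads along [out], a negative one along [inn]; these count the arrows
    from k to v and from v to k, or the reverse when mutating back. *)
Definition mut_step (V : eqType) (out inn : V -> int) (k : V) (g : V -> int)
    (v : V) : int :=
  if v == k then - g k
  else g v + out v * pospart (g k) - inn v * pospart (- g k).

Section Step.
Variables (V : finType) (B B' : pzRingType) (e : V -> B) (e' : V -> B').
Hypothesis eE : forall u v, e u * e v = if u == v then e u else 0.
Hypothesis eE' : forall u v, e' u * e' v = if u == v then e' u else 0.
Variables (k : V) (I J : finType) (s : I -> V) (t : J -> V).
Hypotheses (sk : forall i, s i != k) (tk : forall j, t j != k).
Variables (al : I -> B) (be : J -> B) (ga : I -> J -> B).
Hypothesis (bet : forall j, typed e (t j) k (be j)).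
Hypothesis (alt : forall i, typed e k (s i) (al i)).
Variables (als : I -> B') (bes : J -> B').
Hypothesis (alst : forall i, typed e' (s i) k (als i)).
Hypothesis (best : forall j, typed e' k (t j) (bes j)).
Variable th : {additive B -> B'}.
Hypothesis th_typed : forall u v x, u != k -> v != k ->
  typed e u v x -> typed e' u v (th x).
Hypothesis thM : forall u v w x y, u != k -> v != k -> w != k ->
  typed e u v x -> typed e v w y -> th (x * y) = th x * th y.
Hypothesis th_surj : forall u v x', u != k -> v != k -> typed e' u v x' ->
  exists2 x, typed e u v x & x' = th x.
Variables (T : Type) (c0 : T) (io : T -> B) (io' : T -> B').
Hypothesis io_comm : forall c x, x * io c = io c * x.
Hypothesis io_comm' : forall c x, x * io' c = io' c * x.
Hypothesis th_io : forall c v, v != k -> th (io c * e v) = io' c * e' v.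
Hypothesis inP : forall v y, v != k -> typed e k v y ->
  exists2 z : I -> B, forall i, typed e (s i) v (z i) &
    y = \sum_i al i * z i.
Hypothesis outP : forall u y, u != k -> typed e u k y ->
  exists2 l : J -> B, forall j, typed e u (t j) (l j) &
    y = \sum_j l j * be j.
Hypothesis loopP : forall y, typed e k k y ->
  exists (c : T) (z : I -> J -> B), (forall i j, typed e (s i) (t j) (z i j)) /\
    y = io c * e k + \sum_i \sum_j al i * z i j * be j.
Hypothesis ker_out : forall u (l : J -> B), u != k ->
  (forall j, typed e u (t j) (l j)) -> \sum_j l j * be j = 0 ->
  exists2 m : I -> B, forall i, typed e u (s i) (m i) &
    forall j, th (l j) = \sum_i th (m i) * th (ga i j).
Hypothesis inP' : forall v y, v != k -> typed e' k v y ->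
  exists2 z : J -> B', forall j, typed e' (t j) v (z j) &
    y = \sum_j bes j * z j.
Hypothesis relP : forall i j, als i * bes j = - th (ga i j).
Hypothesis rel_in : forall i, \sum_j bes j * th (be j * al i) = 0.

Lemma step_pos (X : Type) (F : X -> pres V B) :
  (forall a, ptyped e (F a)) -> (forall a b, compat e (F a) (F b)) ->
  (forall a p, p \in ract (F a) -> rlab p != k) ->
  exists F' : X -> pres V B',
    [/\ forall a, ptyped e' (F' a), forall a b, compat e' (F' a) (F' b) &
        forall a v, net (F' a) v = if v == k then - net (F a) k
          else net (F a) v + net (F a) k * (#|[set j | t j == v]|)%:Z].
Proof.
move=> Ft Fc Fk.
have lam_ex a := out_coef_ex outP (Ft a).
pose lam a := projT1 (cid (lam_ex a)).
have lamP a : out_coef e k t be (lam a) := projT2 (cid (lam_ex a)).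
exists (fun a => mut_pres k t bes th (lam a)); split.
- by move=> a; exact: (mut_typed tk best th_typed (Ft a) (lamP a)).
- move=> a b; have th_io' c j := th_io c (tk j).
  apply: (mut_compat eE eE' sk tk bet alt alst best th_typed thM th_surj c0
    io_comm io_comm' th_io' inP outP loopP ker_out inP' relP rel_in
    (Ft a) (Ft b) (lamP a) (lamP b) (Fk a) (Fk b) (Fc a b)).
- by move=> a v; rewrite (mut_net tk) //; exact: Fk.
Qed.

End Step.

(* The remaining half of a mutation step is [step_pos] for the opposite rings. *)
Section StepFull.
Variables (V : finType) (B B' : pzRingType) (e : V -> B) (e' : V -> B').
Hypothesis eE : forall u v, e u * e v = if u == v then e u else 0.
Hypothesis eE' : forall u v, e' u * e' v = if u == v then e' u else 0.
Variables (k : V) (I J : finType) (s : I -> V) (t : J -> V).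
Hypotheses (sk : forall i, s i != k) (tk : forall j, t j != k).
Variables (al : I -> B) (be : J -> B) (ga : I -> J -> B).
Hypothesis (bet : forall j, typed e (t j) k (be j)).
Hypothesis (alt : forall i, typed e k (s i) (al i)).
Variables (als : I -> B') (bes : J -> B').
Hypothesis (alst : forall i, typed e' (s i) k (als i)).
Hypothesis (best : forall j, typed e' k (t j) (bes j)).
Variable th : {additive B -> B'}.
Hypothesis th_typed : forall u v x, u != k -> v != k ->
  typed e u v x -> typed e' u v (th x).
Hypothesis thM : forall u v w x y, u != k -> v != k -> w != k ->
  typed e u v x -> typed e v w y -> th (x * y) = th x * th y.
Hypothesis th_surj : forall u v x', u != k -> v != k -> typed e' u v x' ->
  exists2 x, typed e u v x & x' = th x.
Variables (T : Type) (c0 : T) (io : T -> B) (io' : T -> B').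
Hypothesis io_comm : forall c x, x * io c = io c * x.
Hypothesis io_comm' : forall c x, x * io' c = io' c * x.
Hypothesis th_io : forall c v, v != k -> th (io c * e v) = io' c * e' v.
Hypothesis inP : forall v y, v != k -> typed e k v y ->
  exists2 z : I -> B, forall i, typed e (s i) v (z i) &
    y = \sum_i al i * z i.
Hypothesis outP : forall u y, u != k -> typed e u k y ->
  exists2 l : J -> B, forall j, typed e u (t j) (l j) &
    y = \sum_j l j * be j.
Hypothesis loopP : forall y, typed e k k y ->
  exists (c : T) (z : I -> J -> B), (forall i j, typed e (s i) (t j) (z i j)) /\
    y = io c * e k + \sum_i \sum_j al i * z i j * be j.
Hypothesis ker_out : forall u (l : J -> B), u != k ->
  (forall j, typed e u (t j) (l j)) -> \sum_j l j * be j = 0 ->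
  exists2 m : I -> B, forall i, typed e u (s i) (m i) &
    forall j, th (l j) = \sum_i th (m i) * th (ga i j).
Hypothesis ker_in : forall v (l : I -> B), v != k ->
  (forall i, typed e (s i) v (l i)) -> \sum_i al i * l i = 0 ->
  exists2 m : J -> B, forall j, typed e (t j) v (m j) &
    forall i, th (l i) = \sum_j th (ga i j) * th (m j).
Hypothesis inP' : forall v y, v != k -> typed e' k v y ->
  exists2 z : J -> B', forall j, typed e' (t j) v (z j) &
    y = \sum_j bes j * z j.
Hypothesis outP' : forall u y, u != k -> typed e' u k y ->
  exists2 l : I -> B', forall i, typed e' u (s i) (l i) &
    y = \sum_i l i * als i.
Hypothesis relP : forall i j, als i * bes j = - th (ga i j).
Hypothesis rel_in : forall i, \sum_j bes j * th (be j * al i) = 0.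
Hypothesis rel_out : forall j, \sum_i th (be j * al i) * als i = 0.

Lemma step_neg (X : Type) (F : X -> pres V B) :
  (forall a, ptyped e (F a)) -> (forall a b, compat e (F a) (F b)) ->
  (forall a q, q \in cact (F a) -> clab q != k) ->
  exists F' : X -> pres V B',
    [/\ forall a, ptyped e' (F' a), forall a b, compat e' (F' a) (F' b) &
        forall a v, net (F' a) v = if v == k then - net (F a) k
          else net (F a) v + net (F a) k * (#|[set i | s i == v]|)%:Z].
Proof.
move=> Ft Fc Fk.
pose c := @cvs B; pose c' := @cvs B'.
pose thc : {additive B^c -> B'^c} := th.
have ccE (A : pzRingType) (d : V -> A) : (forall u v, d u * d v = if u == v then d u else 0) ->
    forall u v, (@cvs A \o d) u * (@cvs A \o d) v = if u == v then (@cvs A \o d) u else 0.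
  by move=> dE u v; rewrite /= [LHS]dE eq_sym; case: eqP => [->|].
have tc (A : pzRingType) (d : V -> A) u v x :
    typed d v u x -> typed (@cvs A \o d) u v x by move/typed_conv.
have tc' (A : pzRingType) (d : V -> A) u v x :
    typed (@cvs A \o d) u v x -> typed d v u x by move=> ?; apply/typed_conv.
(* Over the opposite rings the arrows into k and out of k are exchanged: [al] with [be], [als] with
   [bes], [ker_out] with [ker_in] and [rel_in] with [rel_out]. *)
have [||||||||||||||||F' [Ft' Fc' Fn']] := @step_pos V B^c B'^c (c \o e) (c' \o e')
  (ccE _ _ eE) (ccE _ _ eE') k J I t s tk sk be al (fun j i => ga i j)
  (fun i => tc _ _ _ _ _ (alt i)) (fun i => tc _ _ _ _ _ (bet i)) bes als
  (fun i => tc _ _ _ _ _ (best i)) (fun i => tc _ _ _ _ _ (alst i)) thc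
  _ _ _ T c0 io io' _ _ _ _ _ _ _ _ _ _ X (fun a => tr_pres (F a)).
- by move=> u v x uk vk /tc' xt; apply/tc/th_typed.
- move=> u v w x y uk vk wk /tc' xt /tc' yt; exact: (thM wk vk uk yt xt).
- move=> u v x' uk vk /tc' xt; have [x ? ?] := th_surj vk uk xt.
  by exists x => //; exact/tc.
- by move=> d x; rewrite [LHS](esym (io_comm d x)).
- by move=> d x; rewrite [LHS](esym (io_comm' d x)).
- move=> d v vk; rewrite /= [X in thc X](io_comm d (e v)) [RHS](io_comm' d (e' v)).
  exact: th_io.
- move=> v y vk /tc' yt; have [l lt lE] := outP vk yt.
  by exists l => // j; exact/tc.
- move=> v y vk /tc' yt; have [l lt lE] := inP vk yt.
  by exists l => // j; exact/tc.
- move=> y /tc' yt; have [d [z [zt zE]]] := loopP yt.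
  exists d, (fun j i => z i j); split; first by move=> j i; exact/tc.
  rewrite [LHS]zE; congr (_ + _); first by rewrite [RHS]io_comm.
  rewrite exchange_big; apply: eq_bigr => j _; apply: eq_bigr => i _.
  by rewrite -[LHS]mulrA.
- move=> u l uk lt l0; have [m mt mE] := ker_in uk (fun i => tc' _ _ _ _ _ (lt i)) l0.
  by exists m => // j; exact/tc.
- move=> v y vk /tc' yt; have [l lt lE] := outP' vk yt.
  by exists l => // j; exact/tc.
- by move=> j i; exact: relP.
- by move=> j; exact: rel_out.
- by move=> a; exact/tr_typed/Ft.
- by move=> a b; exact/tr_compat/Fc.
- by move=> a q; exact: Fk.
exists (fun a => untr_pres (F' a)); split.
- by move=> a; exact/untr_typed/Ft'.
- by move=> a b; exact/untr_compat/Fc'.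
- move=> a v; rewrite untr_net Fn' !tr_net; case: eqP => _.
    by rewrite opprK.
  by rewrite mulNr opprD !opprK.
Qed.

Variables (K : fieldType) (sc : B -> K).
Hypotheses (scD : {morph sc : x y / x + y}) (scM : {morph sc : x y / x * y}).
Hypotheses (sck : sc (e k) = 1) (scv : forall v, v != k -> sc (e v) = 0).
Hypothesis sc_inv : forall x, typed e k k x -> sc x != 0 ->
  exists w, [/\ typed e k k w, x * w = e k & w * x = e k].

(** All members are first reduced at k. Either no member has a relation at k and [step_pos] applies
    to the whole family, or one member has such a relation, and by the dichotomy no member has a
    generator at k, so that [step_neg] applies. In each case one of the two positive parts of the
    weight at k vanishes. *)
Lemma mutation_step (X : Type) (F : X -> pres V B) :
  (forall a, ptyped e (F a)) -> (forall a b, compat e (F a) (F b)) ->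
  exists F' : X -> pres V B',
    [/\ forall a, ptyped e' (F' a), forall a b, compat e' (F' a) (F' b) &
        forall a v, net (F' a) v =
          mut_step (fun v => (#|[set j | t j == v]|)%:Z)
            (fun v => (#|[set i | s i == v]|)%:Z) k (net (F a)) v].
Proof.
move=> Ft Fc.
pose red a := cid (reduce_pres eE sc_inv (Ft a)).
pose G a := projT1 (red a).
have GP a := projT2 (red a); rewrite -/(G _) in GP.
have Gt a : ptyped e (G a) by have [] := GP a.
have Gr a : reduced_at k sc (G a) by have [] := GP a.
have Gn a v : net (G a) v = net (F a) v by have [_ _ ->] := GP a.
have Gc a b : compat e (G a) (G b).
  have [_ _ _ cl _] := GP a; have [_ _ _ _ cr] := GP b.
  by apply: cr (Gt a) _; exact: (cl _ (Ft b)).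
have [nr|/existsNP[a /existsNP[p /not_implyP[pa /negP]]]] :=
  pselect (forall a p, p \in ract (G a) -> rlab p != k).
  have [F' [Ft' Fc' Fn']] := step_pos eE eE' sk tk bet alt alst best th_typed thM
    th_surj c0 io_comm io_comm' th_io inP outP loopP ker_out inP' relP rel_in Gt Gc nr.
  exists F'; split=> // a v; rewrite Fn' /mut_step !Gn; case: ifP => // _.
  have n0 : 0 <= net (F a) k.
    rewrite -Gn /net [X in _ - X](_ : _ = 0) ?subr0 //.
    rewrite (_ : [set p in _ | _] = set0) ?cards0 //.
    by apply/setP => p; rewrite !inE; case: (boolP (_ \in _)) => //= /nr /negbTE.
  by rewrite /pospart max_l // max_r ?oppr_le0 // mulr0 subr0 mulrC.
rewrite negbK => /eqP pk.
have nc b q : q \in cact (G b) -> clab q != k.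
  move=> qb; apply/eqP => qk.
  exact: (reduced_dichotomy eE scD scM sck scv (Gt a) (Gt b) (Gc a b)
    (Gr a) (Gr b) pa qb pk qk).
have [F' [Ft' Fc' Fn']] := step_neg Gt Gc nc.
exists F'; split=> // b v; rewrite Fn' /mut_step !Gn; case: ifP => // _.
have n0 : net (F b) k <= 0.
  rewrite -Gn /net [X in X - _](_ : _ = 0) ?sub0r ?oppr_le0 //.
  rewrite (_ : [set q in _ | _] = set0) ?cards0 //.
  by apply/setP => q; rewrite !inE; case: (boolP (_ \in _)) => //= /nc /negbTE.
by rewrite /pospart max_r // max_l ?oppr_ge0 // mulr0 addr0 mulrN opprK mulrC.
Qed.

End StepFull.

(** * Sign-coherence of the weights at a vertex *)

Section Coherence.
Variables (V : finType) (B : pzRingType) (e : V -> B).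
Hypothesis eE : forall u v, e u * e v = if u == v then e u else 0.
Variables (k : V) (K : fieldType) (sc : B -> K).
Hypotheses (scD : {morph sc : x y / x + y}) (scM : {morph sc : x y / x * y}).
Hypotheses (sck : sc (e k) = 1) (scv : forall v, v != k -> sc (e v) = 0).
Hypothesis sc_inv : forall x, typed e k k x -> sc x != 0 ->
  exists w, [/\ typed e k k w, x * w = e k & w * x = e k].

Lemma net_coherent (X : Type) (F : X -> pres V B) :
  (forall a, ptyped e (F a)) -> (forall a b, compat e (F a) (F b)) ->
  (forall a, 0 <= net (F a) k) \/ (forall a, net (F a) k <= 0).
Proof.
move=> Ft Fc.
have [pos|/existsNP[a /negP]] := pselect (forall a, 0 <= net (F a) k); first by left.
rewrite -ltNge => na; right=> b; rewrite leNgt; apply/negP => nb.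
have [G [Gt Gr Gn cl cr]] := reduce_pres eE sc_inv (Ft a).
have [H [Ht Hr Hn cl' cr']] := reduce_pres eE sc_inv (Ft b).
have GH : compat e G H by apply: cr' Gt _; exact: (cl _ (Ft b)).
have ex (m : nat) (T : finType) (D : {set T}) : (#|D|%:Z - m%:Z > 0) -> exists x, x \in D.
  by move=> D0; apply/set0Pn; apply: contraTneq D0 => ->; rewrite cards0 sub0r oppr_gt0.
have [q] : exists q, q \in [set q in cact H | clab q == k].
  by apply: (ex #|[set p in ract H | rlab p == k]|); rewrite -/(net H k) Hn.
have [p] : exists p, p \in [set p in ract G | rlab p == k].
  by apply: (ex #|[set q in cact G | clab q == k]|); rewrite -opprB -/(net G k) Gn oppr_gt0.
rewrite !inE => /andP[pG /eqP pk] /andP[qH /eqP qk].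
exact: (reduced_dichotomy eE scD scM sck scv Gt Ht GH Gr Hr pG qH pk qk).
Qed.

End Coherence.

(** * Quotient by a two-sided ideal *)

Section Quotient.
Variable A : pzRingType.

Record tsideal := TSIdeal {
  idpred :> A -> Prop;
  id0 : idpred 0;
  idD : forall x y, idpred x -> idpred y -> idpred (x + y);
  idMl : forall x y, idpred x -> idpred (y * x);
  idMr : forall x y, idpred x -> idpred (x * y) }.

Variable I : tsideal.

Lemma idN x : I x -> I (- x).
Proof. by rewrite -mulN1r; exact: idMl. Qed.

Lemma idB x y : I x -> I y -> I (x - y).
Proof. by move=> Ix Iy; exact/idD/idN. Qed.

Lemma id_sum (T : Type) (r : seq T) (P : pred T) F :
  (forall i, P i -> I (F i)) -> I (\sum_(i <- r | P i) F i).
Proof. by move=> IF; apply: big_ind => //; [exact: id0 | exact: idD]. Qed.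

Definition ideq (x y : A) : bool := `[< I (x - y) >].

Lemma ideq_refl : reflexive ideq.
Proof. by move=> x; apply/asboolP; rewrite subrr; exact: id0. Qed.

Lemma ideq_sym : ssrbool.symmetric ideq.
Proof.
suff imp x y : ideq x y -> ideq y x by move=> x y; apply/idP/idP; exact: imp.
by move=> /asboolP h; apply/asboolP; rewrite -opprB; exact: idN.
Qed.

Lemma ideq_trans : transitive ideq.
Proof.
move=> y x z /asboolP h1 /asboolP h2; apply/asboolP.
by rewrite -(subrKA y); exact: idD.
Qed.

Canonical ideq_equiv := EquivRel ideq ideq_refl ideq_sym ideq_trans.

Definition qring := {eq_quot ideq}.

HB.instance Definition _ := Choice.on qring.
HB.instance Definition _ := Quotient.on qring.

Definition qpi (x : A) : qring := \pi_qring x.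

Lemma qpiP x y : qpi x = qpi y <-> I (x - y).
Proof.
split=> [/eqP|h]; first by rewrite /qpi eqmodE => /asboolP.
by apply/eqP; rewrite /qpi eqmodE; apply/asboolP.
Qed.

Lemma qpi_repr (x : qring) : qpi (repr x) = x.
Proof. exact: reprK. Qed.

Lemma qpi_surj (x : qring) : exists y, x = qpi y.
Proof. by exists (repr x); rewrite qpi_repr. Qed.

(** Locked, so that conversion does not unfold the choice of representatives; [qaddE], [qoppE] and
    [qmulE] give the access to these operations. *)
Definition qadd := locked (fun x y : qring => qpi (repr x + repr y)).
Definition qopp := locked (fun x : qring => qpi (- repr x)).
Definition qmul := locked (fun x y : qring => qpi (repr x * repr y)).

Lemma qrepr x : I (repr (qpi x) - x).
Proof. by apply/qpiP; rewrite qpi_repr. Qed.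

Lemma qaddE x y : qadd (qpi x) (qpi y) = qpi (x + y).
Proof.
by rewrite /qadd -lock; apply/qpiP; rewrite opprD addrACA; apply: idD; exact: qrepr. Qed.

Lemma qoppE x : qopp (qpi x) = qpi (- x).
Proof.
by rewrite /qopp -lock; apply/qpiP; rewrite -opprD; apply: idN; exact: qrepr. Qed.

Lemma qmulE x y : qmul (qpi x) (qpi y) = qpi (x * y).
Proof.
rewrite /qmul -lock; apply/qpiP; rewrite -(subrKA (x * repr (qpi y))) -mulrBl -mulrBr.
by apply: idD; [apply: idMr | apply: idMl]; exact: qrepr.
Qed.

Lemma qaddA : associative qadd.
Proof.
move=> x y z; rewrite -[x]qpi_repr -[y]qpi_repr -[z]qpi_repr.
by rewrite !qaddE addrA.
Qed.

Lemma qaddC : commutative qadd.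
Proof.
by move=> x y; rewrite -[x]qpi_repr -[y]qpi_repr !qaddE addrC.
Qed.

Lemma qadd0 : left_id (qpi 0) qadd.
Proof. by move=> x; rewrite -[x]qpi_repr qaddE add0r. Qed.

Lemma qaddN : left_inverse (qpi 0) qopp qadd.
Proof. by move=> x; rewrite -[x]qpi_repr qoppE qaddE addNr. Qed.

HB.instance Definition _ := GRing.isZmodule.Build qring qaddA qaddC qadd0 qaddN.

Lemma qmulA : associative qmul.
Proof.
move=> x y z; rewrite -[x]qpi_repr -[y]qpi_repr -[z]qpi_repr.
by rewrite !qmulE mulrA.
Qed.

Lemma qmul1l : left_id (qpi 1) qmul.
Proof. by move=> x; rewrite -[x]qpi_repr qmulE mul1r. Qed.

Lemma qmul1r : right_id (qpi 1) qmul.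
Proof. by move=> x; rewrite -[x]qpi_repr qmulE mulr1. Qed.

Lemma qmulDl : left_distributive qmul +%R.
Proof.
move=> x y z; rewrite -[x]qpi_repr -[y]qpi_repr -[z]qpi_repr.
by rewrite [_ + _]qaddE !qmulE [RHS]qaddE mulrDl.
Qed.

Lemma qmulDr : right_distributive qmul +%R.
Proof.
move=> x y z; rewrite -[x]qpi_repr -[y]qpi_repr -[z]qpi_repr.
by rewrite [_ + _]qaddE !qmulE [RHS]qaddE mulrDr.
Qed.

HB.instance Definition _ := GRing.Zmodule_isPzRing.Build qring
  qmulA qmul1l qmul1r qmulDl qmulDr.

Lemma qpi_is_zmod : zmod_morphism qpi.
Proof. by move=> x y; rewrite -[- qpi y]/(qopp _) qoppE [RHS]qaddE. Qed.

HB.instance Definition _ := GRing.isZmodMorphism.Build A qring qpi qpi_is_zmod.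

Lemma qpiM x y : qpi (x * y) = qpi x * qpi y.
Proof. by rewrite [RHS]qmulE. Qed.

Lemma qpi0P x : qpi x = 0 <-> I x.
Proof. by rewrite -[X in I X]subr0 -qpiP raddf0. Qed.

End Quotient.

Section QuotientMap.
Variables (A A' : pzRingType) (I : tsideal A) (I' : tsideal A').
Variable phi : {additive A -> A'}.
Hypothesis phiI : forall x, I x -> I' (phi x).

(** The compatibility with the ideals is an argument, so that the additive structure can be inferred
    from the term itself. *)
Definition qmap of (forall x, I x -> I' (phi x)) := fun x : qring I =>
  qpi I' (phi (repr x)).

Lemma qmap_is_zmod : zmod_morphism (qmap phiI).
Proof.
move=> x y; rewrite /qmap -raddfB; apply/qpiP; rewrite -!raddfB; apply: phiI.
by apply/qpiP; rewrite qpi_repr raddfB /= !qpi_repr.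
Qed.

HB.instance Definition _ :=
  GRing.isZmodMorphism.Build (qring I) (qring I') (qmap phiI) qmap_is_zmod.

Lemma qmapE x : qmap phiI (qpi I x) = qpi I' (phi x).
Proof. by apply/qpiP; rewrite -raddfB; apply: phiI; exact: qrepr. Qed.

End QuotientMap.

Section TypedQuotient.
Variables (V : finType) (A : pzRingType) (e : V -> A) (I : tsideal A).
Hypothesis eE : forall u v, e u * e v = if u == v then e u else 0.

Definition qe (v : V) : qring I := qpi I (e v).

Lemma qeE u v : qe u * qe v = if u == v then qe u else 0.
Proof. by rewrite /qe -qpiM eE; case: eqP => // _; rewrite raddf0. Qed.

Lemma typed_qpi u v x : typed e u v x -> typed qe u v (qpi I x).
Proof. by move=> xt; rewrite /typed /qe -!qpiM xt. Qed.

Lemma typed_proj u v x : typed e u v (e u * x * e v).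
Proof.
by apply: typedP; rewrite ?mulrA ?eE ?eqxx // -!mulrA eE eqxx.
Qed.

Lemma qpi_typed u v x : typed qe u v x ->
  exists2 y, typed e u v y & x = qpi I y.
Proof.
have [y ->] := qpi_surj x; rewrite /typed /qe -!qpiM => yE.
by exists (e u * y * e v); [exact: typed_proj | rewrite yE].
Qed.

End TypedQuotient.

(** * Families of compatible presentations with prescribed weights *)

Section Coh.
Variable V : finType.

(* Working modulo every power of the arrow ideal replaces completion. *)
Definition coh (A : pzRingType) (e : V -> A) (I : nat -> tsideal A)
    (X : Type) (G : X -> V -> int) :=
  forall N, exists F : X -> pres V (qring (I N)),
    [/\ forall a, ptyped (qe e (I N)) (F a),
        forall a b, compat (qe e (I N)) (F a) (F b) &
        forall a v, net (F a) v = G a v].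

Variables (A A' : pzRingType) (e : V -> A) (e' : V -> A').
Hypothesis eE : forall u v, e u * e v = if u == v then e u else 0.
Hypothesis eE' : forall u v, e' u * e' v = if u == v then e' u else 0.

(** Surjectivity modulo the target ideal is what lifts a test map h. The precision M at the source
    may depend on N, which is harmless because [coh] provides a family at every precision. *)
Lemma coh_map (I : nat -> tsideal A) (I' : nat -> tsideal A')
    (phi : {additive A -> A'}) :
  (forall u v x, typed e u v x -> typed e' u v (phi x)) ->
  (forall u v w x y, typed e u v x -> typed e v w y ->
     phi (x * y) = phi x * phi y) ->
  (forall N, exists M, forall x, I M x -> I' N (phi x)) ->
  (forall N u v x', typed e' u v x' ->
     exists2 x, typed e u v x & I' N (x' - phi x)) ->
  forall (X : Type) (G : X -> V -> int), coh e I G -> coh e' I' G.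
Proof.
move=> pt pM pI ps X G cG N; have [M phiI] := pI N.
have [F [Ft Fc Fn]] := cG M.
pose psi : {additive qring (I M) -> qring (I' N)} := qmap phiI.
have psiE x : psi (qpi _ x) = qpi _ (phi x) by exact: qmapE.
have psit u v x : typed (qe e (I M)) u v x -> typed (qe e' (I' N)) u v (psi x).
  move=> /(qpi_typed eE)[y yt ->]; rewrite psiE.
  exact: typed_qpi (pt _ _ _ yt).
exists (fun a => map_pres psi (F a)); split=> [a|a b|//].
- exact: map_typed psit _ (Ft a).
- apply: map_compat psit _ _ _ _ (Ft a) (Ft b) (Fc a b).
    move=> u v w x y /(qpi_typed eE)[x1 xt ->] /(qpi_typed eE)[y1 yt ->].
    by rewrite -qpiM !psiE -qpiM (pM u v w).
  move=> u v x' /(qpi_typed eE')[y' yt ->]; have [x xt xE] := ps N _ _ _ yt.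
  exists (qpi _ x); first exact: typed_qpi.
  by rewrite psiE; apply/qpiP.
Qed.

End Coh.

(** * Path algebras *)

Section PathBasics.
Context (K : fieldType) {V : finType} (Q : quiver V).
Local Notation A := (path_algebra K Q).
Local Notation e := (idem K Q).

Definition pth (p : qpath Q) : A := << p >>.

Lemma pthM p q : pth p * pth q = pvec K (qpcomp p q).
Proof. exact: pamulUU. Qed.

Lemma pscalerAl (c : K) (x y : A) : c *: (x * y) = (c *: x) * y.
Proof.
by have /= := pamul_linl y c x 0; rewrite pamul0l !addr0 => <-.
Qed.

Lemma pscalerAr (c : K) (x y : A) : c *: (x * y) = x * (c *: y).
Proof. by rewrite -[RHS]/(pamul x _) linearZ. Qed.

Lemma pa_sumE (x : A) : x = \sum_(p <- dom x) coeff p x *: pth p.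
Proof.
by rewrite -[LHS]freeg_sumE; apply: eq_bigr => p _; rewrite freegZE.
Qed.

Lemma pa_ind (P : A -> Prop) :
  P 0 -> (forall x y, P x -> P y -> P (x + y)) ->
  (forall c x, P x -> P (c *: x)) -> (forall p, P (pth p)) -> forall x, P x.
Proof.
move=> P0 PD PZ Pp x; rewrite (pa_sumE x).
by apply: big_ind => // p _; exact: PZ.
Qed.

Lemma idem_pthl u p : e u * pth p = if u == ptgt p then pth p else 0.
Proof. by rewrite [LHS]pthM qpcomp1p; case: eqP. Qed.

Lemma idem_pthr v p : pth p * e v = if v == psrc p then pth p else 0.
Proof. by rewrite [LHS]pthM qpcompp1; case: eqP. Qed.

Lemma idemE u v : e u * e v = if u == v then e u else 0.
Proof. by rewrite [LHS]idem_pthl /=; case: eqP => [->|]. Qed.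

Local Notation ty := (typed e).

Lemma typed_pth p : ty (ptgt p) (psrc p) (pth p).
Proof. by rewrite /typed idem_pthl eqxx idem_pthr eqxx. Qed.

Lemma typedZ u v (c : K) x : ty u v x -> ty u v (c *: x).
Proof. by rewrite /typed => xt; rewrite -pscalerAr -pscalerAl xt. Qed.

Lemma typed_ind u v (P : A -> Prop) :
  P 0 -> (forall x y, P x -> P y -> P (x + y)) ->
  (forall c x, P x -> P (c *: x)) ->
  (forall p, ptgt p = u -> psrc p = v -> P (pth p)) ->
  forall x, ty u v x -> P x.
Proof.
move=> P0 PD PZ Pp x <-; apply: (pa_ind (P := fun x => P (e u * x * e v))).
- by rewrite mulr0 mul0r.
- by move=> y z Py Pz; rewrite mulrDr mulrDl; exact: PD.
- by move=> c y Py; rewrite -pscalerAr -pscalerAl; exact: PZ.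
- move=> p; rewrite idem_pthl; case: eqP => [up|_]; last by rewrite mul0r.
  by rewrite idem_pthr; case: eqP => // vp; exact: Pp.
Qed.

Lemma path_of_qpath (v : V) s (h : is_qpath (v, s)) :
  path_of K v s = pth (QPath h).
Proof. by rewrite /path_of (insubT (@is_qpath V Q) h). Qed.

Lemma path_of0 (v : V) s : ~~ is_qpath (Q := Q) (v, s) -> path_of K v s = 0.
Proof. by move=> h; rewrite /path_of insubN. Qed.

Lemma pth_path_of p : pth p = path_of K (ptgt p) (word p).
Proof.
have h : is_qpath (ptgt p, word p) by case: p => -[u s] /= h.
by rewrite (path_of_qpath h); congr (pth _); apply: val_inj; case: p h => -[].
Qed.

Lemma path_of_nil v : path_of K v [::] = e v.
Proof. by rewrite (path_of_qpath (isT : is_qpath (v, [::]))); congr (pth _); exact: val_inj. Qed.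

Lemma path_of_cat v s t :
  path_of K v (s ++ t) = path_of K v s * path_of K (last v (map (@src V Q) s)) t.
Proof.
have [h|h] := boolP (is_qpath (v, s ++ t)); last first.
  rewrite (path_of0 h); move: h; rewrite is_qpath_cat negb_and => /orP[] h.
    by rewrite (path_of0 h) mul0r.
  by rewrite (path_of0 h) mulr0.
rewrite (path_of_qpath h); have := h; rewrite is_qpath_cat => /andP[h1 h2].
rewrite (path_of_qpath h1) (path_of_qpath h2) pthM.
have [_ /(_ _) -> //] := qpcompS (QPath h1) (QPath h2) (QPath h).
Qed.

Definition arr (a : arrow Q) : A := path_of K (tgt a) [:: a].

Lemma is_qpath1 (a : arrow Q) : is_qpath (tgt a, [:: a]).
Proof. by rewrite /is_qpath /= eqxx. Qed.

Lemma arrE a : arr a = pth (QPath (is_qpath1 a)).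
Proof. exact: path_of_qpath. Qed.

Lemma typed_arr a : ty (tgt a) (src a) (arr a).
Proof. by rewrite arrE; exact: typed_pth. Qed.

Lemma path_of_cons v a s :
  path_of K v (a :: s) = if v == tgt a then arr a * path_of K (src a) s else 0.
Proof.
case: eqP => [->|ne]; first by rewrite -cat1s path_of_cat.
by apply: path_of0; rewrite /is_qpath /= eq_sym; case: eqP ne.
Qed.

Lemma path_of_rcons v s a : path_of K v (rcons s a) =
  path_of K v s * (if last v (map (@src V Q) s) == tgt a then arr a else 0).
Proof. by rewrite -cats1 path_of_cat path_of_cons path_of_nil; case: eqP => // _; rewrite (typedr idemE (typed_arr a)). Qed.

Lemma typed_path_of v s : ty v (last v (map (@src V Q) s)) (path_of K v s).
Proof.
have [h|/path_of0->] := boolP (is_qpath (v, s)); last exact: typed0.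
by rewrite (path_of_qpath h); exact: typed_pth.
Qed.

Lemma psrc_path (p : qpath Q) : psrc p = last (ptgt p) (map (@src V Q) (word p)).
Proof. by []. Qed.

Section Lift.
Variables (M : lmodType K) (f : qpath Q -> M).

Definition palift : A -> M := fglift f.

HB.instance Definition _ := GRing.Linear.copy palift (fglift f).

Lemma paliftE p : palift (pth p) = f p.
Proof. exact: fgliftU1. Qed.

End Lift.

(** ** Length filtration *)

(** Membership in the N-th power of the arrow ideal, read off from the support. *)
Definition in_rad (N : nat) (x : A) :=
  forall p, coeff p x != 0 -> (N <= size (word p))%N.

Lemma in_rad0 N : in_rad N 0.
Proof. by move=> p; rewrite coeff0 eqxx. Qed.

Lemma in_radD N x y : in_rad N x -> in_rad N y -> in_rad N (x + y).
Proof.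
move=> hx hy p; rewrite coeffD; have [x0|] := eqVneq (coeff p x) 0; last by move/hx.
by rewrite x0 add0r; exact: hy.
Qed.

Lemma in_radZ N (c : K) x : in_rad N x -> in_rad N (c *: x).
Proof.
by move=> hx p; rewrite coeffZ mulf_eq0 negb_or => /andP[_]; exact: hx.
Qed.

Lemma in_rad_pth N p : (N <= size (word p))%N -> in_rad N (pth p).
Proof.
by move=> h q; rewrite coeffU mul1r; case: (p =P q) => [<- //|_]; rewrite eqxx.
Qed.

Lemma in_rad_sum N (T : Type) (r : seq T) (P : pred T) F :
  (forall i, P i -> in_rad N (F i)) -> in_rad N (\sum_(i <- r | P i) F i).
Proof. by move=> h; apply: big_ind => //; [exact: in_rad0 | exact: in_radD]. Qed.

Lemma in_radW M N x : (N <= M)%N -> in_rad M x -> in_rad N x.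
Proof. by move=> le h p /h; exact: leq_trans. Qed.

Lemma in_rad_ind N (P : A -> Prop) :
  P 0 -> (forall x y, P x -> P y -> P (x + y)) ->
  (forall c x, P x -> P (c *: x)) ->
  (forall p, (N <= size (word p))%N -> P (pth p)) ->
  forall x, in_rad N x -> P x.
Proof.
move=> P0 PD PZ Pp x hx; rewrite (pa_sumE x) big_seq.
by apply: big_ind => // p; rewrite mem_dom => /hx /Pp; exact: PZ.
Qed.

Lemma in_radM M N x y : in_rad M x -> in_rad N y -> in_rad (M + N) (x * y).
Proof.
move=> hx hy; move: y hy; apply: in_rad_ind.
- by rewrite mulr0; exact: in_rad0.
- by move=> y1 y2; rewrite mulrDr; exact: in_radD.
- by move=> c y1; rewrite -pscalerAr; exact: in_radZ.
move=> q hq; move: x hx; apply: in_rad_ind.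
- by rewrite mul0r; exact: in_rad0.
- by move=> y1 y2; rewrite mulrDl; exact: in_radD.
- by move=> c y1; rewrite -pscalerAl; exact: in_radZ.
move=> p hp; rewrite pthM; case E: (qpcomp p q) => [r|]; last exact: in_rad0.
apply: in_rad_pth; move/qpcompS: E => [_ rE].
by rewrite /word rE /= size_cat leq_add.
Qed.

Lemma in_radMl N x y : in_rad N x -> in_rad N (y * x).
Proof. by move=> hx; rewrite -[N]add0n; exact: in_radM. Qed.

Lemma in_radMr N x y : in_rad N x -> in_rad N (x * y).
Proof. by move=> hx; rewrite -[N]addn0; exact: in_radM. Qed.

Lemma in_radX N x n : in_rad N x -> in_rad (n * N) (x ^+ n).
Proof.
by move=> hx; elim: n => // n IH; rewrite exprS mulSn; exact: in_radM.
Qed.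

Lemma in_rad_path_of N v s : (N <= size s)%N -> in_rad N (path_of K v s).
Proof.
move=> h; have [hs|/path_of0->] := boolP (is_qpath (v, s)); last exact: in_rad0.
by rewrite (path_of_qpath hs); exact: in_rad_pth.
Qed.

Lemma in_rad_arr a : in_rad 1 (arr a).
Proof. exact: in_rad_path_of. Qed.

(** ** Scalar part at a vertex *)

Definition scal (v : V) (x : A) : K := coeff (qpidem Q v) x.

Lemma scalD v : {morph scal v : x y / x + y}.
Proof. by move=> x y; rewrite /scal coeffD. Qed.

Lemma scalZ v c x : scal v (c *: x) = c * scal v x.
Proof. by rewrite /scal coeffZ. Qed.

Lemma scal0 v : scal v 0 = 0. Proof. by rewrite /scal coeff0. Qed.

Lemma scal_pth v p : scal v (pth p) = (p == qpidem Q v)%:R.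
Proof. by rewrite /scal coeffU mul1r. Qed.

(** A product of two paths is the idempotent e_v only if both factors are e_v. So [scal v] is the
    character of the path algebra that kills the arrows and the other idempotents. *)
Lemma scalM v : {morph scal v : x y / x * y}.
Proof.
move=> x y; move: y; apply: pa_ind.
- by rewrite mulr0 scal0 mulr0.
- by move=> y z hy hz; rewrite mulrDr !scalD mulrDr hy hz.
- by move=> c y hy; rewrite -pscalerAr !scalZ hy mulrCA.
move=> q; move: x; apply: pa_ind.
- by rewrite mul0r scal0 mul0r.
- by move=> y z hy hz; rewrite mulrDl !scalD mulrDl hy hz.
- by move=> c y hy; rewrite -pscalerAl !scalZ hy mulrA.
move=> p; rewrite !scal_pth pthM -natrM mulnb.
have [pE|pE] := eqVneq p (qpidem Q v).
  by rewrite pE qpcomp1p /=; case: eqP => [->|ne] /=;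
     rewrite ?scal_pth ?scal0 //; case: eqP => // qE; case: ne; rewrite qE.
case E: (qpcomp p q) => [r|]; last by rewrite scal0.
rewrite scal_pth; case: eqP => // rE; move/qpcompS: E => [epq]; rewrite rE /=.
case: p pE epq => -[u s] h pE /= epq [vE /esym/nilP].
rewrite /word cat_nilp => /andP[/nilP /= sE _].
case/negP: pE; apply/eqP/val_inj => /=.
by congr (_, _); [exact: esym vE | exact: sE].
Qed.

Lemma scal_idem u v : scal u (e v) = (u == v)%:R.
Proof.
rewrite [LHS]scal_pth; congr (nat_of_bool _)%:R.
by apply/eqP/eqP => [[->]|->].
Qed.

Lemma scal_rad v x : in_rad 1 x -> scal v x = 0.
Proof. by move=> hx; apply/eqP; apply: contraT => /hx. Qed.

Lemma rad1_split v x : ty v v x -> in_rad 1 (x - scal v x *: e v).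
Proof.
apply: (typed_ind (P := fun x => in_rad 1 (x - scal v x *: e v))).
- by rewrite scal0 scale0r subrr; exact: in_rad0.
- by move=> y z hy hz; rewrite scalD scalerDl opprD addrACA; exact: in_radD.
- by move=> c y hy; rewrite scalZ -scalerA -scalerBr; exact: in_radZ.
move=> p pu pv; rewrite scal_pth; case: (eqVneq p (qpidem Q v)) => [->|ne].
  by rewrite scale1r subrr; exact: in_rad0.
rewrite scale0r subr0; apply: in_rad_pth; case: p ne pu {pv} => -[u [|//]] h ne pu.
by case/eqP: ne; apply: val_inj; rewrite /= -pu.
Qed.

(** With x = c (e_v - r) and r in the arrow ideal, the inverse is the geometric series of r cut off
    after N terms; the error involves r^N only. *)
Lemma local_inv N v x : ty v v x -> scal v x != 0 ->
  exists w, [/\ ty v v w, in_rad N (x * w - e v) & in_rad N (w * x - e v)].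
Proof.
move=> xt nz; set c := scal v x in nz.
pose r := e v - c^-1 *: x.
have rt : ty v v r by apply: typedB; [exact: (typed_idem idemE) | exact: typedZ].
have r1 : in_rad 1 r.
  rewrite /r -opprB -scaleN1r; apply: in_radZ.
  have := in_radZ (c := c^-1) (rad1_split xt); rewrite -/c scalerBr scalerA mulVf //.
  by rewrite scale1r.
have xE : x = c *: (e v - r).
  by rewrite /r opprB addrC subrK scalerA mulfV // scale1r.
pose S := \sum_(i < N) r ^+ i.
have SE : (1 - r) * S = 1 - r ^+ N.
  rewrite /S; elim: (N) => [|n IH]; first by rewrite big_ord0 mulr0 subrr.
  by rewrite big_ord_recr mulrDr IH mulrBl mul1r -exprS addrA subrK.
have SE' : S * (1 - r) = 1 - r ^+ N.
  rewrite -SE /S mulr_suml mulr_sumr; apply: eq_bigr => i _.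
  by rewrite mulrBr mulrBl mulr1 mul1r -exprS -exprSr.
have er : e v * (1 - r) = e v - r by rewrite mulrBr mulr1 (typedl idemE rt).
have re : (1 - r) * e v = e v - r by rewrite mulrBl mul1r (typedr idemE rt).
have comm : (1 - r) * e v = e v * (1 - r) by rewrite er re.
have erN : e v * (1 - r ^+ N) * e v - e v = - (e v * r ^+ N * e v).
  by rewrite mulrBr mulrBl mulr1 idemE eqxx addrAC subrr add0r.
have radN : in_rad N (- (e v * r ^+ N * e v)).
  rewrite -scaleN1r; apply/in_radZ/in_radMr/in_radMl.
  by have := in_radX (n := N) r1; rewrite muln1.
exists (c^-1 *: (e v * S * e v)); split.
- by apply: typedZ; exact: (typed_proj idemE).
- rewrite xE -pscalerAl -pscalerAr scalerA mulfV // scale1r -er !mulrA.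
  rewrite -(mulrA (e v) _ (e v)) comm !mulrA idemE eqxx -(mulrA (e v) (1 - r)).
  by rewrite SE erN.
- rewrite xE -pscalerAl -pscalerAr scalerA mulVf // scale1r -re !mulrA.
  rewrite -(mulrA _ (e v) (1 - r)) -comm !mulrA -(mulrA _ (e v) (e v)) idemE.
  by rewrite eqxx -(mulrA (e v) S) SE' erN.
Qed.

End PathBasics.

(** * Evaluation of paths avoiding a set of vertices *)

Section GoodPaths.
Context (K : fieldType) {V : finType} (P : quiver V) (bad : pred V).
Local Notation A := (path_algebra K P).
Local Notation e := (idem K P).
Local Notation ty := (typed e).
Hypothesis noloop : forall a : arrow P, bad (src a) -> ~~ bad (tgt a).
Local Notation psrcw v s := (last v (map (@src V P) s)).

Lemma path_is_qpath (a : arrow P) s :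
  path (@composable V P) a s -> is_qpath (src a, s).
Proof. by case: s => //= c s; rewrite /is_qpath /= eq_sym. Qed.

(** Since no arrow joins two bad vertices, a path between good vertices splits, read from the left,
    into arrows between good vertices and pairs of arrows through a bad one. *)
Lemma good_word_ind (S : V -> V -> seq (arrow P) -> Prop) :
  (forall v, ~~ bad v -> S v v [::]) ->
  (forall a v s, ~~ bad (tgt a) -> ~~ bad (src a) ->
     is_qpath (src a, s) -> S (src a) v s -> S (tgt a) v (a :: s)) ->
  (forall b a v s, ~~ bad (tgt b) -> src b = tgt a -> bad (src b) ->
     ~~ bad (src a) -> is_qpath (src a, s) -> S (src a) v s ->
     S (tgt b) v (b :: a :: s)) ->
  forall u v s, ~~ bad u -> ~~ bad v -> is_qpath (u, s) -> psrcw u s = v ->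
    S u v s.
Proof.
move=> S0 S1 S2 u v s; have [n] := ubnP (size s).
elim: n u s => // n IH u [|b s] /= sz ug vg; first by move=> _ <-; exact: S0.
rewrite /is_qpath /= => /andP[/eqP bu hs] vE; rewrite -bu in ug *.
have [bs|bs] := boolP (bad (src b)).
  case: s sz hs vE => [|a s] /= sz; first by move=> _ vE; rewrite vE (negbTE vg) in bs.
  move=> /andP[ba hs] vE.
  have ag : ~~ bad (src a).
    by apply/negP => /noloop; rewrite -(eqP ba) bs.
  have hs' : is_qpath (src a, s).
    exact: path_is_qpath.
  by apply: S2 => //; [exact/eqP | apply: IH => //; exact: ltnW].
have hs' : is_qpath (src b, s).
  exact: path_is_qpath.
by apply: S1 => //; exact: IH.
Qed.

Lemma good_ind (S : V -> V -> A -> Prop) :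
  (forall u v, S u v 0) ->
  (forall u v x y, S u v x -> S u v y -> S u v (x + y)) ->
  (forall u v c x, S u v x -> S u v (c *: x)) ->
  (forall v, ~~ bad v -> S v v (e v)) ->
  (forall a v x, ~~ bad (tgt a) -> ~~ bad (src a) -> ~~ bad v -> ty (src a) v x ->
     S (src a) v x -> S (tgt a) v (arr K a * x)) ->
  (forall b a v x, ~~ bad (tgt b) -> src b = tgt a -> bad (src b) ->
     ~~ bad (src a) -> ~~ bad v -> ty (src a) v x -> S (src a) v x ->
     S (tgt b) v (arr K b * arr K a * x)) ->
  forall u v x, ~~ bad u -> ~~ bad v -> ty u v x -> S u v x.
Proof.
move=> S0 SD SZ Se S1 S2 u v x ug vg; apply: typed_ind; [exact: S0| | |].
- exact: SD.
- exact: SZ.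
move=> p pu pv; rewrite pth_path_of pu.
have hp : is_qpath (u, word p) by case: p pu {pv} => -[w s] /= h <-.
have {pv}pv : psrcw u (word p) = v by rewrite -pv -pu.
pose S' u v s := is_qpath (u, s) -> psrcw u s = v -> ~~ bad v -> S u v (path_of K u s).
suff: S' u v (word p) by exact.
apply: (good_word_ind (S := S')) => // {u v x ug vg p pu hp pv}.
- by move=> v vg _ _ _; rewrite path_of_nil; exact: Se.
- move=> a v s ta sa hs IH h /= sv vg; rewrite path_of_cons eqxx.
  apply: S1 => //; last exact: IH.
  by have := typed_path_of K (src a) s; rewrite sv.
- move=> b a v s tb ba bb sa hs IH h /= sv vg.
  rewrite path_of_cons eqxx path_of_cons ba eqxx mulrA.
  apply: S2 => //; last exact: IH.
  by have := typed_path_of K (src a) s; rewrite sv.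
Qed.

End GoodPaths.

Section Cev.
Context (K : fieldType) {V : finType} (P P' : quiver V) (bad : pred V).
Local Notation A := (path_algebra K P).
Local Notation A' := (path_algebra K P').
Local Notation e := (idem K P).
Local Notation e' := (idem K P').
Local Notation ty := (typed e).
Local Notation ty' := (typed e').
Local Notation psrcw v s := (last v (map (@src V P) s)).
Variables (F1 : arrow P -> A') (F2 : arrow P -> arrow P -> A').

(* [F1] is used on the arrows between good vertices, [F2 b a] on the paths
   [b a] through a bad vertex; the value on other words is irrelevant. *)
Fixpoint cev (s : seq (arrow P)) : A' :=
  match s with
  | [::] => 1
  | b :: s1 =>
      if bad (src b) then if s1 is a :: s2 then F2 b a * cev s2 else 0
      else F1 b * cev s1
  end.

(** The factor [e' (ptgt p)] gives the right value on trivial paths, whose word is empty and on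
    which [cev] is 1. *)
Definition ceval : A -> A' := palift (fun p => e' (ptgt p) * cev (word p)).

HB.instance Definition _ := GRing.Linear.copy ceval
  (palift (fun p => e' (ptgt p) * cev (word p))).

Lemma ceval0 : ceval 0 = 0. Proof. exact: raddf0. Qed.
Lemma cevalD x y : ceval (x + y) = ceval x + ceval y. Proof. exact: raddfD. Qed.
Lemma cevalZ c x : ceval (c *: x) = c *: ceval x. Proof. exact: linearZ. Qed.

Lemma ceval_sum (I : Type) (s : seq I) (D : pred I) F :
  ceval (\sum_(i <- s | D i) F i) = \sum_(i <- s | D i) ceval (F i).
Proof. exact: raddf_sum. Qed.

Lemma ceval_path_of v s : is_qpath (v, s) -> ceval (path_of K v s) = e' v * cev s.
Proof. by move=> h; rewrite (path_of_qpath K h) /ceval paliftE. Qed.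

Lemma ceval_idem v : ceval (e v) = e' v.
Proof. by rewrite -path_of_nil ceval_path_of // mulr1. Qed.

Hypothesis noloop : forall a : arrow P, bad (src a) -> ~~ bad (tgt a).
Hypothesis F1t : forall b, ~~ bad (tgt b) -> ~~ bad (src b) ->
  ty' (tgt b) (src b) (F1 b).
Hypothesis F2t : forall b a, src b = tgt a -> bad (src b) ->
  ty' (tgt b) (src a) (F2 b a).

Lemma cev_typed u v s : ~~ bad u -> ~~ bad v -> is_qpath (u, s) -> psrcw u s = v ->
  e' u * cev s = cev s * e' v.
Proof.
have E' := @idemE K V P'.
apply: (@good_word_ind V P bad noloop (fun u v s => e' u * cev s = cev s * e' v)).
- by move=> w _ /=; rewrite mul1r mulr1.
- move=> a w t ta sa _ IH /=; rewrite (negbTE sa) mulrA.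
  by rewrite (typedl E' (F1t ta sa)) -[in RHS]mulrA -IH mulrA (typedr E' (F1t ta sa)).
- move=> b a w t tb ba bb sa _ IH /=; rewrite bb mulrA.
  by rewrite (typedl E' (F2t ba bb)) -[in RHS]mulrA -IH mulrA (typedr E' (F2t ba bb)).
Qed.

Lemma cev_cat u v s t : ~~ bad u -> ~~ bad v -> is_qpath (u, s) -> psrcw u s = v ->
  cev (s ++ t) = cev s * cev t.
Proof.
apply: (@good_word_ind V P bad noloop (fun u v s => cev (s ++ t) = cev s * cev t)).
- by move=> w _; rewrite mul1r.
- by move=> a w r ta sa _ IH /=; rewrite (negbTE sa) IH mulrA.
- by move=> b a w r tb ba bb sa _ IH /=; rewrite bb IH mulrA.
Qed.

Lemma ceval_typed u v x : ~~ bad u -> ~~ bad v -> ty u v x -> ty' u v (ceval x).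
Proof.
have E' := @idemE K V P'.
move=> ug vg; move: x; apply: typed_ind.
- by rewrite ceval0; exact: typed0.
- by move=> y z yt zt; rewrite cevalD; exact: typedD.
- by move=> c y yt; rewrite cevalZ; exact: typedZ.
move=> p pu pv; rewrite pth_path_of pu.
have hp : is_qpath (u, word p) by case: p pu {pv} => -[w s] /= h <-.
rewrite ceval_path_of //; apply: (typedP); first by rewrite mulrA E' eqxx.
rewrite -mulrA -(cev_typed ug vg hp) ?mulrA ?E' ?eqxx //.
by rewrite -pv -pu.
Qed.

(** The vertex v at which the product is cut must be good: then the cut never separates the two
    arrows of a passage through a bad vertex. *)
Lemma cevalM u v w x y : ~~ bad u -> ~~ bad v -> ~~ bad w ->
  ty u v x -> ty v w y -> ceval (x * y) = ceval x * ceval y.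
Proof.
have E' := @idemE K V P'.
move=> ug vg wg xt yt; move: y yt; apply: typed_ind.
- by rewrite mulr0 !ceval0 mulr0.
- by move=> y z hy hz; rewrite mulrDr !cevalD hy hz mulrDr.
- by move=> c y hy; rewrite -pscalerAr !cevalZ hy pscalerAr.
move=> q qv qw; move: x xt; apply: typed_ind.
- by rewrite mul0r !ceval0 mul0r.
- by move=> y z hy hz; rewrite mulrDl !cevalD hy hz mulrDl.
- by move=> c y hy; rewrite -pscalerAl !cevalZ hy pscalerAl.
move=> p pu pv; rewrite !pth_path_of pu qv.
have hp : is_qpath (u, word p) by case: p pu {pv} => -[z s] /= h <-.
have hq : is_qpath (v, word q) by case: q qv {qw} => -[z s] /= h <-.
have sp : psrcw u (word p) = v by rewrite -pv -pu.
rewrite -[in LHS]sp -path_of_cat !ceval_path_of //; last by rewrite is_qpath_cat hp sp.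
rewrite (cev_cat _ ug vg hp sp) mulrA -[in RHS](mulrA _ (cev _)).
rewrite [cev _ * (_ * _)]mulrA -(cev_typed ug vg hp sp).
by rewrite !mulrA E' eqxx.
Qed.

Lemma ceval_arr a : ~~ bad (tgt a) -> ~~ bad (src a) -> ceval (arr K a) = F1 a.
Proof.
move=> ta sa; rewrite ceval_path_of ?is_qpath1 //= (negbTE sa) mulr1.
exact: (typedl (@idemE K V P')) (F1t ta sa).
Qed.

Lemma ceval_arr2 b a : src b = tgt a -> bad (src b) ->
  ceval (arr K b * arr K a) = F2 b a.
Proof.
move=> ba bb; have -> : arr K b * arr K a = path_of K (tgt b) [:: b; a].
  by rewrite path_of_cons eqxx /arr ba.
rewrite ceval_path_of; last by rewrite /is_qpath /= eqxx /composable ba eqxx.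
rewrite /= bb mulr1; exact: (typedl (@idemE K V P')) (F2t ba bb).
Qed.

Hypothesis F1r : forall b, in_rad 1 (F1 b).
Hypothesis F2r : forall b a, in_rad 1 (F2 b a).

(** Two arrows through a bad vertex may be replaced by a single one, so evaluation can halve the
    length. This is the source of the doubled precisions below. *)
Lemma cev_rad s : in_rad (uphalf (size s)) (cev s).
Proof.
have [n] := ubnP (size s); elim: n s => // n IH [|b s] // sz.
rewrite /=; case: ifP => _.
  case: s sz => [|a s] //= sz; first exact: in_rad0.
  rewrite -add1n; apply: in_radM; first exact: F2r.
  by apply: IH; exact: ltnW.
have le : ((size s)./2.+1 <= 1 + uphalf (size s))%N.
  by rewrite add1n ltnS uphalf_half leq_addl.
by apply: (in_radW le); apply: in_radM; [exact: F1r | exact: IH].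
Qed.

Lemma ceval_rad_uphalf N x : in_rad N x -> in_rad (uphalf N) (ceval x).
Proof.
move: x; apply: in_rad_ind.
- by rewrite ceval0; exact: in_rad0.
- by move=> x y hx hy; rewrite cevalD; exact: in_radD.
- by move=> c x hx; rewrite cevalZ; exact: in_radZ.
move=> p hp; rewrite /ceval paliftE; apply: in_radMl; apply: in_radW; last exact: cev_rad.
exact: uphalf_leq.
Qed.

Lemma ceval_rad N x : in_rad N.*2 x -> in_rad N (ceval x).
Proof. by move=> /ceval_rad_uphalf; rewrite uphalf_double. Qed.

End Cev.

(** * Cancelling an arrow *)

Section Cancel.
Context (K : fieldType) {V : finType} (P : quiver V).
Local Notation A := (path_algebra K P).
Local Notation e := (idem K P).
Local Notation ty := (typed e).
Local Notation ar := (arr K).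

(** Cancellation of the leftmost arrow, when it is a; the other paths are killed. [lcan] and [rcan]
    give the coefficients of an element along the arrows at its left or right end. *)
Definition lcan_qpath (a : arrow P) (p : qpath P) : A :=
  if word p is b :: s then if b == a then path_of K (src a) s else 0 else 0.

Definition rcan_qpath (b : arrow P) (p : qpath P) : A :=
  if word p is c :: s then
    if last c s == b then path_of K (ptgt p) (belast c s) else 0 else 0.

Definition lcan a : A -> A := palift (lcan_qpath a).
Definition rcan b : A -> A := palift (rcan_qpath b).

HB.instance Definition _ a := GRing.Linear.copy (lcan a) (palift (lcan_qpath a)).
HB.instance Definition _ b := GRing.Linear.copy (rcan b) (palift (rcan_qpath b)).

Lemma lcan0 a : lcan a 0 = 0. Proof. exact: raddf0. Qed.
Lemma lcanD a x y : lcan a (x + y) = lcan a x + lcan a y. Proof. exact: raddfD. Qed.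
Lemma lcanZ a c x : lcan a (c *: x) = c *: lcan a x. Proof. exact: linearZ. Qed.
Lemma rcan0 a : rcan a 0 = 0. Proof. exact: raddf0. Qed.
Lemma rcanD a x y : rcan a (x + y) = rcan a x + rcan a y. Proof. exact: raddfD. Qed.
Lemma rcanZ a c x : rcan a (c *: x) = c *: rcan a x. Proof. exact: linearZ. Qed.

Lemma lcan_path a v b s : is_qpath (v, b :: s) ->
  lcan a (path_of K v (b :: s)) = if b == a then path_of K (src a) s else 0.
Proof. by move=> h; rewrite (path_of_qpath K h) /lcan paliftE /lcan_qpath. Qed.

Lemma rcan_path b v s c : is_qpath (v, rcons s c) ->
  rcan b (path_of K v (rcons s c)) = if c == b then path_of K v s else 0.
Proof.
move=> h; rewrite (path_of_qpath K h) /rcan paliftE /rcan_qpath /word /ptgt /=.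
by case: s h => [|d s] h //=; rewrite last_rcons belast_rcons.
Qed.

Lemma rcan_idem b v : rcan b (e v) = 0.
Proof. by rewrite -path_of_nil (path_of_qpath K (isT : is_qpath (v, [::]))) /rcan paliftE /rcan_qpath. Qed.

Lemma lcan_idem b v : lcan b (e v) = 0.
Proof. by rewrite -path_of_nil (path_of_qpath K (isT : is_qpath (v, [::]))) /lcan paliftE /lcan_qpath. Qed.

Lemma lcan_arr a c x : lcan a (ar c * x) = if c == a then e (src a) * x else 0.
Proof.
have E := @idemE K V P.
move: x; apply: pa_ind.
- by rewrite !mulr0 lcan0 if_same.
- by move=> x y hx hy; rewrite mulrDr lcanD hx hy; case: eqP; rewrite ?addr0 ?mulrDr.
- by move=> k x hx; rewrite -pscalerAr lcanZ hx; case: eqP; rewrite ?scaler0 ?pscalerAr.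
move=> p; have [cp|cp] := eqVneq (src c) (ptgt p); last first.
  rewrite idem_pthl (_ : ar c * pth K p = 0) ?lcan0; last first.
    by rewrite -(typedr E (typed_arr K c)) -mulrA idem_pthl (negbTE cp) mulr0.
  by case: eqP => // <-; rewrite (negbTE cp).
have hp : is_qpath (src c, word p) by rewrite cp; case: p {cp} => -[].
rewrite pth_path_of -cp; have := path_of_cons K (tgt c) c (word p).
rewrite eqxx => <-; rewrite lcan_path; last first.
  have := is_qpath_cat (tgt c) [:: c] (word p).
  by rewrite /= is_qpath1 hp.
by case: eqP => // ->; rewrite (typedl E (typed_path_of K _ _)).
Qed.

Lemma rcan_arr b c x : rcan b (x * ar c) = if c == b then x * e (tgt b) else 0.
Proof.
have E := @idemE K V P.
move: x; apply: pa_ind.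
- by rewrite !mul0r rcan0 if_same.
- by move=> x y hx hy; rewrite mulrDl rcanD hx hy; case: eqP; rewrite ?addr0 ?mulrDl.
- by move=> k x hx; rewrite -pscalerAl rcanZ hx; case: eqP; rewrite ?scaler0 ?pscalerAl.
move=> p; have [cp|cp] := eqVneq (tgt c) (psrc p); last first.
  rewrite idem_pthr (_ : pth K p * ar c = 0) ?rcan0; last first.
    by rewrite -(typedl E (typed_arr K c)) mulrA idem_pthr (negbTE cp) mul0r.
  by case: eqP => // <-; rewrite (negbTE cp).
have hp : is_qpath (ptgt p, word p) by case: p {cp} => -[].
have := path_of_rcons K (ptgt p) (word p) c; rewrite -psrc_path -cp eqxx.
rewrite -pth_path_of => <-; rewrite rcan_path; last first.
  by rewrite -cats1 is_qpath_cat hp -psrc_path -cp is_qpath1.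
by case: eqP => // <-; rewrite idem_pthr cp eqxx pth_path_of.
Qed.

(** A trivial path in x would let the cancelled arrow come from y, hence the condition on x. *)
Lemma lcanM a x y : in_rad 1 x -> lcan a (x * y) = lcan a x * y.
Proof.
have E := @idemE K V P.
move: x; apply: in_rad_ind.
- by rewrite mul0r !lcan0 mul0r.
- by move=> x z hx hz; rewrite mulrDl !lcanD hx hz mulrDl.
- by move=> k x hx; rewrite -pscalerAl !lcanZ hx pscalerAl.
move=> p; rewrite pth_path_of; case: (word p) => // c s _.
rewrite path_of_cons; case: eqP => _; last by rewrite mul0r lcan0 mul0r.
by rewrite -mulrA !lcan_arr; case: eqP => _; rewrite ?mul0r ?mulrA.
Qed.

Lemma rcanM b x y : in_rad 1 y -> rcan b (x * y) = x * rcan b y.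
Proof.
have E := @idemE K V P.
move: y; apply: in_rad_ind.
- by rewrite mulr0 !rcan0 mulr0.
- by move=> y z hy hz; rewrite mulrDr !rcanD hy hz mulrDr.
- by move=> k y hy; rewrite -pscalerAr !rcanZ hy pscalerAr.
move=> p; rewrite pth_path_of; case/lastP: (word p) => // s c _.
rewrite path_of_rcons; case: eqP => _; last by rewrite mulr0 mulr0 rcan0 mulr0.
by rewrite mulrA !rcan_arr; case: eqP => _; rewrite ?mulr0 ?mulrA.
Qed.

Lemma lcan_typed a v x : ty (tgt a) v x -> ty (src a) v (lcan a x).
Proof.
move: x; apply: typed_ind.
- by rewrite lcan0; exact: typed0.
- by move=> y z hy hz; rewrite lcanD; exact: typedD.
- by move=> c y hy; rewrite lcanZ; exact: typedZ.
move=> p pa pv; rewrite pth_path_of pa.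
have hp : is_qpath (tgt a, word p) by case: p pa {pv} => -[w s] /= h <-.
have sp : last (tgt a) (map (@src V P) (word p)) = v by rewrite -pv -pa.
case: (word p) hp sp => [|c s] hp sp; first by rewrite path_of_nil lcan_idem; exact: typed0.
rewrite lcan_path //; case: eqP => [ca|_]; last exact: typed0.
by move: sp; rewrite /= ca => sp; have := typed_path_of K (src a) s; rewrite sp.
Qed.

Lemma rcan_typed b u x : ty u (src b) x -> ty u (tgt b) (rcan b x).
Proof.
move: x; apply: typed_ind.
- by rewrite rcan0; exact: typed0.
- by move=> y z hy hz; rewrite rcanD; exact: typedD.
- by move=> c y hy; rewrite rcanZ; exact: typedZ.
move=> p pu pv; rewrite pth_path_of pu.
have hp : is_qpath (u, word p) by case: p pu {pv} => -[w s] /= h <-.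
case/lastP: (word p) hp => [|s c] hp; first by rewrite path_of_nil rcan_idem; exact: typed0.
rewrite rcan_path //; case: eqP => [cb|_]; last exact: typed0.
have := typed_path_of K u s; move: hp; rewrite -cats1 is_qpath_cat => /andP[_].
by rewrite /is_qpath /= andbT cb => /eqP <-.
Qed.

Lemma lcan_rad a N x : in_rad N.+1 x -> in_rad N (lcan a x).
Proof.
move: x; apply: in_rad_ind.
- by rewrite lcan0; exact: in_rad0.
- by move=> y z hy hz; rewrite lcanD; exact: in_radD.
- by move=> c y hy; rewrite lcanZ; exact: in_radZ.
move=> p; rewrite pth_path_of.
have hp : is_qpath (ptgt p, word p) by case: p => -[].
case: (word p) hp => // c s hp hs; rewrite lcan_path //.
by case: eqP => _; [exact: in_rad_path_of | exact: in_rad0].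
Qed.

Lemma rcan_rad b N x : in_rad N.+1 x -> in_rad N (rcan b x).
Proof.
move: x; apply: in_rad_ind.
- by rewrite rcan0; exact: in_rad0.
- by move=> y z hy hz; rewrite rcanD; exact: in_radD.
- by move=> c y hy; rewrite rcanZ; exact: in_radZ.
move=> p; rewrite pth_path_of.
have hp : is_qpath (ptgt p, word p) by case: p => -[].
case/lastP: (word p) hp => // s c hp; rewrite size_rcons => hs; rewrite rcan_path //.
by case: eqP => _; [exact: in_rad_path_of | exact: in_rad0].
Qed.

Variable k : V.
Definition in_arrow := {a : arrow P | tgt a == k}.
Definition out_arrow := {b : arrow P | src b == k}.

Lemma in_arrow_sum x : in_rad 1 x ->
  e k * x = \sum_(i : in_arrow) ar (val i) * lcan (val i) x.
Proof.
have E := @idemE K V P.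
move: x; apply: in_rad_ind.
- by rewrite mulr0 big1 // => i _; rewrite lcan0 mulr0.
- move=> x y hx hy; rewrite mulrDr hx hy -big_split; apply: eq_bigr => i _.
  by rewrite lcanD mulrDr.
- move=> c x hx; rewrite -pscalerAr hx scaler_sumr; apply: eq_bigr => i _.
  by rewrite lcanZ pscalerAr.
move=> p; rewrite pth_path_of; case: (word p) => // c s _.
rewrite path_of_cons; case: eqP => [pc|_]; last first.
  by rewrite mulr0 big1 // => i _; rewrite lcan0 mulr0.
have [tc|tc] := eqVneq (tgt c) k; last first.
  rewrite mulrA (_ : e k * ar c = 0) ?mul0r; last first.
    by rewrite -(typedl E (typed_arr K c)) mulrA E eq_sym (negbTE tc) mul0r.
  rewrite big1 // => i _; rewrite lcan_arr.
  case: eqP => [ci|_]; last by rewrite mulr0.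
  by move: tc; rewrite ci (eqP (valP i)) eqxx.
rewrite mulrA -{1}tc (typedl E (typed_arr K c)).
have ck : tgt c == k by rewrite tc.
rewrite (bigD1 (Sub c ck : in_arrow)) //= lcan_arr eqxx mulrA.
rewrite (typedr E (typed_arr K c)) big1 ?addr0 // => i ne.
rewrite lcan_arr; case: eqP => [ci|_]; last by rewrite mulr0.
by case/eqP: ne; apply: val_inj; rewrite /= ci.
Qed.

Lemma in_arrow_split v x : ty k v x -> in_rad 1 x ->
  x = \sum_(i : in_arrow) ar (val i) * lcan (val i) x.
Proof. by move=> xt /in_arrow_sum <-; rewrite (typedl (@idemE K V P) xt). Qed.

Lemma out_arrow_sum x : in_rad 1 x ->
  x * e k = \sum_(j : out_arrow) rcan (val j) x * ar (val j).
Proof.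
have E := @idemE K V P.
move: x; apply: in_rad_ind.
- by rewrite mul0r big1 // => i _; rewrite rcan0 mul0r.
- move=> x y hx hy; rewrite mulrDl hx hy -big_split; apply: eq_bigr => i _.
  by rewrite rcanD mulrDl.
- move=> c x hx; rewrite -pscalerAl hx scaler_sumr; apply: eq_bigr => i _.
  by rewrite rcanZ pscalerAl.
move=> p; rewrite pth_path_of; case/lastP: (word p) => // s c _.
rewrite path_of_rcons; case: eqP => [pc|_]; last first.
  by rewrite mulr0 mul0r big1 // => i _; rewrite rcan0 mul0r.
have [tc|tc] := eqVneq (src c) k; last first.
  rewrite -mulrA (_ : ar c * e k = 0) ?mulr0; last first.
    by rewrite -(typedr E (typed_arr K c)) -mulrA E (negbTE tc) mulr0.
  rewrite big1 // => i _; rewrite rcan_arr.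
  case: eqP => [ci|_]; last by rewrite mul0r.
  by move: tc; rewrite ci (eqP (valP i)) eqxx.
rewrite -mulrA -{1}tc (typedr E (typed_arr K c)).
have ck : src c == k by rewrite tc.
rewrite (bigD1 (Sub c ck : out_arrow)) //= rcan_arr eqxx -mulrA.
rewrite (typedl E (typed_arr K c)) big1 ?addr0 // => i ne.
rewrite rcan_arr; case: eqP => [ci|_]; last by rewrite mul0r.
by case/eqP: ne; apply: val_inj; rewrite /= ci.
Qed.

Lemma out_arrow_split u x : ty u k x -> in_rad 1 x ->
  x = \sum_(j : out_arrow) rcan (val j) x * ar (val j).
Proof. by move=> xt /out_arrow_sum <-; rewrite (typedr (@idemE K V P) xt). Qed.

Lemma typed_rad1 u v x : u != v -> ty u v x -> in_rad 1 x.
Proof.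
move=> uv; move: x; apply: typed_ind.
- exact: in_rad0.
- exact: in_radD.
- exact: in_radZ.
move=> p pu pv; apply: in_rad_pth; case E: (word p) => //.
by move: uv; rewrite -pu -pv psrc_path E eqxx.
Qed.

End Cancel.

(** * Ideals generated by relations *)

Section Relations.
Context (K : fieldType) {V : finType} (P : quiver V).
Local Notation A := (path_algebra K P).
Local Notation e := (idem K P).
Local Notation ty := (typed e).
Variable r : arrow P -> A.

Definition idl (x : A) : Prop := exists s : seq (A * arrow P * A),
  x = \sum_(t <- s) t.1.1 * r t.1.2 * t.2.

Lemma idl0 : idl 0. Proof. by exists [::]; rewrite big_nil. Qed.

Lemma idlD x y : idl x -> idl y -> idl (x + y).
Proof. by move=> [s ->] [t ->]; exists (s ++ t); rewrite big_cat. Qed.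

Lemma idlMl x y : idl x -> idl (y * x).
Proof.
move=> [s ->]; exists [seq (y * t.1.1, t.1.2, t.2) | t <- s].
by rewrite big_map mulr_sumr; apply: eq_bigr => t _; rewrite /= !mulrA.
Qed.

Lemma idlMr x y : idl x -> idl (x * y).
Proof.
move=> [s ->]; exists [seq (t.1.1, t.1.2, t.2 * y) | t <- s].
by rewrite big_map mulr_suml; apply: eq_bigr => t _; rewrite /= !mulrA.
Qed.

Definition idl_ideal := TSIdeal idl0 idlD idlMl idlMr.

Lemma idl_gen a : idl (r a).
Proof. by exists [:: (1, a, 1)]; rewrite big_seq1 mul1r mulr1. Qed.

Lemma idlN x : idl x -> idl (- x). Proof. exact: (@idN _ idl_ideal). Qed.

Lemma idlB x y : idl x -> idl y -> idl (x - y).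
Proof. exact: (@idB _ idl_ideal). Qed.

Lemma idl_sum (T : Type) (s : seq T) (D : pred T) F :
  (forall i, D i -> idl (F i)) -> idl (\sum_(i <- s | D i) F i).
Proof. exact: (@id_sum _ idl_ideal). Qed.

Lemma idlZ c x : idl x -> idl (c *: x).
Proof. by move=> hx; rewrite -[x]mul1r pscalerAl; exact: idlMl. Qed.

(** The relations together with the N-th power of the arrow ideal: modulo this ideal, an element of
    a corner with nonzero scalar part is invertible. *)
Definition jid_pred (N : nat) (x : A) := exists i m, [/\ idl i, in_rad N m & x = i + m].

Lemma jid0 N : jid_pred N 0.
Proof. by exists 0, 0; split; [exact: idl0 | exact: in_rad0 | rewrite addr0]. Qed.

Lemma jidD N x y : jid_pred N x -> jid_pred N y -> jid_pred N (x + y).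
Proof.
move=> [i [m [hi hm ->]]] [i' [m' [hi' hm' ->]]]; exists (i + i'), (m + m').
by split; [exact: idlD | exact: in_radD | rewrite addrACA].
Qed.

Lemma jidMl N x y : jid_pred N x -> jid_pred N (y * x).
Proof.
move=> [i [m [hi hm ->]]]; exists (y * i), (y * m).
by split; [exact: idlMl | exact: in_radMl | rewrite mulrDr].
Qed.

Lemma jidMr N x y : jid_pred N x -> jid_pred N (x * y).
Proof.
move=> [i [m [hi hm ->]]]; exists (i * y), (m * y).
by split; [exact: idlMr | exact: in_radMr | rewrite mulrDl].
Qed.

Definition jid N := TSIdeal (jid0 N) (@jidD N) (@jidMl N) (@jidMr N).

Lemma idl_jid N x : idl x -> jid N x.
Proof. by move=> hx; exists x, 0; split=> //; [exact: in_rad0 | rewrite addr0]. Qed.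

Lemma rad_jid N x : in_rad N x -> jid N x.
Proof. by move=> hx; exists 0, x; split=> //; [exact: idl0 | rewrite add0r]. Qed.

Hypothesis rt : forall a, ty (src a) (tgt a) (r a).

(** The typing of [r a] inserts idempotents on both sides of it, so both cofactors can be taken to
    be paths with matching ends. *)
Lemma idl_typed_ind u v (S : A -> Prop) :
  S 0 -> (forall x y, S x -> S y -> S (x + y)) ->
  (forall c x, S x -> S (c *: x)) ->
  (forall p a q, ptgt p = u -> psrc p = src a -> ptgt q = tgt a -> psrc q = v ->
     S (pth K p * r a * pth K q)) ->
  forall x, ty u v x -> idl x -> S x.
Proof.
have E := @idemE K V P.
move=> S0 SD SZ Sp x xt [s xE]; rewrite -xt xE mulr_sumr mulr_suml.
apply: big_ind => // -[[y a] z] _ /=.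
have -> : e u * (y * r a * z) * e v =
    (e u * y * e (src a)) * r a * (e (tgt a) * z * e v).
  by rewrite -{1}(rt a) !mulrA.
have := typed_proj E u (src a) y; have := typed_proj E (tgt a) v z.
move: (e u * y * _) (_ * z * _) => {}y {}z zt; move: y; apply: typed_ind.
- by rewrite !mul0r.
- by move=> y1 y2 h1 h2; rewrite !mulrDl; exact: SD.
- by move=> c y1 h1; rewrite -!pscalerAl; exact: SZ.
move=> p pu pv; move: z zt; apply: typed_ind.
- by rewrite !mulr0.
- by move=> y1 y2 h1 h2; rewrite !mulrDr; exact: SD.
- by move=> c y1 h1; rewrite -!pscalerAr; exact: SZ.
by move=> q qu qv; exact: Sp.
Qed.

Hypothesis rr : forall a, in_rad 1 (r a).

Lemma scal_jid v N x : (0 < N)%N -> jid N x -> scal v x = 0.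
Proof.
move=> N0 [i [m [[s ->] hm ->]]].
rewrite scalD (scal_rad v (in_radW N0 hm)) addr0 (big_morph _ (scalD v) (scal0 K P v)).
by apply: big1 => t _; rewrite !scalM (scal_rad v (@rr _)) mulr0 mul0r.
Qed.

Section ScalarPart.
Variables (N : nat) (k : V).
Local Notation D := (jid N.+1).

(** The precision is a successor, so that the ideal has no scalar part and the choice of the
    representative does not matter. *)
Definition qscal (x : qring D) : K := scal k (repr x).

Lemma qscalE x : qscal (qpi D x) = scal k x.
Proof.
apply/eqP; rewrite -subr_eq0 -[- scal k x]mulN1r -scalZ -scalD scaleN1r.
by apply/eqP; apply: (@scal_jid k N.+1) => //; exact: (qrepr D x).
Qed.

Lemma qscalD : {morph qscal : x y / x + y}.
Proof.
move=> x y; have [x1 ->] := qpi_surj x; have [y1 ->] := qpi_surj y.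
by rewrite -raddfD !qscalE scalD.
Qed.

Lemma qscalM : {morph qscal : x y / x * y}.
Proof.
move=> x y; have [x1 ->] := qpi_surj x; have [y1 ->] := qpi_surj y.
by rewrite -qpiM !qscalE scalM.
Qed.

Lemma qscal_idem : qscal (qe e D k) = 1.
Proof. by rewrite qscalE scal_idem eqxx. Qed.

Lemma qscal_idem0 v : v != k -> qscal (qe e D v) = 0.
Proof. by move=> vk; rewrite qscalE scal_idem eq_sym (negbTE vk). Qed.

Lemma qscal_inv x : typed (qe e D) k k x -> qscal x != 0 ->
  exists w, [/\ typed (qe e D) k k w, x * w = qe e D k & w * x = qe e D k].
Proof.
move=> /(qpi_typed (@idemE K V P))[y yt ->].
rewrite qscalE => /(local_inv N.+1 yt)[w [wt w1 w2]].
exists (qpi D w); split; first exact: typed_qpi.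
  by rewrite -qpiM; apply/qpiP/rad_jid.
by rewrite -qpiM; apply/qpiP/rad_jid.
Qed.

End ScalarPart.

Lemma coh_coherent (X : Type) (G : X -> V -> int) : coh e jid G ->
  forall k, (forall a, 0 <= G a k) \/ (forall a, G a k <= 0).
Proof.
(* The weights are the same at all precisions, and precision 1 already detects scalar parts. *)
move=> cG k; have [F [Ft Fc Fn]] := cG 1%N.
have [pos|neg] := net_coherent (qeE (jid 1) (@idemE K V P)) (@qscalD 0 k)
  (@qscalM 0 k) (qscal_idem 0 k) (@qscal_idem0 0 k) (@qscal_inv 0 k) Ft Fc.
- by left=> a; rewrite -Fn.
- by right=> a; rewrite -Fn.
Qed.

(** With [eps] false the members are projectives, with [eps] true shifted projectives. Either way no
    member has a relation or no member has a generator, so compatibility has no position to test. *)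
Lemma coh_init (X : Type) (vx : X -> V) (eps : bool) :
  coh e jid (fun a v => (-1) ^+ eps * (v == vx a)%:R).
Proof.
move=> N; pose F a : pres V (qring (jid N)) := @Pres V _ unit unit
  (fun=> vx a) (fun=> vx a) (if eps then setT else set0) (if eps then set0 else setT)
  (fun _ _ => 0).
exists F; split.
- by move=> a p q; exact: typed0.
- move=> a b h ht; exists (fun _ _ => 0), (fun _ _ => 0); split.
  + by move=> *; exact: typed0.
  + by move=> *; exact: typed0.
  + by rewrite /F; case: (eps) => p q /=; rewrite !inE.
- move=> a v; rewrite /net /F /=.
  have c0 (D : pred unit) : #|[set p in (set0 : {set unit}) | D p]| = 0%N.
    by apply/eqP; rewrite cards_eq0; apply/eqP/setP => p; rewrite !inE.
  have c1 (c : bool) : #|[set p in (setT : {set unit}) | c]| = c.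
    case: c; last by apply/eqP; rewrite cards_eq0; apply/eqP/setP => p; rewrite !inE.
    by rewrite (_ : [set p in _ | _] = setT) ?cardsT ?card_unit //; apply/setP => p; rewrite !inE.
  by case: (eps); rewrite c0 c1 ?subr0 ?sub0r natz eq_sym ?expr1 ?mulN1r ?expr0 ?mul1r.
Qed.

End Relations.

(** * Half of a quiver mutation *)

Section HalfMutation.
Context (K : fieldType) {V : finType} (P P' : quiver V) (k : V).
Local Notation A := (path_algebra K P).
Local Notation A' := (path_algebra K P').
Local Notation e := (idem K P).
Local Notation e' := (idem K P').
Local Notation ty := (typed e).
Local Notation ty' := (typed e').
Local Notation bad := (pred1 k).
Local Notation I := (in_arrow P k).
Local Notation J := (out_arrow P k).
Local Notation ar := (arr K).
Hypothesis noloop : forall a : arrow P, src a == k -> tgt a != k.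
Variables (r : arrow P -> A) (r' : arrow P' -> A').
Hypothesis rt : forall a, ty (src a) (tgt a) (r a).
Hypothesis rr : forall a, in_rad 1 (r a).
Hypothesis mixed : forall (i : I) (j : J),
  rcan (val j) (r (val i)) = lcan (val i) (r (val j)).
Variables (F1 : arrow P -> A') (F2 : arrow P -> arrow P -> A').
Hypothesis F1t : forall b, tgt b != k -> src b != k -> ty' (tgt b) (src b) (F1 b).
Hypothesis F2t : forall b a, src b = tgt a -> src b == k ->
  ty' (tgt b) (src a) (F2 b a).
Hypothesis F1r : forall b, in_rad 1 (F1 b).
Hypothesis F2r : forall b a, in_rad 1 (F2 b a).
Local Notation th := (ceval bad F1 F2).
Variables (als : I -> A') (bes : J -> A').
Hypothesis alst : forall i, ty' (src (val i)) k (als i).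
Hypothesis best : forall j, ty' k (tgt (val j)) (bes j).
(** When r is given by the cyclic derivatives, this is the second derivative of the potential along
    the passage through k formed by i and then j; [mixed] expresses that it can be computed in
    either order. *)
Definition gam (i : I) (j : J) : A := rcan (val j) (r (val i)).
Hypothesis relP : forall i j, idl r' (als i * bes j + th (gam i j)).
Hypothesis rel_in : forall i : I,
  idl r' (\sum_j bes j * th (ar (val j) * ar (val i))).
Hypothesis rel_out : forall j : J,
  idl r' (\sum_i th (ar (val j) * ar (val i)) * als i).
Hypothesis rel_good : forall a, src a != k -> tgt a != k -> idl r' (th (r a)).
Hypothesis th_surj : forall u v x', u != k -> v != k -> ty' u v x' ->
  exists2 x, ty u v x & idl r' (x' - th x).
Hypothesis inP' : forall v y, v != k -> ty' k v y ->
  exists2 z : J -> A', forall j, ty' (tgt (val j)) v (z j) &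
    y = \sum_j bes j * z j.
Hypothesis outP' : forall u y, u != k -> ty' u k y ->
  exists2 l : I -> A', forall i, ty' u (src (val i)) (l i) &
    y = \sum_i l i * als i.

Let E := @idemE K V P.
Let E' := @idemE K V P'.

Lemma in_src (i : I) : src (val i) != k.
Proof. by apply: contraL (valP i) => /noloop. Qed.

Lemma out_tgt (j : J) : tgt (val j) != k.
Proof. exact: noloop (valP j). Qed.

Lemma arr_in (i : I) : ty k (src (val i)) (ar (val i)).
Proof. by have := typed_arr K (val i); rewrite (eqP (valP i)). Qed.

Lemma arr_out (j : J) : ty (tgt (val j)) k (ar (val j)).
Proof. by have := typed_arr K (val j); rewrite (eqP (valP j)). Qed.

Lemma r_in (i : I) : ty (src (val i)) k (r (val i)).
Proof. by have := rt (val i); rewrite (eqP (valP i)). Qed.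

Lemma r_out (j : J) : ty k (tgt (val j)) (r (val j)).
Proof. by have := rt (val j); rewrite (eqP (valP j)). Qed.

Lemma gam_typed i j : ty (src (val i)) (tgt (val j)) (gam i j).
Proof. by apply: rcan_typed; rewrite (eqP (valP j)); exact: r_in. Qed.

Lemma r_inE (i : I) : r (val i) = \sum_j gam i j * ar (val j).
Proof. exact: (out_arrow_split (r_in i) (@rr _)). Qed.

Lemma r_outE (j : J) : r (val j) = \sum_i ar (val i) * gam i j.
Proof.
rewrite [LHS](in_arrow_split (r_out j) (@rr _)).
by apply: eq_bigr => i _; rewrite /gam mixed.
Qed.

Lemma thM u v w x y : u != k -> v != k -> w != k -> ty u v x -> ty v w y ->
  th (x * y) = th x * th y.
Proof. exact: (cevalM noloop F1t F2t). Qed.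

Lemma th_typed u v x : u != k -> v != k -> ty u v x -> ty' u v (th x).
Proof. exact: (ceval_typed noloop F1t F2t). Qed.

(** A relation with an end at k is outside the range of [th], but the neighbouring path supplies an
    arrow at k. Expanding the relation by [r_outE] or [r_inE] gives a sum containing the [gam i j];
    modulo r' each of them is minus [als i * bes j], and the sum becomes a multiple of [rel_out] or
    [rel_in]. *)
Lemma th_idl_typed u v x : u != k -> v != k -> ty u v x -> idl r x -> idl r' (th x).
Proof.
move=> uk vk; move: x; apply: (idl_typed_ind rt).
- by rewrite ceval0; exact: idl0.
- by move=> x y hx hy; rewrite cevalD; exact: idlD.
- by move=> c x hx; rewrite cevalZ; exact: idlZ.
move=> p a q pu pv qu qv.
have pt : ty u (src a) (pth K p) by rewrite -pu -pv; exact: typed_pth.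
have qt : ty (tgt a) v (pth K q) by rewrite -qu -qv; exact: typed_pth.
have [sa|sa] := boolP (src a == k).
  pose j0 : J := Sub a sa; have ta := noloop sa.
  rewrite (eqP sa) in pt.
  rewrite (out_arrow_split pt (typed_rad1 uk pt)) !mulr_suml ceval_sum.
  apply: idl_sum => j _; have zt : ty u (tgt (val j)) (rcan (val j) (pth K p)).
    by apply: rcan_typed; rewrite (eqP (valP j)).
  have rat : ty k (tgt a) (r a) by have := rt a; rewrite (eqP sa).
  rewrite (_ : _ * _ * r a * _ = rcan (val j) (pth K p) * (ar (val j) * r a) * pth K q);
    last by rewrite !mulrA.
  have mt := typedM E (arr_out j) rat.
  rewrite (thM uk ta vk (typedM E zt mt) qt) (thM uk (out_tgt j) ta zt mt).
  apply/idlMr/idlMl; rewrite (r_outE j0) mulr_sumr ceval_sum /=.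
  have -> : \sum_i th (ar (val j) * (ar (val i) * gam i j0)) =
      \sum_i th (ar (val j) * ar (val i)) * (als i * bes j0 + th (gam i j0)) -
      (\sum_i th (ar (val j) * ar (val i)) * als i) * bes j0.
    rewrite mulr_suml -sumrB; apply: eq_bigr => i _.
    rewrite mulrDr [_ * (als i * _)]mulrA addrAC subrr add0r mulrA.
    exact: (thM (out_tgt j) (in_src i) (out_tgt j0)
      (typedM E (arr_out j) (arr_in i)) (gam_typed i j0)).
  apply: idlB; last exact/idlMr/rel_out.
  by apply: idl_sum => i _; apply/idlMl/relP.
have [ta|ta] := boolP (tgt a == k); last first.
  rewrite (thM uk ta vk (typedM E pt (rt a)) qt) (thM uk sa ta pt (rt a)).
  exact/idlMr/idlMl/rel_good.
pose i0 : I := Sub a ta.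
rewrite (eqP ta) in qt.
have q1 : in_rad 1 (pth K q) by apply: typed_rad1 qt; rewrite eq_sym.
rewrite (in_arrow_split qt q1) mulr_sumr ceval_sum.
apply: idl_sum => i _; have zt : ty (src (val i)) v (lcan (val i) (pth K q)).
  by apply: lcan_typed; rewrite (eqP (valP i)).
have rat : ty (src a) k (r a) by have := rt a; rewrite (eqP ta).
rewrite (_ : pth K p * r a * _ = pth K p * (r a * ar (val i)) * lcan (val i) (pth K q));
  last by rewrite !mulrA.
have mt := typedM E rat (arr_in i).
rewrite (thM uk (in_src i) vk (typedM E pt mt) zt) (thM uk sa (in_src i) pt mt).
apply/idlMr/idlMl; rewrite (r_inE i0) mulr_suml ceval_sum /=.
have -> : \sum_j th (gam i0 j * ar (val j) * ar (val i)) =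
    \sum_j (als i0 * bes j + th (gam i0 j)) * th (ar (val j) * ar (val i)) -
    als i0 * (\sum_j bes j * th (ar (val j) * ar (val i))).
  rewrite mulr_sumr -sumrB; apply: eq_bigr => j _.
  rewrite mulrDl -[als i0 * _ * _]mulrA addrAC subrr add0r -[in LHS]mulrA.
  exact: (thM (in_src i0) (out_tgt j) (in_src i) (gam_typed i0 j)
      (typedM E (arr_out j) (arr_in i))).
apply: idlB; last exact/idlMl/rel_in.
by apply: idl_sum => j _; apply/idlMr/relP.
Qed.

(* Restriction to the good vertices makes [th] compatible with the ideals. *)
Definition good1 : A := \sum_(v | v != k) e v.
Definition thg (x : A) : A' := th (good1 * x * good1).

Lemma thg_is_zmod : zmod_morphism thg.
Proof. by move=> x y; rewrite /thg mulrBr mulrBl raddfB. Qed.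

HB.instance Definition _ := GRing.isZmodMorphism.Build A A' thg thg_is_zmod.

Lemma thg_sum x : thg x = \sum_(u | u != k) \sum_(v | v != k) th (e u * x * e v).
Proof.
rewrite /thg /good1 mulr_suml mulr_suml ceval_sum; apply: eq_bigr => u _.
by rewrite mulr_sumr ceval_sum.
Qed.

Lemma thg_typed u v x : u != k -> v != k -> ty u v x -> thg x = th x.
Proof.
move=> uk vk xt; rewrite thg_sum (bigD1 u) //= (bigD1 v) //= xt.
rewrite big1 => [|w /andP[_ wv]].
  rewrite addr0 big1 ?addr0 // => w /andP[_ wu]; apply: big1 => z _.
  by rewrite -(typedl E xt) mulrA E (negbTE wu) !mul0r ceval0.
by rewrite -mulrA -(typedr E xt) -mulrA E eq_sym (negbTE wv) !mulr0 ceval0.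
Qed.

Lemma thg_jid N x : jid r N.*2 x -> jid r' N (thg x).
Proof.
move=> [i [m [hi hm ->]]]; rewrite thg_sum; apply: (@id_sum _ (jid r' N)) => u uk.
apply: id_sum => v vk; rewrite mulrDr mulrDl cevalD; apply: jidD.
  apply/idl_jid/(th_idl_typed uk vk); first exact: (typed_proj E).
  exact/idlMr/idlMl.
apply: rad_jid; apply: (ceval_rad F1r F2r).
by apply: in_radMr; apply: in_radMl.
Qed.

(** It suffices to treat p (r a) q with paths p and q. If q is not trivial, the last arrow is
    cancelled in q and the result stays in the ideal. If q is trivial, a ends at k, and cancelling
    the arrow j leaves p times [gam a j]. This is the exactness that controls the kernel of
    multiplication by the arrows leaving k. *)
Lemma ker_out_idl u x : u != k -> ty u k x -> idl r x ->
  exists2 m : I -> A, forall i, ty u (src (val i)) (m i) &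
    forall j : J, idl r (rcan (val j) x - \sum_i m i * gam i j).
Proof.
move=> uk; move: x; apply: (idl_typed_ind rt).
- exists (fun=> 0) => [i|j]; first exact: typed0.
  by rewrite rcan0 big1 ?subr0 => [|i _]; [exact: idl0 | rewrite mul0r].
- move=> x y [m mt mE] [n nt nE]; exists (fun i => m i + n i) => [i|j].
    exact: typedD.
  rewrite rcanD (eq_bigr _ (fun i _ => mulrDl _ _ _)) big_split opprD addrACA.
  exact: idlD.
- move=> c x [m mt mE]; exists (fun i => c *: m i) => [i|j]; first exact: typedZ.
  rewrite rcanZ (eq_bigr (fun i => c *: (m i * gam i j))) => [|i _].
    by rewrite -scaler_sumr -scalerBr; exact: idlZ.
  by rewrite pscalerAl.
move=> p a q pu pv qu qv.
have pt : ty u (src a) (pth K p) by rewrite -pu -pv; exact: typed_pth.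
case wq: (word q) => [|c s].
  have qE : pth K q = e (tgt a) by rewrite pth_path_of wq path_of_nil qu.
  have ta : tgt a == k by rewrite -qu -qv psrc_path wq.
  rewrite qE -mulrA (typedr E (rt a)).
  exists (fun i => if val i == a then pth K p else 0) => [i|j].
    by case: eqP => [->|_] //; exact: typed0.
  rewrite rcanM // (bigD1 (Sub a ta : I)) //= eqxx big1 ?addr0 => [|i ne].
    by rewrite subrr; exact: idl0.
  by case: eqP => [ia|_]; rewrite ?mul0r //; case/eqP: ne; apply: val_inj.
exists (fun=> 0) => [i|j]; first exact: typed0.
rewrite big1 ?subr0 => [|i _]; last by rewrite mul0r.
rewrite rcanM; last by apply: in_rad_pth; rewrite wq.
exact/idlMr/idlMl/idl_gen.
Qed.

Lemma ker_in_idl v x : v != k -> ty k v x -> idl r x ->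
  exists2 m : J -> A, forall j, ty (tgt (val j)) v (m j) &
    forall i : I, idl r (lcan (val i) x - \sum_j gam i j * m j).
Proof.
move=> vk; move: x; apply: (idl_typed_ind rt).
- exists (fun=> 0) => [i|j]; first exact: typed0.
  by rewrite lcan0 big1 ?subr0 => [|i _]; [exact: idl0 | rewrite mulr0].
- move=> x y [m mt mE] [n nt nE]; exists (fun i => m i + n i) => [i|j].
    exact: typedD.
  rewrite lcanD (eq_bigr _ (fun i _ => mulrDr _ _ _)) big_split opprD addrACA.
  exact: idlD.
- move=> c x [m mt mE]; exists (fun i => c *: m i) => [i|j]; first exact: typedZ.
  rewrite lcanZ (eq_bigr (fun i => c *: (gam j i * m i))) => [|i _].
    by rewrite -scaler_sumr -scalerBr; exact: idlZ.
  by rewrite pscalerAr.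
move=> p a q pu pv qu qv.
have qt : ty (tgt a) v (pth K q) by rewrite -qu -qv; exact: typed_pth.
case wp: (word p) => [|c s].
  have pE : pth K p = e (src a) by rewrite -pv pth_path_of psrc_path wp path_of_nil.
  have ta : src a == k by rewrite -pu -pv psrc_path wp.
  rewrite pE (typedl E (rt a)).
  exists (fun j => if val j == a then pth K q else 0) => [j|i].
    by case: eqP => [->|_] //; exact: typed0.
  rewrite lcanM // (bigD1 (Sub a ta : J)) //= eqxx big1 ?addr0 => [|j ne].
    by rewrite /gam mixed subrr; exact: idl0.
  by case: eqP => [ja|_]; rewrite ?mulr0 //; case/eqP: ne; apply: val_inj.
exists (fun=> 0) => [i|j]; first exact: typed0.
rewrite big1 ?subr0 => [|i _]; last by rewrite mulr0.
rewrite -mulrA lcanM; last by apply: in_rad_pth; rewrite wp.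
exact/idlMl/idlMr/idl_gen.
Qed.

(** Cancelling an arrow costs one unit of length and evaluation halves the rest, hence the precision
    2N + 1. *)
Lemma ker_out_jid N u (l : J -> A) : u != k ->
  (forall j, ty u (tgt (val j)) (l j)) -> jid r N.*2.+1 (\sum_j l j * ar (val j)) ->
  exists2 m : I -> A, forall i, ty u (src (val i)) (m i) &
    forall j, jid r' N (th (l j) - \sum_i th (m i) * th (gam i j)).
Proof.
move=> uk lt [i0 [m0 [hi hm sE]]].
have st : ty u k (\sum_j l j * ar (val j)).
  by apply: typed_sum => j _; exact: (typedM E (lt j) (arr_out j)).
pose i1 := e u * i0 * e k; pose m1 := e u * m0 * e k.
have sE1 : \sum_j l j * ar (val j) = i1 + m1 by rewrite -st sE mulrDr mulrDl.
have hi1 : idl r i1 by exact/idlMr/idlMl.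
have hm1 : in_rad N.*2.+1 m1 by apply: in_radMr; apply: in_radMl.
have [m mt mE] := ker_out_idl uk (typed_proj E u k i0) hi1.
exists m => // j.
have lE : l j = rcan (val j) i1 + rcan (val j) m1.
  rewrite -rcanD -sE1 raddf_sum (bigD1 j) //= rcan_arr eqxx (typedr E (lt j)).
  rewrite big1 ?addr0 // => j' ne; rewrite rcan_arr; case: eqP => // jj.
  by case/eqP: ne; apply: val_inj.
have gt i : ty u (tgt (val j)) (m i * gam i j) by exact: (typedM E (mt i) (gam_typed i j)).
have it : ty u (tgt (val j)) (rcan (val j) i1).
  by apply: rcan_typed; rewrite (eqP (valP j)); exact: typed_proj.
rewrite lE cevalD addrAC; apply: jidD; last first.
  by apply: rad_jid; apply: (ceval_rad F1r F2r); exact: rcan_rad.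
have -> : th (rcan (val j) i1) - \sum_i th (m i) * th (gam i j) =
    th (rcan (val j) i1 - \sum_i m i * gam i j).
  rewrite -scaleN1r cevalD -[- (\sum_i m i * _)]scaleN1r cevalZ; congr (_ + _ *: _).
  rewrite ceval_sum; apply: eq_bigr => i _.
  by rewrite (thM uk (in_src i) (out_tgt j) (mt i) (gam_typed i j)).
apply/idl_jid/(th_idl_typed uk (out_tgt j)); last exact: mE.
by apply: typedB => //; apply: typed_sum => i _; exact: gt.
Qed.

Lemma ker_in_jid N v (l : I -> A) : v != k ->
  (forall i, ty (src (val i)) v (l i)) -> jid r N.*2.+1 (\sum_i ar (val i) * l i) ->
  exists2 m : J -> A, forall j, ty (tgt (val j)) v (m j) &
    forall i, jid r' N (th (l i) - \sum_j th (gam i j) * th (m j)).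
Proof.
move=> vk lt [i0 [m0 [hi hm sE]]].
have st : ty k v (\sum_i ar (val i) * l i).
  by apply: typed_sum => i _; exact: (typedM E (arr_in i) (lt i)).
pose i1 := e k * i0 * e v; pose m1 := e k * m0 * e v.
have sE1 : \sum_i ar (val i) * l i = i1 + m1 by rewrite -st sE mulrDr mulrDl.
have hi1 : idl r i1 by exact/idlMr/idlMl.
have hm1 : in_rad N.*2.+1 m1 by apply: in_radMr; apply: in_radMl.
have [m mt mE] := ker_in_idl vk (typed_proj E k v i0) hi1.
exists m => // i.
have lE : l i = lcan (val i) i1 + lcan (val i) m1.
  rewrite -lcanD -sE1 raddf_sum (bigD1 i) //= lcan_arr eqxx (typedl E (lt i)).
  rewrite big1 ?addr0 // => j' ne; rewrite lcan_arr; case: eqP => // jj.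
  by case/eqP: ne; apply: val_inj.
have gt j : ty (src (val i)) v (gam i j * m j) by exact: (typedM E (gam_typed i j) (mt j)).
have it : ty (src (val i)) v (lcan (val i) i1).
  by apply: lcan_typed; rewrite (eqP (valP i)); exact: typed_proj.
rewrite lE cevalD addrAC; apply: jidD; last first.
  by apply: rad_jid; apply: (ceval_rad F1r F2r); exact: lcan_rad.
have -> : th (lcan (val i) i1) - \sum_j th (gam i j) * th (m j) =
    th (lcan (val i) i1 - \sum_j gam i j * m j).
  rewrite -scaleN1r cevalD -[- (\sum_j _ * m j)]scaleN1r cevalZ; congr (_ + _ *: _).
  rewrite ceval_sum; apply: eq_bigr => j _.
  by rewrite (thM (in_src i) (out_tgt j) vk (gam_typed i j) (mt j)).
apply/idl_jid/(th_idl_typed (in_src i) vk); last exact: mE.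
by apply: typedB => //; apply: typed_sum => j _; exact: gt.
Qed.

Definition out_count (v : V) : int := (#|[set j : J | tgt (val j) == v]|)%:Z.
Definition in_count (v : V) : int := (#|[set i : I | src (val i) == v]|)%:Z.

(** The hypotheses of [mutation_step] are checked between the quotients at precisions 2N + 1 and N:
    typed elements lift to typed elements of the path algebras, where the statements above apply.
    The central elements [io] are the scalar multiples of 1. *)
Lemma coh_half (X : Type) (G : X -> V -> int) : coh e (jid r) G ->
  coh e' (jid r') (fun a v => mut_step out_count in_count k (G a) v).
Proof.
move=> cG N; have [F [Ft Fc Fn]] := cG N.*2.+1.
pose D := jid r N.*2.+1; pose D' := jid r' N.
have phiI x : D x -> D' (thg x).
  move=> [i [m [hi hm ->]]]; apply: thg_jid; exists i, m; split=> //.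
  exact: in_radW hm.
pose thB : {additive qring D -> qring D'} := qmap phiI.
have thBE x : thB (qpi _ x) = qpi _ (thg x) by exact: qmapE.
have thBt u v x : u != k -> v != k -> ty u v x -> thB (qpi _ x) = qpi _ (th x).
  by move=> uk vk xt; rewrite thBE (thg_typed uk vk xt).
have lift u v x : typed (qe e D) u v x -> exists2 y, ty u v y & x = qpi D y.
  exact: (qpi_typed E).
have lift' u v x : typed (qe e' D') u v x -> exists2 y, ty' u v y & x = qpi D' y.
  exact: (qpi_typed E').
have alB (i : I) : typed (qe e D) k (src (val i)) (qpi D (ar (val i))).
  by apply: typed_qpi; exact: arr_in.
have beB (j : J) : typed (qe e D) (tgt (val j)) k (qpi D (ar (val j))).
  by apply: typed_qpi; exact: arr_out.
have alsB (i : I) : typed (qe e' D') (src (val i)) k (qpi D' (als i)).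
  by apply: typed_qpi; exact: alst.
have besB (j : J) : typed (qe e' D') k (tgt (val j)) (qpi D' (bes j)).
  by apply: typed_qpi; exact: best.
have h1 u v x : u != k -> v != k -> typed (qe e D) u v x ->
    typed (qe e' D') u v (thB x).
  move=> uk vk /lift[y yt ->]; rewrite (thBt _ _ _ uk vk yt).
  by apply: typed_qpi; apply: th_typed.
have h2 u v w x y : u != k -> v != k -> w != k -> typed (qe e D) u v x ->
    typed (qe e D) v w y -> thB (x * y) = thB x * thB y.
  move=> uk vk wk /lift[x1 xt ->] /lift[y1 yt ->]; rewrite -qpiM.
  rewrite (thBt _ _ _ uk vk xt) (thBt _ _ _ vk wk yt) -qpiM.
  by rewrite (thBt _ _ _ uk wk (typedM E xt yt)) (thM uk vk wk xt yt).
have h3 u v x' : u != k -> v != k -> typed (qe e' D') u v x' ->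
    exists2 x, typed (qe e D) u v x & x' = thB x.
  move=> uk vk /lift'[y yt ->]; have [x xt xE] := th_surj uk vk yt.
  exists (qpi D x); first exact: typed_qpi.
  by rewrite (thBt _ _ _ uk vk xt); apply/qpiP/idl_jid.
pose io (c : K) : qring D := qpi D (c *: (1 : A)).
pose io' (c : K) : qring D' := qpi D' (c *: (1 : A')).
have h4 (c : K) x : x * io c = io c * x.
  have [y ->] := qpi_surj x.
  by rewrite /io -!qpiM -pscalerAl -pscalerAr mul1r mulr1.
have h5 (c : K) x : x * io' c = io' c * x.
  have [y ->] := qpi_surj x.
  by rewrite /io' -!qpiM -pscalerAl -pscalerAr mul1r mulr1.
have h6 c v : v != k -> thB (io c * qe e D v) = io' c * qe e' D' v.
  move=> vk; rewrite /io /io' /qe -!qpiM -!pscalerAl !mul1r.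
  by rewrite (thBt _ _ _ vk vk (typedZ c (typed_idem E v))) cevalZ ceval_idem.
have h7 v y : v != k -> typed (qe e D) k v y ->
    exists2 z : I -> qring D, forall i, typed (qe e D) (src (val i)) v (z i) &
      y = \sum_i qpi D (ar (val i)) * z i.
  move=> vk /lift[y1 yt ->]; exists (fun i : I => qpi D (lcan (val i) y1)) => [i|].
    by apply: typed_qpi; apply: lcan_typed; rewrite (eqP (valP i)).
  rewrite [in LHS](in_arrow_split yt (typed_rad1 _ yt)) 1?eq_sym // raddf_sum.
  by apply: eq_bigr => i _; rewrite -qpiM.
have h8 u y : u != k -> typed (qe e D) u k y ->
    exists2 l : J -> qring D, forall j, typed (qe e D) u (tgt (val j)) (l j) &
      y = \sum_j l j * qpi D (ar (val j)).
  move=> uk /lift[y1 yt ->]; exists (fun j : J => qpi D (rcan (val j) y1)) => [j|].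
    by apply: typed_qpi; apply: rcan_typed; rewrite (eqP (valP j)).
  rewrite [in LHS](out_arrow_split yt (typed_rad1 uk yt)) raddf_sum.
  by apply: eq_bigr => i _; rewrite -qpiM.
have h9 y : typed (qe e D) k k y -> exists (c : K) (z : I -> J -> qring D),
    (forall i j, typed (qe e D) (src (val i)) (tgt (val j)) (z i j)) /\
    y = io c * qe e D k +
      \sum_i \sum_j qpi D (ar (val i)) * z i j * qpi D (ar (val j)).
  (* Without its scalar part a loop at k lies in the arrow ideal, so an arrow can be cancelled on
     the left; the remainder joins two different vertices, so one can be cancelled on the right as
     well. *)
  move=> /lift[y1 yt ->]; pose y2 := y1 - scal k y1 *: e k.
  have y2t : ty k k y2 by apply: typedB => //; by apply: typedZ; exact: typed_idem.
  have zt (i : I) : ty (src (val i)) k (lcan (val i) y2).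
    by apply: lcan_typed; rewrite (eqP (valP i)).
  exists (scal k y1), (fun i j => qpi D (rcan (val j) (lcan (val i) y2))).
  split=> [i j|]; first by apply: typed_qpi; apply: rcan_typed; rewrite (eqP (valP j)).
  rewrite /io /qe -qpiM -pscalerAl mul1r -[in LHS](subrK (scal k y1 *: e k) y1).
  rewrite raddfD addrC -/y2; congr (_ + _).
  rewrite [in LHS](in_arrow_split y2t (rad1_split yt)) raddf_sum.
  apply: eq_bigr => i _.
  rewrite [in LHS](out_arrow_split (zt i) (typed_rad1 (in_src i) (zt i))).
  rewrite mulr_sumr raddf_sum; apply: eq_bigr => j _.
  by rewrite -!qpiM mulrA.
have h10 u (l : J -> qring D) : u != k ->
    (forall j, typed (qe e D) u (tgt (val j)) (l j)) ->
    \sum_j l j * qpi D (ar (val j)) = 0 ->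
    exists2 m : I -> qring D, forall i, typed (qe e D) u (src (val i)) (m i) &
      forall j, thB (l j) = \sum_i thB (m i) * thB (qpi D (gam i j)).
  move=> uk lt l0.
  have /choice[l1 l1P] : forall j, exists y, ty u (tgt (val j)) y /\ l j = qpi D y.
    by move=> j; have [y yt yE] := lift _ _ _ (lt j); exists y.
  have l1t j : ty u (tgt (val j)) (l1 j) by have [] := l1P j.
  have l1E j : l j = qpi D (l1 j) by have [] := l1P j.
  have l10 : D (\sum_j l1 j * ar (val j)).
    apply/qpi0P; rewrite raddf_sum -[RHS]l0; apply: eq_bigr => j _.
    by rewrite l1E -qpiM.
  have [m mt mE] := ker_out_jid uk l1t l10.
  exists (fun i => qpi D (m i)) => [i|j]; first exact: typed_qpi.
  rewrite l1E (thBt _ _ _ uk (out_tgt j) (l1t j)).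
  have /qpiP -> := mE j; rewrite raddf_sum; apply: eq_bigr => i _.
  rewrite (thBt _ _ _ uk (in_src i) (mt i)).
  rewrite (thBt _ _ _ (in_src i) (out_tgt j) (gam_typed i j)).
  exact: qpiM.
have h11 v (l : I -> qring D) : v != k ->
    (forall i, typed (qe e D) (src (val i)) v (l i)) ->
    \sum_i qpi D (ar (val i)) * l i = 0 ->
    exists2 m : J -> qring D, forall j, typed (qe e D) (tgt (val j)) v (m j) &
      forall i, thB (l i) = \sum_j thB (qpi D (gam i j)) * thB (m j).
  move=> vk lt l0.
  have /choice[l1 l1P] : forall i, exists y, ty (src (val i)) v y /\ l i = qpi D y.
    by move=> j; have [y yt yE] := lift _ _ _ (lt j); exists y.
  have l1t j : ty (src (val j)) v (l1 j) by have [] := l1P j.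
  have l1E j : l j = qpi D (l1 j) by have [] := l1P j.
  have l10 : D (\sum_i ar (val i) * l1 i).
    apply/qpi0P; rewrite raddf_sum -[RHS]l0; apply: eq_bigr => j _.
    by rewrite l1E -qpiM.
  have [m mt mE] := ker_in_jid vk l1t l10.
  exists (fun j => qpi D (m j)) => [j|i]; first exact: typed_qpi.
  rewrite l1E (thBt _ _ _ (in_src i) vk (l1t i)).
  have /qpiP -> := mE i; rewrite raddf_sum; apply: eq_bigr => j _.
  rewrite (thBt _ _ _ (out_tgt j) vk (mt j)).
  rewrite (thBt _ _ _ (in_src i) (out_tgt j) (gam_typed i j)).
  exact: qpiM.
have h12 v y : v != k -> typed (qe e' D') k v y ->
    exists2 z : J -> qring D', forall j, typed (qe e' D') (tgt (val j)) v (z j) &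
      y = \sum_j qpi D' (bes j) * z j.
  move=> vk /lift'[y1 yt ->]; have [z zt ->] := inP' vk yt.
  exists (fun j => qpi D' (z j)) => [j|]; first exact: typed_qpi.
  by rewrite raddf_sum; apply: eq_bigr => j _; exact: qpiM.
have h13 u y : u != k -> typed (qe e' D') u k y ->
    exists2 l : I -> qring D', forall i, typed (qe e' D') u (src (val i)) (l i) &
      y = \sum_i l i * qpi D' (als i).
  move=> uk /lift'[y1 yt ->]; have [z zt ->] := outP' uk yt.
  exists (fun j => qpi D' (z j)) => [j|]; first exact: typed_qpi.
  by rewrite raddf_sum; apply: eq_bigr => j _; exact: qpiM.
have h14 (i : I) (j : J) : qpi D' (als i) * qpi D' (bes j) = - thB (qpi D (gam i j)).
  rewrite (thBt _ _ _ (in_src i) (out_tgt j) (gam_typed i j)) -qpiM.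
  apply/eqP; rewrite -subr_eq0 opprK -raddfD; apply/eqP/qpi0P/idl_jid; exact: relP.
have thB2 (i : I) (j : J) : thB (qpi D (ar (val j)) * qpi D (ar (val i))) =
    qpi D' (th (ar (val j) * ar (val i))).
  by rewrite -qpiM (thBt _ _ _ (out_tgt j) (in_src i) (typedM E (arr_out j) (arr_in i))).
have h15 (i : I) : \sum_(j : J) qpi D' (bes j) *
    thB (qpi D (ar (val j)) * qpi D (ar (val i))) = 0.
  under eq_bigr => j _ do rewrite thB2 -qpiM.
  by rewrite -raddf_sum; apply/qpi0P/idl_jid; exact: rel_in.
have h16 (j : J) : \sum_(i : I) thB (qpi D (ar (val j)) * qpi D (ar (val i))) *
    qpi D' (als i) = 0.
  under eq_bigr => i _ do rewrite thB2 -qpiM.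
  by rewrite -raddf_sum; apply/qpi0P/idl_jid; exact: rel_out.
have [F' [Ft' Fc' Fn']] := mutation_step (qeE D E) (qeE D' E') in_src out_tgt beB alB
  alsB besB h1 h2 h3 (0 : K) h4 h5 h6 h7 h8 h9 h10 h11 h12 h13 h14 h15 h16
  (@qscalD _ _ _ _ rr N.*2 k) (@qscalM _ _ _ _ rr N.*2 k) (qscal_idem rr N.*2 k)
  (@qscal_idem0 _ _ _ _ rr N.*2 k) (@qscal_inv _ _ _ _ rr N.*2 k) Ft Fc.
exists F'; split=> // a v; rewrite Fn' /mut_step !Fn; reflexivity.
Qed.

End HalfMutation.

(** * Cyclic derivatives *)

Lemma sum_sig (T : finType) (P : pred T) (M : zmodType) (F : T -> M) :
  \sum_(i : {x | P x}) F (val i) = \sum_(x | P x) F x.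
Proof.
rewrite [RHS](reindex_omap (val : {x | P x} -> T) insub) => [|x Px].
  by apply: eq_bigl => i; rewrite valK eqxx (valP i).
by rewrite insubT.
Qed.

Section CyclicSum.
Variables (T : Type) (M : zmodType).
Implicit Types (Phi : seq T -> M) (s : seq T).

Definition csum Phi s : M := \sum_(i < size s) Phi (rot i s).

Fixpoint czip Phi (acc s : seq T) : M :=
  if s is x :: s' then Phi (x :: s' ++ acc) + czip Phi (rcons acc x) s' else 0.

Lemma czipE Phi acc s :
  czip Phi acc s = \sum_(i < size s) Phi (drop i s ++ acc ++ take i s).
Proof.
elim: s acc => [|x s IH] acc /=; first by rewrite big_ord0.
rewrite big_ord_recl /= cats0 IH; congr (_ + _); apply: eq_bigr => i _.
by rewrite /= cat_rcons.
Qed.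

Lemma csum_czip Phi s : csum Phi s = czip Phi [::] s.
Proof. by rewrite czipE; apply: eq_bigr => i _; rewrite /rot. Qed.

Lemma csum_rot1 Phi s : csum (Phi \o rot 1) s = csum Phi s.
Proof.
case: s => [|x s]; first by rewrite /csum !big_ord0.
rewrite /csum [LHS]big_ord_recr [RHS]big_ord_recl /= addrC; congr (_ + _).
  by rewrite -rotS //= rot0 -[(size s).+1]/(size (x :: s)) rot_size.
by apply: eq_bigr => i _ /=; rewrite -rotS //= ltnS ltnW.
Qed.

Lemma csum_rot Phi n s : csum Phi (rot n s) = csum Phi s.
Proof.
have rot1 t : csum Phi (rot 1 t) = csum Phi t.
  rewrite -[RHS]csum_rot1 /csum size_rot; apply: eq_bigr => i _ /=.
  by rewrite rot_rot.
elim: n => [|n IH]; first by rewrite rot0.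
have [lt|ge] := ltnP n (size s); last by rewrite rot_oversize // ltnW.
by rewrite rotS // rot1.
Qed.

Lemma csum_eq Phi Phi' s :
  (forall i, (i < size s)%N -> Phi (rot i s) = Phi' (rot i s)) ->
  csum Phi s = csum Phi' s.
Proof. by move=> h; apply: eq_bigr => i _; exact: h. Qed.

End CyclicSum.

Section Derivatives.
Context (K : fieldType) {V : finType} (Q : quiver V).
Local Notation A := (path_algebra K Q).
Local Notation e := (idem K Q).
Local Notation ty := (typed e).
Local Notation Pot := (potential K Q).
Local Notation der := (@cyclic_derivative K V Q).

Definition dhead (a : arrow Q) (t : seq (arrow Q)) : A :=
  if t is b :: t' then if b == a then path_of K (src a) t' else 0 else 0.

Definition dword (a : arrow Q) (s : seq (arrow Q)) : A := csum (dhead a) s.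

Lemma der_gen a c : der a << c >> = dword a (nword c).
Proof.
rewrite [LHS]fgliftU1 /dword /csum big_mkcond; apply: eq_bigr => i _.
by rewrite /dhead /rot (drop_nth a).
Qed.

Lemma der0 a : der a 0 = 0. Proof. exact: raddf0. Qed.
Lemma derD a W W' : der a (W + W') = der a W + der a W'. Proof. exact: raddfD. Qed.
Lemma derZ a c W : der a (c *: W) = c *: der a W. Proof. exact: linearZ. Qed.
Lemma der_sum a (T : Type) (s : seq T) (D : pred T) F :
  der a (\sum_(i <- s | D i) F i) = \sum_(i <- s | D i) der a (F i).
Proof. exact: raddf_sum. Qed.

Lemma cyc_word (s : cycle_word Q) :
  exists i, rot i (cwval s) = nword (\pi_(necklace Q) s).
Proof.
have /eqP : \pi_(necklace Q) s = \pi_(necklace Q) (repr (\pi_(necklace Q) s)).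
  by rewrite reprK.
by rewrite eqmodE => /rotation_eqP.
Qed.

Lemma der_cyc a s : der a (cyc K s) = if is_cycle s then dword a s else 0.
Proof.
rewrite /cyc; case: insubP => [w _ wE|/negbTE->]; last exact: der0.
rewrite -wE (cwvalP w) der_gen; have [i <-] := cyc_word w.
exact: csum_rot.
Qed.

Lemma nword_cycle (c : necklace Q) : is_cycle (nword c).
Proof. exact: cwvalP. Qed.

Lemma cyc_nword (c : necklace Q) : << c >> = cyc K (nword c) :> Pot.
Proof.
rewrite /cyc insubT ?nword_cycle // => h; congr << _ >>.
rewrite -[LHS]reprK; congr (\pi_(necklace Q) _); exact: val_inj.
Qed.

Lemma pot_ind (S : Pot -> Prop) :
  S 0 -> (forall x y, S x -> S y -> S (x + y)) ->
  (forall c x, S x -> S (c *: x)) ->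
  forall W, (forall c, c \in dom W -> S (cyc K (nword c))) -> S W.
Proof.
move=> S0 SD SZ W Sc; rewrite -[W]freeg_sumE big_seq.
by apply: big_ind => // c cW; rewrite freegZE cyc_nword; apply/SZ/Sc.
Qed.

Lemma is_cycleP a s : is_cycle (a :: s) =
  is_qpath (src a, s) && (last (src a) (map (@src V Q) s) == tgt a).
Proof.
rewrite /is_cycle /= rcons_path /is_qpath /= last_map.
by congr (_ && _); case: s => //= b s; rewrite /composable eq_sym.
Qed.

Lemma is_cycle_rot n s : is_cycle (Q := Q) (rot n s) = is_cycle s.
Proof. by rewrite /is_cycle rot_cycle -!size_eq0 size_rot. Qed.

Lemma dhead_typed a t : is_cycle t -> ty (src a) (tgt a) (dhead a t).
Proof.
case: t => [|b t] //; rewrite is_cycleP => /andP[_ /eqP bt] /=.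
case: eqP => [<-|_]; last exact: typed0.
by have := typed_path_of K (src b) t; rewrite bt.
Qed.

Lemma dword_typed a s : is_cycle s -> ty (src a) (tgt a) (dword a s).
Proof.
by move=> cs; apply: typed_sum => i _; apply: dhead_typed; rewrite is_cycle_rot.
Qed.

Lemma der_typed a W : ty (src a) (tgt a) (der a W).
Proof.
apply: (pot_ind (S := fun W => ty (src a) (tgt a) (der a W))).
- by rewrite der0; exact: typed0.
- by move=> x y; rewrite derD; exact: typedD.
- by move=> c x; rewrite derZ; exact: typedZ.
- by move=> c _; rewrite der_cyc nword_cycle; exact/dword_typed/nword_cycle.
Qed.

Lemma der_rad N W : (forall c, c \in dom W -> (N < size (nword c))%N) ->
  forall a, in_rad N (der a W).
Proof.
move=> WN a; apply: (pot_ind (S := fun W => in_rad N (der a W))).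
- by rewrite der0; exact: in_rad0.
- by move=> x y; rewrite derD; exact: in_radD.
- by move=> c x; rewrite derZ; exact: in_radZ.
- move=> c /WN h; rewrite der_cyc nword_cycle; apply: in_rad_sum => i _.
  rewrite /dhead; have := size_rot i (nword c).
  case: rot => [|b t] /= st; first exact: in_rad0.
  by case: eqP => _; [apply: in_rad_path_of; rewrite -ltnS st | exact: in_rad0].
Qed.

Lemma rcan_path_of b v s c : is_qpath (Q := Q) (v, rcons s c) ->
  rcan b (path_of K v (rcons s c)) = if c == b then path_of K v s else 0.
Proof. exact: rcan_path. Qed.

(* Both sides sum over the occurrences of [b a] in the cyclic words of [W]. *)
Lemma der_mixed a b W : rcan b (der a W) = lcan a (der b W).
Proof.
apply: (pot_ind (S := fun W => rcan b (der a W) = lcan a (der b W))).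
- by rewrite !der0 rcan0 lcan0.
- by move=> x y hx hy; rewrite !derD rcanD lcanD hx hy.
- by move=> c x hx; rewrite !derZ rcanZ lcanZ hx.
move=> c _; rewrite !der_cyc nword_cycle.
have sr (s : seq (arrow Q)) : rcan b (dword a s) = csum (fun t => rcan b (dhead a t)) s.
  exact: raddf_sum.
have sl (s : seq (arrow Q)) : lcan a (dword b s) = csum (fun t => lcan a (dhead b t)) s.
  exact: raddf_sum.
rewrite sr sl -[LHS]csum_rot1; apply: csum_eq => i _ /=.
have := nword_cycle c; rewrite -(is_cycle_rot i); case: (rot i _) => [|x [|y t]] // ct.
  by rewrite rot1_cons /=; case: eqP; case: eqP => _ _;
    rewrite ?path_of_nil ?rcan_idem ?lcan_idem ?rcan0 ?lcan0.
have := ct; rewrite is_cycleP => /andP[h1 _].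
rewrite -(is_cycle_rot 1) rot1_cons rcons_cons is_cycleP in ct.
have /andP[h2 _] := ct; rewrite rot1_cons rcons_cons /dhead.
case: (y =P a) => [ya|ya]; case: (x =P b) => [xb|xb]; rewrite ?rcan0 ?lcan0 //.
- by rewrite -ya -xb rcan_path_of // lcan_path // !eqxx.
- by rewrite -ya rcan_path_of //; case: (x =P b).
- by rewrite -xb lcan_path //; case: (y =P a).
Qed.

End Derivatives.

(** * Premutation of a quiver with potential *)

Section MuPre.
Context (K : fieldType) {V : finType} (Q : quiver V) (k : V).
Local Notation Q' := (mu_pre k Q).
Local Notation A := (path_algebra K Q).
Local Notation A' := (path_algebra K Q').
Local Notation e := (idem K Q).
Local Notation e' := (idem K Q').
Local Notation ty := (typed e).
Local Notation ty' := (typed e').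
Local Notation ar := (arr K (Q := Q)).
Local Notation ar' := (arr K (Q := Q')).
Local Notation bad := (pred1 k).
Hypothesis noloop : forall a : arrow Q, src a == k -> tgt a != k.

Lemma in_not_src (a : arrow Q) : tgt a == k -> src a != k.
Proof. by apply: contraL => /noloop. Qed.

Definition thru (b a : arrow Q) : option (arrow Q') :=
  omap inr (insub (b, a) : option (through Q k)).

Lemma thruT b a (h : (src b == k) && (tgt a == k)) :
  thru b a = Some (inr (Sub (b, a) h : through Q k)).
Proof. by rewrite /thru insubT. Qed.

(** The letters that occur in contracted words: everything except the opposite arrows. *)
Definition good_letter (x : arrow Q') : bool :=
  match x with inl a => ~~ incident k a | inr _ => true end.

Definition expand (x : arrow Q') : seq (arrow Q) :=
  match x with inl a => [:: a] | inr p => [:: (val p).1; (val p).2] end.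

Local Notation expands c := (flatten (map expand c)).

Lemma mu_pre_noloop (x : arrow Q') : src x == k -> tgt x != k.
Proof.
case: x => [a|p] /=; last by move=> _; have /andP[b _] := valP p; exact: noloop.
rewrite /incident; have [sa|sa] := eqVneq (src a) k; first by rewrite /= (negbTE (noloop _)) ?sa.
by have [ta|ta] /= := eqVneq (tgt a) k; rewrite (negbTE sa).
Qed.

Lemma is_qpath_cons (P : quiver V) v (a : arrow P) s :
  is_qpath (v, a :: s) = (tgt a == v) && is_qpath (src a, s).
Proof.
by rewrite -cat1s is_qpath_cat /= {1}/is_qpath /= andbT.
Qed.

Lemma is_qpath_expand u (c : seq (arrow Q')) : all good_letter c ->
  is_qpath (u, expands c) = is_qpath (u, c).
Proof.
elim: c u => // x c IH u /andP[gx gc]; rewrite [RHS]is_qpath_cons -(IH _ gc).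
case: x gx => [a|p] /= gx; first by rewrite is_qpath_cons (negbTE gx).
have /andP[/eqP b /eqP a] := valP p.
by rewrite !is_qpath_cons a b eqxx.
Qed.

Lemma last_expand u (c : seq (arrow Q')) : all good_letter c ->
  last u (map (@src V Q) (expands c)) = last u (map (@src V Q') c).
Proof.
elim: c u => // x c IH u /andP[gx gc]; case: x gx => [a|p] /= gx.
  by rewrite (negbTE gx) IH.
by rewrite IH.
Qed.

(** Contraction loses no information on paths between vertices other than k, so sums over the
    rotations of a cycle can be compared with those of its contraction through [expand]. *)
Lemma contractP u v (s : seq (arrow Q)) : u != k -> v != k -> is_qpath (u, s) ->
  last u (map (@src V Q) s) = v ->
  all good_letter (contract k s) && (expands (contract k s) == s).
Proof.
apply: (good_word_ind (bad := bad) noloop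
  (S := fun u v s => all good_letter (contract k s) && (expands (contract k s) == s))).
- by [].
- move=> a w t ta sa _ /andP[gc /eqP ec].
  have {}sa : src a != k := sa.
  have cE : contract k (a :: t) = inl a :: contract k t.
    by case: t {gc ec} => //= b t; rewrite insubN //= (negbTE sa).
  rewrite cE /= gc ec eqxx !andbT /incident negb_or.
  by apply/andP; split; [exact: sa | exact: ta].
- move=> b a w t /= tb ba bb sa _ /andP[gc /eqP ec].
  have h : (src b == k) && (tgt a == k) by rewrite -ba andbb.
  by rewrite /= insubT //= gc ec eqxx.
Qed.

Definition mu_F1 (a : arrow Q) : A' := ar' (inl a).
Definition mu_F2 (b a : arrow Q) : A' := if thru b a is Some x then ar' x else 0.
Local Notation th := (ceval bad mu_F1 mu_F2).

Lemma mu_F1t b : tgt b != k -> src b != k -> ty' (tgt b) (src b) (mu_F1 b).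
Proof.
move=> tb sb; have := typed_arr K (inl b : arrow Q').
by rewrite /= /incident (negbTE tb) (negbTE sb).
Qed.

Lemma mu_F2t b a : src b = tgt a -> src b == k -> ty' (tgt b) (src a) (mu_F2 b a).
Proof.
move=> ba bk; have h : (src b == k) && (tgt a == k) by rewrite -ba bk.
by rewrite /mu_F2 (thruT h); exact: typed_arr.
Qed.

Lemma mu_F1r b : in_rad 1 (mu_F1 b). Proof. exact: in_rad_arr. Qed.

Lemma mu_F2r b a : in_rad 1 (mu_F2 b a).
Proof. by rewrite /mu_F2; case: thru => [x|]; [exact: in_rad_arr | exact: in_rad0]. Qed.

Lemma cev_expand c : all good_letter c ->
  cev bad mu_F1 mu_F2 (expands c) = \prod_(x <- c) ar' x.
Proof.
elim: c => [|x c IH] /=; first by rewrite big_nil.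
move=> /andP[gx gc]; rewrite big_cons -(IH gc).
case: x gx => [a|p] /= gx.
  by move: gx; rewrite negb_or => /andP[/negbTE -> _].
have /andP[b a] := valP p; rewrite b /mu_F2 (thruT (valP p)); congr (ar' _ * _).
by congr inr; apply: val_inj; case: p {b a gx} => -[].
Qed.

Lemma path_of_prod (P : quiver V) u (c : seq (arrow P)) : is_qpath (u, c) ->
  path_of K u c = idem K P u * \prod_(x <- c) arr K x.
Proof.
have E := @idemE K V P.
elim: c u => [|x c IH] u; first by rewrite big_nil mulr1 path_of_nil.
rewrite is_qpath_cons => /andP[/eqP <- hc].
rewrite path_of_cons eqxx IH // big_cons !mulrA.
by rewrite (typedr E (typed_arr K x)) (typedl E (typed_arr K x)).
Qed.

Lemma th_expand u c : all good_letter c ->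
  th (path_of K u (expands c)) = path_of K u c.
Proof.
move=> gc; have [h|h] := boolP (is_qpath (u, c)); last first.
  by rewrite (path_of0 K h) path_of0 ?is_qpath_expand // ceval0.
rewrite ceval_path_of ?is_qpath_expand // cev_expand //.
by rewrite path_of_prod.
Qed.

(** ** Derivatives of the bracket *)

(** The rotations of an expanded word, grouped by the letter they start in: a letter [ba] accounts
    for two of them, one that starts with b and one that starts in its middle, with a, and ends with
    b. *)
Definition letter_sum (M : zmodType) (Phi : seq (arrow Q) -> M)
    (c : seq (arrow Q')) : M :=
  match c with
  | [::] => 0
  | inl a :: c' => Phi (a :: expands c')
  | inr p :: c' => Phi ((val p).1 :: (val p).2 :: expands c') +
                   Phi ((val p).2 :: rcons (expands c') (val p).1)
  end.

Lemma csum_expand (M : zmodType) (Phi : seq (arrow Q) -> M) c :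
  csum Phi (expands c) = csum (letter_sum Phi) c.
Proof.
rewrite !csum_czip -[X in czip _ X (expands c)]/(expands [::]).
elim: c [::] => // -[a|p] c IH acc /=.
  by rewrite map_cat flatten_cat; congr (_ + _);
     rewrite -IH map_rcons flatten_rcons cats1.
rewrite map_cat flatten_cat -addrA; congr (_ + _); congr (_ + _).
  by rewrite -rcons_cat.
by rewrite -IH map_rcons flatten_rcons /= -!cats1 -catA.
Qed.

Lemma th_csum (Phi : seq (arrow Q) -> A) s :
  th (csum Phi s) = csum (fun t => th (Phi t)) s.
Proof. exact: ceval_sum. Qed.

Lemma rcan_csum b (Phi : seq (arrow Q) -> A) s :
  rcan b (csum Phi s) = csum (fun t => rcan b (Phi t)) s.
Proof. exact: raddf_sum. Qed.

Section ClosedWord.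
Variable c : seq (arrow Q').
Hypotheses (gc : all good_letter c) (cc : is_cycle c).

Lemma rot_good i x c' : rot i c = x :: c' ->
  [/\ good_letter x, all good_letter c', is_qpath (src x, c') &
      last (src x) (map (@src V Q') c') = tgt x].
Proof.
move=> rE; have /andP[gx gc'] : good_letter x && all good_letter c'.
  by move: gc; rewrite -(cat_take_drop i c) all_cat andbC -all_cat -/(rot i c) rE.
have := cc; rewrite -(is_cycle_rot i) rE is_cycleP => /andP[h1 /eqP h2].
by split.
Qed.

Lemma th_dword_good a : src a != k -> tgt a != k ->
  th (dword K a (expands c)) = dword K (inl a : arrow Q') c.
Proof.
move=> sa ta; rewrite /dword th_csum csum_expand; apply: csum_eq => i _.
case rE: (rot i c) => [|x c'] //; have [gx gc' _ _] := rot_good rE.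
case: x gx {rE} => [b|p] gx /=.
  have -> : (inl b == inl a :> arrow Q') = (b == a) by [].
  case: eqP => [_|_]; last exact: ceval0.
  by rewrite /incident (negbTE sa) (negbTE ta) th_expand.
have /andP[/eqP b1 /eqP b2] := valP p.
have -> : ((val p).1 == a) = false by apply: contraNF sa => /eqP <-; rewrite b1.
have -> : ((val p).2 == a) = false by apply: contraNF ta => /eqP <-; rewrite b2.
by rewrite ceval0 addr0.
Qed.

(** A rotation that starts with a and ends with b comes from the middle of a letter [ba]; removing
    both ends leaves the expansion of the word that follows this letter. *)
Lemma th_dword_thru a b (h : (src b == k) && (tgt a == k)) :
  th (rcan b (dword K a (expands c))) =
  dword K (inr (Sub (b, a) h : through Q k) : arrow Q') c.
Proof.
have /andP[sb ta] := h.
rewrite /dword rcan_csum th_csum csum_expand; apply: csum_eq => i _.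
case rE: (rot i c) => [|x c'] //; have [gx gc' hq hl] := rot_good rE.
case: x gx rE hq hl => [d|p] gx rE hq hl /=.
  have -> : (d == a) = false.
    by apply: contraNF gx => /eqP ->; rewrite /= /incident ta orbT.
  by rewrite rcan0 ceval0.
have /andP[s1 t2] := valP p.
have -> : ((val p).1 == a) = false.
  by apply: contraTF ta => /eqP <-; exact: noloop.
rewrite rcan0 ceval0 add0r.
have -> : (inr p == inr (Sub (b, a) h : through Q k) :> arrow Q') =
    ((val p).2 == a) && ((val p).1 == b).
  rewrite -[LHS]/(p == _) -val_eqE /=; case: (val p) => p1 p2 /=.
  by rewrite xpair_eqE andbC.
case: eqP => [pa|_]; last by rewrite rcan0 ceval0.
rewrite rcan_path_of; last first.
  rewrite -cats1 is_qpath_cat is_qpath_expand // last_expand // -pa.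
  by rewrite /= in hq hl; rewrite hq hl is_qpath1.
case: eqP => [pb|_]; last by rewrite ceval0.
by rewrite th_expand // pa.
Qed.

Lemma dword_incident a : incident k a -> dword K (inl a : arrow Q') c = 0.
Proof.
move=> ia; apply: big1 => i _; rewrite /dhead.
case rE: (rot i c) => [|x c'] //; have [gx _ _ _] := rot_good rE.
by case: eqP => // xa; rewrite xa /= ia in gx.
Qed.

End ClosedWord.

Lemma bracket0 : bracket k (0 : potential K Q) = 0. Proof. exact: raddf0. Qed.
Lemma bracketD (W W' : potential K Q) :
  bracket k (W + W') = bracket k W + bracket k W'.
Proof. exact: raddfD. Qed.
Lemma bracketZ c (W : potential K Q) : bracket k (c *: W) = c *: bracket k W.
Proof. exact: linearZ. Qed.

Lemma bracket_gen (n : necklace Q) : exists c : seq (arrow Q'),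
  [/\ all good_letter c, is_cycle c, bracket k << n >> = cyc K c &
      exists i, expands c = rot i (nword n)].
Proof.
set s := nword n; set i := find (fun a => tgt a != k) s.
have cs : is_cycle s := nword_cycle n.
have hs : has (fun a => tgt a != k) s.
  move: cs; case: (s) => [|a t] //=; rewrite is_cycleP => /andP[h1 /eqP h2].
  have [ta|//] := eqVneq (tgt a) k; have sa := in_not_src (introT eqP ta).
  case: t h1 h2 => [|b t]; first by move=> _ /= h2; rewrite h2 ta eqxx in sa.
  by rewrite is_qpath_cons => /andP[/eqP tb _] _ /=; rewrite tb sa.
have iz : (i < size s)%N by rewrite -has_find.
have [a [t [sE ta]]] : exists a t, rot i s = a :: t /\ tgt a != k.
  have [b _] : exists b, b \in s by case/hasP: hs => b; exists b.
  exists (nth b s i), (drop i.+1 s ++ take i s).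
  by rewrite /rot (drop_nth b) //; split=> //; exact: (nth_find b hs).
have := cs; rewrite -(is_cycle_rot i) sE is_cycleP => /andP[h1 /eqP h2].
have hq : is_qpath (tgt a, rot i s) by rewrite sE is_qpath_cons eqxx.
have hl : last (tgt a) (map (@src V Q) (rot i s)) = tgt a by rewrite sE.
have /andP[gc /eqP ec] := contractP ta ta hq hl.
exists (contract k (rot i s)); split=> //; last 2 first.
- by rewrite [LHS]fgliftU1.
- by exists i.
have := is_qpath_expand (tgt a) gc; have := last_expand (tgt a) gc.
rewrite ec hl hq; case: (contract k (rot i s)) ec => [|x c] /=; first by rewrite sE.
move=> _ lE; rewrite is_qpath_cons => /esym/andP[/eqP tx hc].
by rewrite is_cycleP hc -lE tx eqxx.
Qed.

Lemma der_bracket_good (W : potential K Q) a : src a != k -> tgt a != k ->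
  th (cyclic_derivative a W) = cyclic_derivative (inl a : arrow Q') (bracket k W).
Proof.
move=> sa ta; apply: (pot_ind (S := fun W => th (cyclic_derivative a W) =
   cyclic_derivative (inl a : arrow Q') (bracket k W))).
- by rewrite bracket0 !der0 ceval0.
- by move=> x y hx hy; rewrite bracketD !derD cevalD hx hy.
- by move=> c x hx; rewrite bracketZ !derZ cevalZ hx.
move=> n _; rewrite -cyc_nword; have [c [gc cc -> [i ec]]] := bracket_gen n.
rewrite der_gen der_cyc cc -(th_dword_good gc cc sa ta) ec /dword csum_rot //.
Qed.

Lemma der_bracket_thru (W : potential K Q) a b (h : (src b == k) && (tgt a == k)) :
  th (rcan b (cyclic_derivative a W)) =
  cyclic_derivative (inr (Sub (b, a) h : through Q k) : arrow Q') (bracket k W).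
Proof.
apply: (pot_ind (S := fun W => th (rcan b (cyclic_derivative a W)) =
   cyclic_derivative (inr (Sub (b, a) h : through Q k) : arrow Q') (bracket k W))).
- by rewrite bracket0 !der0 rcan0 ceval0.
- by move=> x y hx hy; rewrite bracketD !derD rcanD cevalD hx hy.
- by move=> c x hx; rewrite bracketZ !derZ rcanZ cevalZ hx.
move=> n _; rewrite -cyc_nword; have [c [gc cc -> [i ec]]] := bracket_gen n.
by rewrite der_gen der_cyc cc -(th_dword_thru gc cc h) ec /dword csum_rot.
Qed.

Lemma der_bracket_incident (W : potential K Q) a : incident k a ->
  cyclic_derivative (inl a : arrow Q') (bracket k W) = 0.
Proof.
move=> ia; apply: (pot_ind
  (S := fun W => cyclic_derivative (inl a : arrow Q') (bracket k W) = 0)).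
- by rewrite bracket0 der0.
- by move=> x y hx hy; rewrite bracketD derD hx hy addr0.
- by move=> c x hx; rewrite bracketZ derZ hx scaler0.
move=> n _; rewrite -cyc_nword; have [c [gc cc -> _]] := bracket_gen n.
by rewrite der_cyc cc dword_incident.
Qed.

(** ** Derivatives of [Delta] *)

Lemma sum_through (M : zmodType) (F : arrow Q -> arrow Q -> M) :
  \sum_(p : through Q k) F (val p).1 (val p).2 =
  \sum_(b | src b == k) \sum_(a | tgt a == k) F b a.
Proof.
rewrite (sum_sig (fun p : arrow Q * arrow Q => (src p.1 == k) && (tgt p.2 == k))
   (fun p => F p.1 p.2)).
by rewrite pair_big_dep.
Qed.

Lemma mu_F2E (p : through Q k) : ar' (inr p) = mu_F2 (val p).1 (val p).2.
Proof.
rewrite /mu_F2 (thruT (valP p)); congr (ar' (inr _)); apply: val_inj.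
by case: p => -[].
Qed.

Lemma der_Delta x : cyclic_derivative x (Delta k Q : potential K Q') = \sum_(p : through Q k)
  ((if inl (val p).2 == x then ar' (inl (val p).1) * ar' (inr p) else 0) +
   (if inl (val p).1 == x then ar' (inr p) * ar' (inl (val p).2) else 0) +
   (if inr p == x then ar' (inl (val p).2) * ar' (inl (val p).1) else 0)).
Proof.
rewrite der_sum; apply: eq_bigr => p _; rewrite der_cyc.
have /andP[/eqP b /eqP a] := valP p.
have cc : is_cycle ([:: inl (val p).2; inl (val p).1; inr p] : seq (arrow Q')).
  by rewrite /is_cycle /= /composable /= /incident a b eqxx /= orbT !eqxx.
rewrite cc /dword csum_czip /=.
have pE (y z : arrow Q') v : v = tgt y -> src y = tgt z ->
    path_of K v [:: y; z] = ar' y * ar' z.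
  by move=> -> yz; rewrite path_of_cons eqxx /arr yz.
rewrite addr0 addrA; congr (_ + _ + _); case: eqP => // <-; apply: pE => //=;
  by rewrite /incident ?a ?b ?eqxx ?orbT.
Qed.

End MuPre.

(** * Compatible families under premutation, in both directions *)

Section MuPreStep.
Context (K : fieldType) {V : finType} (Q : quiver V) (k : V) (W : potential K Q).
Local Notation Q' := (mu_pre k Q).
Local Notation A := (path_algebra K Q).
Local Notation A' := (path_algebra K Q').
Local Notation e := (idem K Q).
Local Notation e' := (idem K Q').
Local Notation ty := (typed e).
Local Notation ty' := (typed e').
Local Notation ar := (arr K (Q := Q)).
Local Notation ar' := (arr K (Q := Q')).
Local Notation bad := (pred1 k).
Hypothesis noloop : forall a : arrow Q, src a == k -> tgt a != k.
Hypothesis Wr : forall a, in_rad 2 (cyclic_derivative a W).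

Definition mu_pot : potential K Q' := bracket k W + Delta k Q.
Local Notation r := (fun a : arrow Q => cyclic_derivative a W).
Local Notation r' := (fun x : arrow Q' => cyclic_derivative x mu_pot).
Local Notation th := (ceval bad (@mu_F1 K V Q k) (@mu_F2 K V Q k)).
Local Notation I := (in_arrow Q k).
Local Notation J := (out_arrow Q k).

Let E := @idemE K V Q.
Let E' := @idemE K V Q'.
Let nl' := mu_pre_noloop noloop.

Lemma inl_eqE (a b : arrow Q) : (inl a == inl b :> arrow Q') = (a == b).
Proof. by []. Qed.

(** This and the next three lemmas compute the relations of the premutation along its four kinds of
    arrows; they provide the hypotheses [rel_good], [relP], [rel_in] and [rel_out] of the half
    mutation. *)
Lemma mu_der_good a : src a != k -> tgt a != k -> r' (inl a) = th (r a).
Proof.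
move=> sa ta; rewrite /mu_pot derD -(der_bracket_good noloop W sa ta) der_Delta //.
rewrite big1 ?addr0 // => p _; rewrite !inl_eqE.
have /andP[/eqP b1 /eqP b2] := valP p.
have -> : ((val p).1 == a) = false by apply: contraNF sa => /eqP <-; rewrite b1.
have -> : ((val p).2 == a) = false by apply: contraNF ta => /eqP <-; rewrite b2.
by rewrite /= !addr0.
Qed.

Lemma mu_der_thru a b (h : (src b == k) && (tgt a == k)) :
  r' (inr (Sub (b, a) h : through Q k)) =
  th (rcan b (r a)) + ar' (inl a) * ar' (inl b).
Proof.
rewrite /mu_pot derD -(der_bracket_thru noloop) der_Delta //; congr (_ + _).
rewrite (bigD1 (Sub (b, a) h : through Q k)) //= eqxx !add0r big1 ?addr0 // => p np.
have -> : (inr p == inr (Sub (b, a) h : through Q k) :> arrow Q') = false.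
  exact: negbTE np.
by rewrite /= !addr0.
Qed.

Lemma mu_der_in a : tgt a == k ->
  r' (inl a) = \sum_(j : J) ar' (inl (val j)) * mu_F2 K k (val j) a.
Proof.
move=> ta; rewrite /mu_pot derD der_bracket_incident ?add0r //; last by rewrite /incident ta orbT.
rewrite der_Delta //.
transitivity (\sum_(p : through Q k)
    (if (val p).2 == a then ar' (inl (val p).1) * mu_F2 K k (val p).1 a else 0)).
  apply: eq_bigr => p _; rewrite !inl_eqE; have /andP[b1 _] := valP p.
  have -> : ((val p).1 == a) = false.
    by apply: contraTF ta => /eqP <-; exact: noloop.
  rewrite /= !addr0; case: eqP => // <-; by rewrite mu_F2E.
rewrite (sum_through k (fun b a' => if a' == a then ar' (inl b) * mu_F2 K k b a else 0)).
rewrite [RHS](sum_sig (fun b => src b == k) (fun b => ar' (inl b) * mu_F2 K k b a)).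
apply: eq_bigr => b _; rewrite (bigD1 a) //= eqxx big1 ?addr0 // => a' /andP[_ /negbTE ->] //.
Qed.

Lemma mu_der_out b : src b == k ->
  r' (inl b) = \sum_(i : I) mu_F2 K k b (val i) * ar' (inl (val i)).
Proof.
move=> sb; rewrite /mu_pot derD der_bracket_incident ?add0r //; last by rewrite /incident sb.
rewrite der_Delta //.
transitivity (\sum_(p : through Q k)
    (if (val p).1 == b then mu_F2 K k b (val p).2 * ar' (inl (val p).2) else 0)).
  apply: eq_bigr => p _; rewrite !inl_eqE; have /andP[_ b2] := valP p.
  have -> : ((val p).2 == b) = false.
    by apply: contraTF b2 => /eqP ->; exact: noloop.
  rewrite /= add0r !addr0; case: eqP => // <-; by rewrite mu_F2E.
rewrite (sum_through k (fun b' a => if b' == b then mu_F2 K k b a * ar' (inl a) else 0)).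
rewrite [RHS](sum_sig (fun a => tgt a == k) (fun a => mu_F2 K k b a * ar' (inl a))).
rewrite (bigD1 b) //= eqxx [X in _ + X]big1 ?addr0 // => b' /andP[_ /negbTE ->].
by rewrite big1.
Qed.

(* The arrows of [mu_pre k Q] ending (starting) at [k] are the opposites of the
   arrows of [Q] starting (ending) at [k]. *)
Lemma sum_in_mu (M : zmodType) (F : arrow Q' -> M) :
  \sum_(x : in_arrow Q' k) F (val x) = \sum_(j : J) F (inl (val j)).
Proof.
rewrite (sum_sig (fun x : arrow Q' => tgt x == k)).
rewrite [RHS](sum_sig (fun b : arrow Q => src b == k) (fun b => F (inl b))).
rewrite big_sumType /= [X in _ + X]big1 ?addr0 => [|p /= tp]; last first.
  by have /andP[/noloop] := valP p; rewrite tp.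
apply: eq_bigl => a /=; rewrite /incident.
have [sa|sa] := boolP (src a == k); first by [].
by case: (boolP (tgt a == k)) => [_|/negbTE] //=; rewrite (negbTE sa).
Qed.

Lemma sum_out_mu (M : zmodType) (F : arrow Q' -> M) :
  \sum_(x : out_arrow Q' k) F (val x) = \sum_(i : I) F (inl (val i)).
Proof.
rewrite (sum_sig (fun x : arrow Q' => src x == k)).
rewrite [RHS](sum_sig (fun b : arrow Q => tgt b == k) (fun b => F (inl b))).
rewrite big_sumType /= [X in _ + X]big1 ?addr0 => [|p /= tp]; last first.
  by have /andP[_ /(in_not_src noloop)] := valP p; rewrite tp.
apply: eq_bigl => a /=; rewrite /incident.
have [ta|ta] := boolP (tgt a == k); first by rewrite orbT.
by rewrite orbF; case: (boolP (src a == k)) => [_|/negbTE] //=; rewrite (negbTE ta).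
Qed.

Lemma mu_inl_in (i : I) : ty' (src (val i)) k (ar' (inl (val i))).
Proof.
have := typed_arr K (inl (val i) : arrow Q').
by rewrite /= /incident (valP i) orbT (eqP (valP i)).
Qed.

Lemma mu_inl_out (j : J) : ty' k (tgt (val j)) (ar' (inl (val j))).
Proof.
have := typed_arr K (inl (val j) : arrow Q').
by rewrite /= /incident (valP j) (eqP (valP j)).
Qed.

Lemma th_arr2 (b a : arrow Q) : src b == k -> tgt a == k ->
  th (ar b * ar a) = mu_F2 K k b a.
Proof.
move=> sb ta; apply: (ceval_arr2 (bad := bad) _ (@mu_F2t K V Q k)) => //.
by rewrite (eqP sb) (eqP ta).
Qed.

Lemma mu_der_rad x : in_rad 1 (r' x).
Proof.
have th1 y : in_rad 1 y -> in_rad 1 (th y).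
  exact: (ceval_rad_uphalf (@mu_F1r K V Q k) (@mu_F2r K V Q k) (N := 1)).
case: x => [a|p].
  have [sa|sa] := boolP (src a == k).
    by rewrite mu_der_out //; apply: in_rad_sum => i _; exact/in_radMl/in_rad_arr.
  have [ta|ta] := boolP (tgt a == k).
    by rewrite mu_der_in //; apply: in_rad_sum => i _; exact/in_radMr/in_rad_arr.
  by rewrite mu_der_good //; apply: th1; apply: in_radW (Wr (a := a)).
have -> : p = Sub ((val p).1, (val p).2) (valP p).
  by apply: val_inj => /=; case: (val p).
rewrite mu_der_thru; apply: in_radD; last exact/in_radMl/in_rad_arr.
by apply: th1; apply: rcan_rad; exact: Wr.
Qed.

Lemma thM2 u v w x y : u != k -> v != k -> w != k -> ty u v x -> ty v w y ->
  th (x * y) = th x * th y.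
Proof. exact: (cevalM noloop (@mu_F1t K V Q k) (@mu_F2t K V Q k)). Qed.

Lemma mu_src_k (x : arrow Q') : src x == k -> exists i : I, x = inl (val i).
Proof.
case: x => [a|p] /=; last by have /andP[_ /(in_not_src noloop)/negbTE ->] := valP p.
rewrite /incident; have [ta|ta] := boolP (tgt a == k); first by exists (Sub a ta).
rewrite orbF; case: ifP => [_|->] // tk; by rewrite tk in ta.
Qed.

Lemma mu_tgt_k (x : arrow Q') : tgt x == k -> exists j : J, x = inl (val j).
Proof.
case: x => [a|p] /=; last by have /andP[/noloop/negbTE ->] := valP p.
rewrite /incident; have [sa|sa] := boolP (src a == k); first by exists (Sub a sa).
by rewrite orFb; case: ifP => [_|->] // sk; rewrite sk in sa.
Qed.

Lemma mu_good_inl a : src (inl a : arrow Q') != k -> tgt (inl a : arrow Q') != k ->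
  src a != k /\ tgt a != k.
Proof.
by rewrite /= /incident; case: (boolP (src a == k)) => sa;
  case: (boolP (tgt a == k)) => ta //=; rewrite ?sa ?ta.
Qed.

(** Modulo the derivative along [ba], a passage through k by the opposites of b and a equals minus
    the image of [gam]. So every element between vertices other than k is represented without
    opposite arrows. *)
Lemma mu_th_surj u v x' : u != k -> v != k -> ty' u v x' ->
  exists2 x, ty u v x & idl r' (x' - th x).
Proof.
apply: (good_ind (bad := bad) nl'
  (S := fun u v x' => exists2 x, ty u v x & idl r' (x' - th x))).
- by move=> a b; exists 0; [exact: typed0 | rewrite ceval0 subrr; exact: idl0].
- move=> a b x y [x1 xt xE] [y1 yt yE]; exists (x1 + y1); first exact: typedD.
  by rewrite cevalD opprD addrACA; exact: idlD.
- move=> a b c x [x1 xt xE]; exists (c *: x1); first exact: typedZ.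
  by rewrite cevalZ -scalerBr; exact: idlZ.
- move=> w wk; exists (e w); first exact: (typed_idem E).
  by rewrite ceval_idem subrr; exact: idl0.
- move=> [a|p] w x tx sx wk xt [x1 x1t xE].
    have [sa ta] := mu_good_inl sx tx.
    rewrite /= /incident (negbTE sa) (negbTE ta) /= in xt x1t *.
    exists (ar a * x1); first exact: (typedM E (typed_arr K a) x1t).
    rewrite (thM2 ta sa wk (typed_arr K a) x1t).
    rewrite (ceval_arr (bad := bad) _ (@mu_F1t K V Q k) ta sa) -mulrBr.
    exact: idlMl.
  have /andP[sb ta] := valP p; rewrite /= in xt x1t sx tx *.
  have pt : ty (tgt (val p).1) (src (val p).2) (ar (val p).1 * ar (val p).2).
    exact: (typedM E (typed_arr K _) (typed_arr K _)).
  exists (ar (val p).1 * ar (val p).2 * x1); first exact: (typedM E pt x1t).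
  rewrite (thM2 tx sx wk pt x1t) th_arr2 // -mu_F2E -mulrBr.
  exact: idlMl.
- move=> b' a' w x tb ba bb sa wk xt [x1 x1t xE].
  have [i bE] := mu_src_k bb; have [j aE] : exists j : J, a' = inl (val j).
    by apply: mu_tgt_k; rewrite -ba.
  subst b' a'; rewrite /= /incident !(valP i) !(valP j) orbT /= in xt x1t tb sa *.
  have gt := gam_typed (r := r) (@der_typed K V Q ^~ W) i j.
  exists (- gam r i j * x1); first exact: (typedM E (typedN gt) x1t).
  rewrite mulNr -[in th (- _)]scaleN1r cevalZ scaleN1r opprK.
  rewrite (thM2 tb sa wk gt x1t).
  have -> : ar' (inl (val i)) * ar' (inl (val j)) * x + th (gam r i j) * th x1 =
    (th (gam r i j) + ar' (inl (val i)) * ar' (inl (val j))) * x -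
    th (gam r i j) * (x - th x1).
    by rewrite mulrDl mulrBr opprB [X in _ = X + _]addrC -[RHS]addrA [X in _ = _ + X]addrC subrK.
  have h : (src (val j) == k) && (tgt (val i) == k) by rewrite (valP i) (valP j).
  apply: idlB; last exact: idlMl.
  by apply: idlMr; rewrite -(mu_der_thru h); exact: (idl_gen r').
Qed.

Lemma coh_mu_pre (X : Type) (G : X -> V -> int) : coh e (jid r) G ->
  coh e' (jid r') (fun a v => mut_step (out_count Q k) (in_count Q k) k (G a) v).
Proof.
have rr a : in_rad 1 (r a) by apply: in_radW (Wr (a := a)).
apply: (@coh_half K V Q Q' k noloop r r' _ _ _ (@mu_F1 K V Q k) (@mu_F2 K V Q k)
  _ _ _ _ (fun i : I => ar' (inl (val i))) (fun j : J => ar' (inl (val j)))).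
- by move=> a; exact: der_typed.
- exact: rr.
- by move=> i j; exact: der_mixed.
- exact: mu_F1t.
- exact: mu_F2t.
- exact: mu_F1r.
- exact: mu_F2r.
- exact: mu_inl_in.
- exact: mu_inl_out.
- move=> i j; have h : (src (val j) == k) && (tgt (val i) == k).
    by rewrite (valP i) (valP j).
  by rewrite addrC -(mu_der_thru h); exact: (idl_gen r').
- move=> i; under eq_bigr => j _ do rewrite (th_arr2 (valP j) (valP i)).
  by rewrite -(mu_der_in (valP i)); exact: (idl_gen r').
- move=> j; under eq_bigr => i _ do rewrite (th_arr2 (valP j) (valP i)).
  by rewrite -(mu_der_out (valP j)); exact: (idl_gen r').
- by move=> a sa ta; rewrite -mu_der_good //; exact: (idl_gen r').
- exact: mu_th_surj.
- move=> v y vk yt; exists (fun j : J => lcan (inl (val j) : arrow Q') y) => [j|].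
    have tj : tgt (inl (val j) : arrow Q') = k by rewrite /= /incident (valP j) (eqP (valP j)).
    have := lcan_typed (K := K) (a := inl (val j) : arrow Q') (v := v) (x := y).
    by rewrite tj /= /incident (valP j); exact.
  rewrite [LHS](in_arrow_split yt (typed_rad1 _ yt)) 1?eq_sym //.
  exact: (sum_in_mu (fun x => ar' x * lcan x y)).
- move=> u y uk yt; exists (fun i : I => rcan (inl (val i) : arrow Q') y) => [i|].
    have ti : src (inl (val i) : arrow Q') = k.
      by rewrite /= /incident (valP i) orbT (eqP (valP i)).
    have := rcan_typed (K := K) (b := inl (val i) : arrow Q') (u := u) (x := y).
    by rewrite ti /= /incident (valP i) orbT; exact.
  rewrite [LHS](out_arrow_split yt (typed_rad1 uk yt)).
  exact: (sum_out_mu (fun x => rcan x y * ar' x)).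
Qed.

(** ** The opposite direction *)

(** The algebra of Q itself plays the role of the mutation of its premutation, so that the twice
    premutated quiver never has to be reduced: [ba] is sent back to the product b a, and a passage
    through k by opposite arrows to minus the second derivative. *)
Definition back_F1 (x : arrow Q') : A :=
  match x with inl a => ar a | inr p => ar (val p).1 * ar (val p).2 end.
Definition back_F2 (x y : arrow Q') : A :=
  match x, y with
  | inl a, inl b => if (tgt a == k) && (src b == k) then - rcan b (r a) else 0
  | _, _ => 0
  end.
Local Notation th' := (ceval bad back_F1 back_F2).

(* The sign makes the second premutation inverse to the first one. *)
Definition back_als (x : arrow Q') : A := if x is inl b then - ar b else 0.
Definition back_bes (x : arrow Q') : A := if x is inl a then ar a else 0.

Lemma r_typed_in (a b : arrow Q) : tgt a == k -> src b == k ->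
  ty (src a) (tgt b) (rcan b (r a)).
Proof.
move=> ta sb; apply: rcan_typed; have := der_typed a W.
by rewrite (eqP ta) (eqP sb).
Qed.

Lemma back_F1t x : tgt x != k -> src x != k -> ty (tgt x) (src x) (back_F1 x).
Proof.
case: x => [a|p] tx sx; last exact: (typedM E (typed_arr K _) (typed_arr K _)).
have [sa ta] := mu_good_inl sx tx.
by rewrite /= /incident (negbTE sa) (negbTE ta); exact: typed_arr.
Qed.

Lemma back_F2t x y : src x = tgt y -> src x == k -> ty (tgt x) (src y) (back_F2 x y).
Proof.
move=> xy xk; have [i ->] := mu_src_k xk.
have [j ->] : exists j : J, y = inl (val j) by apply: mu_tgt_k; rewrite -xy.
rewrite /= (valP i) (valP j) /incident !(valP i) !(valP j) orbT /=.
by apply: typedN; apply: r_typed_in; [exact: valP i | exact: valP j].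
Qed.

Lemma back_F1r x : in_rad 1 (back_F1 x).
Proof. by case: x => [a|p]; [exact: in_rad_arr | apply/in_radMl/in_rad_arr]. Qed.

Lemma back_F2r x y : in_rad 1 (back_F2 x y).
Proof.
case: x y => [a|p] [b|q]; rewrite /back_F2; try exact: in_rad0.
case: ifP => _; last exact: in_rad0.
by rewrite -scaleN1r; apply/in_radZ/rcan_rad; exact: Wr.
Qed.

Lemma thM3 u v w x y : u != k -> v != k -> w != k -> ty' u v x -> ty' v w y ->
  th' (x * y) = th' x * th' y.
Proof. exact: (cevalM nl' back_F1t back_F2t). Qed.

Lemma th_typed2 u v x : u != k -> v != k -> ty u v x -> ty' u v (th x).
Proof. exact: (ceval_typed noloop (@mu_F1t K V Q k) (@mu_F2t K V Q k)). Qed.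

Lemma back_arr x : tgt x != k -> src x != k -> th' (ar' x) = back_F1 x.
Proof. exact: (ceval_arr (bad := bad) _ back_F1t). Qed.

Lemma back_mu_F2 b a : src b == k -> tgt a == k -> th' (mu_F2 K k b a) = ar b * ar a.
Proof.
move=> sb ta; have h : (src b == k) && (tgt a == k) by rewrite sb ta.
rewrite /mu_F2 (thruT h) back_arr //=; first exact: noloop.
exact: in_not_src.
Qed.

Lemma back_arr2 a b : tgt a == k -> src b == k ->
  th' (ar' (inl a) * ar' (inl b)) = - rcan b (r a).
Proof.
move=> ta sb; rewrite (ceval_arr2 (bad := bad) _ back_F2t) /=.
- by rewrite ta sb.
- by rewrite /incident ta orbT sb (eqP ta) (eqP sb).
- by rewrite /incident ta orbT.
Qed.

Lemma back_th u v x : u != k -> v != k -> ty u v x -> th' (th x) = x.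
Proof.
apply: (good_ind (bad := bad) noloop (S := fun u v x => th' (th x) = x)).
- by move=> _ _; rewrite !ceval0.
- by move=> _ _ y z hy hz; rewrite !cevalD hy hz.
- by move=> _ _ c y hy; rewrite !cevalZ hy.
- by move=> w wk; rewrite !ceval_idem.
- move=> a w y ta sa wk yt hy; rewrite (thM2 ta sa wk (typed_arr K a) yt).
  rewrite (ceval_arr (bad := bad) _ (@mu_F1t K V Q k) ta sa).
  have at' := mu_F1t K ta sa.
  rewrite (thM3 ta sa wk at' (th_typed2 sa wk yt)) hy back_arr //= /incident;
    by rewrite (negbTE (sa : src a != k)) (negbTE (ta : tgt a != k)).
- move=> b a w y tb ba bb sa wk yt hy.
  have ta : tgt a == k by rewrite -ba.
  have bat := typedM E (typed_arr K b) (typed_arr K a).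
  rewrite (thM2 tb sa wk bat yt) th_arr2 //.
  rewrite (thM3 tb sa wk (mu_F2t K ba bb) (th_typed2 sa wk yt)) hy.
  by rewrite back_mu_F2.
Qed.

Lemma coh_mu_pre_back (X : Type) (G : X -> V -> int) : coh e' (jid r') G ->
  coh e (jid r) (fun a v => mut_step (out_count Q' k) (in_count Q' k) k (G a) v).
Proof.
have rr a : in_rad 1 (r a) by apply: in_radW (Wr (a := a)).
have rt a := der_typed a W.
have mixed (i : I) (j : J) : rcan (val j) (r (val i)) = lcan (val i) (r (val j)) by exact: der_mixed.
apply: (@coh_half K V Q' Q k nl' r' r _ _ _ back_F1 back_F2
  _ _ _ _ (fun i => back_als (val i)) (fun j => back_bes (val j))).
- by move=> a; exact: der_typed.
- exact: mu_der_rad.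
- by move=> i j; exact: der_mixed.
- exact: back_F1t.
- exact: back_F2t.
- exact: back_F1r.
- exact: back_F2r.
- move=> i; have [j ->] := mu_tgt_k (valP i); rewrite /= /incident (valP j) /=.
  by apply: typedN; have := typed_arr K (val j); rewrite (eqP (valP j)).
- move=> j; have [i ->] := mu_src_k (valP j); rewrite /= /incident (valP i) orbT.
  by have := typed_arr K (val i); rewrite (eqP (valP i)).
- move=> i' j'; rewrite /gam; have [j ->] := mu_tgt_k (valP i').
  have [i ->] := mu_src_k (valP j'); rewrite mu_der_out ?(valP j) // raddf_sum.
  rewrite (bigD1 i) //= big1 => [|i1 ni]; last first.
    rewrite rcan_arr inl_eqE; case: eqP => // ii; case/eqP: ni; exact: val_inj.
  rewrite addr0 rcan_arr eqxx.
  have Ft := mu_F2t K (b := val j) (a := val i).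
  have jk := eqP (valP j); have ik := eqP (valP i).
  have -> : mu_F2 K k (val j) (val i) * e' (tgt (inl (val i) : arrow Q')) =
      mu_F2 K k (val j) (val i).
    rewrite (_ : tgt (inl (val i) : arrow Q') = src (val i)).
      have Ft' := Ft k (etrans jk (esym ik)) (valP j).
      exact: (typedr E' Ft').
    by rewrite /= /incident (valP i) orbT.
  rewrite back_mu_F2 ?(valP i) ?(valP j) // mulNr addNr; exact: idl0.
- move=> i'; have [j ->] := mu_tgt_k (valP i').
  rewrite (sum_out_mu (fun x => back_bes x * th' (ar' x * ar' (inl (val j))))) /=.
  under eq_bigr => i _ do rewrite back_arr2 ?(valP i) ?(valP j) // mulrN.
  rewrite sumrN; apply: idlN.
  have := r_outE rt rr mixed j; rewrite /gam => <-; exact: (idl_gen r).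
- move=> j'; have [i ->] := mu_src_k (valP j').
  rewrite (sum_in_mu (fun x => th' (ar' (inl (val i)) * ar' x) * back_als x)) /=.
  under eq_bigr => j _ do rewrite back_arr2 ?(valP i) ?(valP j) // mulrNN.
  have := r_inE rt rr i; rewrite /gam => <-; exact: (idl_gen r).
- move=> [a|p] sx tx.
    have [sa ta] := mu_good_inl sx tx.
    by rewrite mu_der_good // (back_th sa ta (rt a)); exact: (idl_gen r).
  have -> : p = Sub ((val p).1, (val p).2) (valP p).
    by apply: val_inj => /=; case: (val p).
  have /andP[sb ta] := valP p.
  rewrite mu_der_thru cevalD back_arr2 // (back_th (in_not_src noloop ta) (noloop sb)
    (r_typed_in ta sb)) subrr; exact: idl0.
- move=> u v x uk vk xt; exists (th x); first exact: th_typed2.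
  by rewrite (back_th uk vk xt) subrr; exact: idl0.
- move=> v y vk yt.
  exists (fun j' : out_arrow Q' k => if val j' is inl a then lcan a y else 0) => [j'|].
    have [i ->] := mu_src_k (valP j'); rewrite /= /incident (valP i) orbT.
    by apply: lcan_typed; rewrite (eqP (valP i)).
  rewrite (sum_out_mu (fun x => back_bes x * (if x is inl a then lcan a y else 0))).
  by rewrite [LHS](in_arrow_split yt (typed_rad1 _ yt)) 1?eq_sym.
- move=> u y uk yt.
  exists (fun i' : in_arrow Q' k => if val i' is inl b then - rcan b y else 0) => [i'|].
    have [j ->] := mu_tgt_k (valP i'); rewrite /= /incident (valP j) /=.
    by apply/typedN/rcan_typed; rewrite (eqP (valP j)).
  rewrite (sum_in_mu (fun x => (if x is inl b then - rcan b y else 0) * back_als x)).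
  rewrite [LHS](out_arrow_split yt (typed_rad1 uk yt)); apply: eq_bigr => j _.
  by rewrite /= mulrNN.
Qed.

Lemma card_intE (T : finType) (P : pred T) :
  (#|[set x | P x]|)%:Z = \sum_x (P x)%:R :> int.
Proof.
rewrite -sum1dep_card -(natz (\sum_(x | P x) 1)%N) natr_sum big_mkcond /=.
by apply: eq_bigr => x _; case: (P x).
Qed.

Lemma out_countE v : out_count Q k v = (narrows Q k v)%:Z.
Proof.
rewrite /out_count /narrows !card_intE.
rewrite (sum_sig (fun b : arrow Q => src b == k) (fun b => (tgt b == v)%:R)).
by rewrite big_mkcond; apply: eq_bigr => b _; case: (src b == k).
Qed.

Lemma in_countE v : in_count Q k v = (narrows Q v k)%:Z.
Proof.
rewrite /in_count /narrows !card_intE.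
rewrite (sum_sig (fun b : arrow Q => tgt b == k) (fun b => (src b == v)%:R)).
by rewrite big_mkcond; apply: eq_bigr => b _; rewrite andbC; case: (tgt b == k).
Qed.

Lemma out_count_mu v : out_count Q' k v = (narrows Q v k)%:Z.
Proof.
rewrite -in_countE /out_count /in_count !card_intE.
rewrite (sum_out_mu (fun x => (tgt x == v)%:R)); apply: eq_bigr => i _.
by rewrite /= /incident (valP i) orbT.
Qed.

Lemma in_count_mu v : in_count Q' k v = (narrows Q k v)%:Z.
Proof.
rewrite -out_countE /out_count /in_count !card_intE.
rewrite (sum_in_mu (fun x => (src x == v)%:R)); apply: eq_bigr => i _.
by rewrite /= /incident (valP i).
Qed.

End MuPreStep.

(** * Algebra maps fixing the idempotents *)

Section PathAlgebraMaps.
Context (K : fieldType) {V : finType} (P P' : quiver V).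
Local Notation A := (path_algebra K P).
Local Notation A' := (path_algebra K P').
Local Notation e := (idem K P).
Local Notation e' := (idem K P').

Lemma pa_arr_ind (S : A -> Prop) :
  S 0 -> (forall x y, S x -> S y -> S (x + y)) ->
  (forall c x, S x -> S (c *: x)) ->
  (forall v, S (e v)) -> (forall a x, S x -> S (arr K a * x)) -> forall x, S x.
Proof.
move=> S0 SD SZ Se Sa; apply: pa_ind => // p; rewrite pth_path_of.
move: (ptgt p) (word p) => v s; elim: s v => [|a s IH] v.
  by rewrite path_of_nil.
by rewrite path_of_cons; case: eqP => _; [apply: Sa | exact: S0].
Qed.

Record pa_hom (f : A -> A') : Prop := PaHom {
  pa_homD : forall x y, f (x + y) = f x + f y;
  pa_homZ : forall c x, f (c *: x) = c *: f x;
  pa_homM : forall x y, f (x * y) = f x * f y;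
  pa_hom_idem : forall v, f (e v) = e' v }.

Lemma pa_hom0 f : pa_hom f -> f 0 = 0.
Proof. by move=> fh; rewrite -(scale0r 0) (pa_homZ fh) scale0r. Qed.

Lemma pa_homB f : pa_hom f -> zmod_morphism f.
Proof.
by move=> fh x y; rewrite (pa_homD fh) -scaleN1r (pa_homZ fh) scaleN1r.
Qed.

Lemma pa_hom_sum f (T : Type) (s : seq T) (D : pred T) F : pa_hom f ->
  f (\sum_(i <- s | D i) F i) = \sum_(i <- s | D i) f (F i).
Proof. by move=> fh; apply: big_morph; [exact: pa_homD | exact: pa_hom0]. Qed.

Lemma pa_hom_typed f u v x : pa_hom f -> typed e u v x -> typed e' u v (f x).
Proof.
by move=> fh xt; rewrite /typed -!(pa_hom_idem fh) -!(pa_homM fh) xt.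
Qed.

Lemma pa_hom_idl (r : arrow P -> A) (r' : arrow P' -> A') f : pa_hom f ->
  (forall a, idl r' (f (r a))) -> forall x, idl r x -> idl r' (f x).
Proof.
move=> fh fr x [s ->]; rewrite (pa_hom_sum _ _ _ fh); apply: idl_sum => t _.
by rewrite !(pa_homM fh); apply/idlMr/idlMl.
Qed.

Lemma pa_hom_rad f N x : pa_hom f -> (forall a, in_rad 1 (f (arr K a))) ->
  in_rad N x -> in_rad N (f x).
Proof.
move=> fh fa; move: x; apply: in_rad_ind.
- by rewrite (pa_hom0 fh); exact: in_rad0.
- by move=> x y; rewrite (pa_homD fh); exact: in_radD.
- by move=> c x; rewrite (pa_homZ fh); exact: in_radZ.
move=> p /in_radW; apply; rewrite pth_path_of.
move: (ptgt p) (word p) => v s; elim: s v => [|a s IH] v //.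
rewrite path_of_cons; case: eqP => _ /=; last by rewrite (pa_hom0 fh); exact: in_rad0.
by rewrite (pa_homM fh) -add1n; exact: in_radM.
Qed.

Lemma coh_hom (r : arrow P -> A) (r' : arrow P' -> A') f : pa_hom f ->
  (forall a, idl r' (f (r a))) ->
  (forall N, exists M, forall x, in_rad M x -> in_rad N (f x)) ->
  (forall u v x', typed e' u v x' -> exists2 x, typed e u v x & idl r' (x' - f x)) ->
  forall (X : Type) (G : X -> V -> int), coh e (jid r) G -> coh e' (jid r') G.
Proof.
move=> fh fr fN fs.
pose F : {additive A -> A'} := HB.pack f (GRing.isZmodMorphism.Build A A' f (pa_homB fh)).
apply: (coh_map (@idemE K V P) (@idemE K V P') (phi := F)).
- by move=> u v x; exact: pa_hom_typed.
- by move=> u v w x y _ _; exact: pa_homM.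
- move=> N; have [M fM] := fN N; exists M => x [i [m [hi hm ->]]].
  rewrite [F _](pa_homD fh); exists (f i), (f m); split=> //; last exact: fM.
  exact: pa_hom_idl hi.
- by move=> N u v x' /fs[x xt xE]; exists x => //; exact: idl_jid.
Qed.

End PathAlgebraMaps.

Section PathAlgebraIso.
Context (K : fieldType) {V : finType} (P P' : quiver V).
Local Notation A := (path_algebra K P).
Local Notation A' := (path_algebra K P').
Local Notation e := (idem K P).
Local Notation e' := (idem K P').

Lemma coh_iso (r : arrow P -> A) (r' : arrow P' -> A') (f : A -> A') (g : A' -> A) :
  pa_hom f -> pa_hom g -> cancel g f -> (forall a, idl r' (f (r a))) ->
  (forall a, in_rad 1 (f (arr K a))) ->
  forall (X : Type) (G : X -> V -> int), coh e (jid r) G -> coh e' (jid r') G.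
Proof.
move=> fh gh gK fr fa; apply: (coh_hom fh fr) => [N|u v x' xt].
  by exists N => x; exact: pa_hom_rad.
by exists (g x'); [exact: (pa_hom_typed gh) | rewrite gK subrr; exact: idl0].
Qed.

Lemma pa_hom_can (f : A -> A') (g : A' -> A) :
  pa_hom f -> cancel f g -> cancel g f -> pa_hom g.
Proof.
move=> fh fK gK; split=> [x y|c x|x y|v]; apply: (can_inj fK).
- by rewrite (pa_homD fh) !gK.
- by rewrite (pa_homZ fh) !gK.
- by rewrite (pa_homM fh) !gK.
- by rewrite (pa_hom_idem fh) gK.
Qed.

Section HomOfArrows.
Variable F : arrow P -> A'.
Hypothesis Ft : forall a, typed e' (tgt a) (src a) (F a).

(** With no bad vertex, [ceval] is the algebra homomorphism determined by the images of the
    arrows. *)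
Definition arrow_hom : A -> A' := ceval pred0 F (fun _ _ => 0).

Let Ft1 b : ~~ pred0 (tgt b) -> ~~ pred0 (src b) -> typed e' (tgt b) (src b) (F b).
Proof. by []. Qed.

Lemma arrow_hom_arr a : arrow_hom (arr K a) = F a.
Proof. exact: (ceval_arr (bad := pred0) _ Ft1). Qed.

Lemma arrow_homP : pa_hom arrow_hom.
Proof.
have E := @idemE K V P; have E' := @idemE K V P'.
have ht u v x : typed e u v x -> typed e' u v (arrow_hom x).
  by apply: (ceval_typed (bad := pred0) _ Ft1).
split=> [||x y|]; [exact: cevalD | exact: cevalZ | | exact: ceval_idem].
move: x y; apply: pa_ind => [y|x x' hx hx' y|c x hx y|p].
- by rewrite mul0r /arrow_hom ceval0 mul0r.
- by rewrite mulrDl /arrow_hom !cevalD [LHS](congr2 _ (hx y) (hx' y)) -mulrDl.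
- by rewrite -pscalerAl /arrow_hom !cevalZ [X in _ *: X](hx y) pscalerAl.
apply: pa_ind => [|y y' hy hy'|c y hy|q].
- by rewrite mulr0 /arrow_hom ceval0 mulr0.
- by rewrite mulrDr /arrow_hom !cevalD [LHS](congr2 _ hy hy') -mulrDr.
- by rewrite -pscalerAr /arrow_hom !cevalZ [X in _ *: X]hy pscalerAr.
have [pq|npq] := eqVneq (psrc p) (ptgt q).
  apply: (cevalM (bad := pred0) _ Ft1 _ (u := ptgt p) (v := psrc p) (w := psrc q)) => //.
    exact: typed_pth.
  by rewrite pq; exact: typed_pth.
have -> : pth K p * pth K q = 0.
  rewrite -[pth K p](typedr E (typed_pth K p)) -[pth K q](typedl E (typed_pth K q)).
  by rewrite !mulrA -(mulrA _ (e _) (e _)) E (negbTE npq) mulr0 mul0r.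
rewrite -[arrow_hom (pth K p)](typedr E' (ht _ _ _ (typed_pth K p))).
rewrite -[arrow_hom (pth K q)](typedl E' (ht _ _ _ (typed_pth K q))).
by rewrite !mulrA -(mulrA _ (e' _) (e' _)) E' (negbTE npq) mulr0 mul0r /arrow_hom ceval0.
Qed.

End HomOfArrows.

End PathAlgebraIso.

(** * The chain rule for cyclic derivatives *)

Section ChainRule.
Context (K : fieldType) {V : finType} (P : quiver V).
Local Notation A := (path_algebra K P).
Local Notation e := (idem K P).
Local Notation ar := (arr K).

(* The sum of [w * z * u] over the factorizations [u b w] of the word. *)
Fixpoint cder_word (b : arrow P) (s : seq (arrow P)) (z : A) : A :=
  if s is a :: s' then
    (if a == b then path_of K (src a) s' * z * e (tgt a) else 0) +
    cder_word b s' (z * ar a)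
  else 0.

Definition cder b (z : A) : A -> A := palift (fun p => cder_word b (word p) z).

HB.instance Definition _ b z :=
  GRing.Linear.copy (cder b z) (palift (fun p => cder_word b (word p) z)).

Let E := @idemE K V P.

Lemma cder0 b z : cder b z 0 = 0. Proof. exact: raddf0. Qed.
Lemma cderD b z x y : cder b z (x + y) = cder b z x + cder b z y.
Proof. exact: raddfD. Qed.
Lemma cderZ b z c x : cder b z (c *: x) = c *: cder b z x.
Proof. exact: linearZ. Qed.

Lemma cder_path_of b z v s : is_qpath (v, s) ->
  cder b z (path_of K v s) = cder_word b s z.
Proof. by move=> h; rewrite (path_of_qpath K h) /cder paliftE. Qed.

Lemma cder_wordD b s z z' :
  cder_word b s (z + z') = cder_word b s z + cder_word b s z'.
Proof.
elim: s z z' => [|a s IH] z z' /=; first by rewrite addr0.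
rewrite mulrDl IH addrACA; congr (_ + _); case: eqP => _; last by rewrite addr0.
by rewrite mulrDr mulrDl.
Qed.

Lemma cder_wordZ b s c z : cder_word b s (c *: z) = c *: cder_word b s z.
Proof.
elim: s z => [|a s IH] z /=; first by rewrite scaler0.
rewrite -pscalerAl IH scalerDr; congr (_ + _); case: eqP => _; last by rewrite scaler0.
by rewrite -pscalerAr -pscalerAl.
Qed.

Lemma cderDr b z z' x : cder b (z + z') x = cder b z x + cder b z' x.
Proof.
move: x; apply: pa_ind => [|x y hx hy|c x hx|p]; rewrite ?cder0 ?addr0 //.
- by rewrite !cderD hx hy addrACA.
- by rewrite !cderZ hx scalerDr.
- by rewrite /cder !paliftE cder_wordD.
Qed.

Lemma cderZr b c z x : cder b (c *: z) x = c *: cder b z x.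
Proof.
move: x; apply: pa_ind => [|x y hx hy|d x hx|p]; rewrite ?cder0 ?scaler0 //.
- by rewrite !cderD hx hy scalerDr.
- by rewrite !cderZ hx !scalerA mulrC.
- by rewrite /cder !paliftE cder_wordZ.
Qed.

Lemma cder0r b x : cder b 0 x = 0.
Proof. by have := cderZr b 0 0 x; rewrite !scale0r. Qed.

Lemma cder_idem b z v : cder b z (e v) = 0.
Proof. by rewrite -path_of_nil cder_path_of. Qed.

Lemma cder_arr b z a :
  cder b z (ar a) = if a == b then e (src a) * z * e (tgt a) else 0.
Proof.
by rewrite cder_path_of ?is_qpath1 //= addr0 path_of_nil.
Qed.

Lemma cder_pthr b z p : cder b z (pth K p) = cder b (z * e (ptgt p)) (pth K p).
Proof.
rewrite /cder !paliftE; case: p => -[v [|a s]] //= h; have /andP[/eqP av _] := h.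
rewrite /ptgt /= in av *; subst v; rewrite -!mulrA E eqxx.
by rewrite -{1}(typedl E (typed_arr K a)).
Qed.

Lemma cder_idemM b z v y : cder b z (e v * y) = cder b (z * e v) y.
Proof.
move: y; apply: pa_ind => [|x y hx hy|d x hx|p]; rewrite ?mulr0 ?cder0 //.
- by rewrite mulrDr !cderD hx hy.
- by rewrite -pscalerAr !cderZ hx.
rewrite idem_pthl [RHS]cder_pthr -mulrA E; case: eqP => [->|_].
  by rewrite -cder_pthr.
by rewrite mulr0 cder0r cder0.
Qed.

Lemma cder_arrM b z a y :
  cder b z (ar a * y) = cder b (y * z) (ar a) + cder b (z * ar a) y.
Proof.
move: y; apply: pa_ind => [|x y hx hy|d x hx|p].
- by rewrite mulr0 mul0r !cder0 cder0r addr0.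
- by rewrite mulrDr mulrDl !cderD cderDr hx hy addrACA.
- by rewrite -pscalerAr -pscalerAl !cderZ cderZr hx scalerDr.
have [pa|npa] := eqVneq (ptgt p) (src a).
  have h : is_qpath (src a, word p).
    by rewrite -pa; case: p {pa} => -[v s].
  rewrite pth_path_of pa -[ar a * _]/(ar a * path_of K (src a) (word p)).
  have -> : ar a * path_of K (src a) (word p) = path_of K (tgt a) (a :: word p).
    by rewrite path_of_cons eqxx.
  rewrite (cder_path_of _ _ h) cder_path_of.
    by rewrite /= cder_arr; case: eqP => // _; rewrite !mulrA (typedl E (typed_path_of K _ _)).
  rewrite -cat1s is_qpath_cat /= h andbT; exact: is_qpath1.
have na : (src a == ptgt p) = false by rewrite eq_sym; exact: negbTE.
have -> : ar a * pth K p = 0.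
  by rewrite -[ar a](typedr E (typed_arr K a)) -mulrA idem_pthl na mulr0.
rewrite cder0 cder_arr mulrA idem_pthl na !mul0r.
rewrite cder_pthr -mulrA -{1}[ar a](typedr E (typed_arr K a)) -mulrA E na.
by rewrite !mulr0 cder0r; case: eqP; rewrite addr0.
Qed.

(** The Leibniz rule on a circle: when the marked letter lies in one factor, the other factor is
    carried around into the inserted element. The argument z of [cder] exists for this. *)
Lemma cderM b z x y : cder b z (x * y) = cder b (y * z) x + cder b (z * x) y.
Proof.
move: x z; apply: pa_arr_ind => [z|x x' hx hx' z|c x hx z|v z|a x hx z].
- by rewrite mul0r mulr0 cder0r !cder0 addr0.
- by rewrite mulrDl mulrDr !cderD hx hx' cderDr addrACA.
- by rewrite -pscalerAl -pscalerAr !cderZ hx cderZr scalerDr.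
- by rewrite cder_idem add0r cder_idemM.
by rewrite -mulrA !cder_arrM hx !mulrA addrA.
Qed.

Lemma cder_typed_arg b z u v x : typed e u v x ->
  cder b z x = cder b (e v * z * e u) x.
Proof.
move=> xt; rewrite -[in LHS]xt !cderM !cder_idem !(addr0, add0r).
by rewrite -mulrA.
Qed.

(** A constant family of relations makes [idl] the two-sided ideal generated by z. The induction on
    x moves letters into the inserted element, hence the generalization to [z * y]. *)
Lemma cder_idl b z x : idl (fun _ : arrow P => z) (cder b z x).
Proof.
suff h y : idl (fun _ : arrow P => z) (cder b (z * y) x).
  by have := h 1; rewrite mulr1.
move: x y; apply: pa_arr_ind => [y|x x' hx hx' y|c x hx y|v y|a x hx y].
- by rewrite cder0; exact: idl0.
- by rewrite cderD; exact: idlD.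
- by rewrite cderZ; exact: idlZ.
- by rewrite cder_idem; exact: idl0.
rewrite cder_arrM; apply: idlD; last by rewrite -mulrA.
rewrite cder_arr; case: eqP => _; last exact: idl0.
rewrite !mulrA; do 2 apply: idlMr; apply: idlMl; exact: (idl_gen (fun _ => z) b).
Qed.

(** A rotation of a closed word is the part after the marked letter followed by the part before it;
    the letters already passed, seen as a path, form the inserted element. *)
Lemma czip_cder b acc s v : is_qpath (v, acc ++ s) ->
  last v (map (@src V P) (acc ++ s)) = v ->
  czip (dhead K b) acc s = cder_word b s (path_of K v acc).
Proof.
elim: s acc => [|a s IH] acc //= h lv.
rewrite -cat_rcons in h lv.
rewrite (IH _ h lv); congr (_ + _).
  have := h; rewrite is_qpath_cat => /andP[h1 h2].
  rewrite map_rcons last_rcons in h2; rewrite map_cat last_cat map_rcons last_rcons in lv.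
  case: eqP => // ab; subst a; rewrite path_of_cat lv -mulrA.
  have := h1; rewrite -cats1 is_qpath_cat /= => /andP[_ /andP[/eqP lt _]]; rewrite /= in lt.
  by have tt := typed_path_of K v acc; rewrite -lt in tt; rewrite (typedr E tt).
have := h; rewrite is_qpath_cat => /andP[h1 _].
have := h1; rewrite -cats1 is_qpath_cat /= => /andP[_ /andP[/eqP lt _]]; rewrite /= in lt.
by rewrite cats1 path_of_rcons lt eqxx.
Qed.

Lemma der_potential_of_path b x :
  cyclic_derivative b (potential_of_path x) = cder b 1 x.
Proof.
move: x; apply: pa_ind => [|x y hx hy|c x hx|p].
- by rewrite cder0 /potential_of_path raddf0 der0.
- by rewrite cderD -hx -hy -derD /potential_of_path raddfD.
- by rewrite cderZ -hx -derZ /potential_of_path linearZ.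
rewrite [potential_of_path _]fgliftU1 der_cyc.
have [pc|npc] := eqVneq (psrc p) (ptgt p); last first.
  rewrite (cder_typed_arg _ _ (typed_pth K p)) mulr1 E (negbTE npc) cder0r.
  rewrite /is_cycle; case: ifP => // pcy.
  case/eqP: npc; case: p pcy => -[v [|a s]] //= h.
  have /andP[/eqP hv _] := h; rewrite rcons_path => /andP[_ /eqP]; rewrite /psrc /ptgt /word /=.
  by rewrite last_map => ->.
rewrite [RHS]paliftE; case: p pc => -[v [|a s]] h pc //=.
rewrite -[in X in is_cycle X]/(a :: s).
have hc : is_cycle (a :: s).
  rewrite is_cycleP; have := h; rewrite -cat1s is_qpath_cat => /andP[h1 h2].
  have av : tgt a = v by have /andP[/eqP] := h1.
  by rewrite h2 av; move: pc; rewrite /psrc /ptgt /word /= => ->; rewrite eqxx.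
rewrite -[word _]/(a :: s) hc /dword csum_czip.
rewrite -[RHS]/(cder_word b (a :: s) 1).
have lv : last v (map (@src V P) (a :: s)) = v by exact: pc.
rewrite (@czip_cder b [::] (a :: s) v) // path_of_nil.
have := cder_pthr b 1 (QPath h); rewrite mul1r /cder !paliftE => <-.
by [].
Qed.

Lemma path_of_potentialK (W : potential K P) :
  potential_of_path (path_of_potential W) = W.
Proof.
apply: (pot_ind (S := fun W => potential_of_path (path_of_potential W) = W)).
- by rewrite /path_of_potential raddf0 /potential_of_path raddf0.
- by move=> x y hx hy; rewrite -{2}hx -{2}hy /path_of_potential raddfD /potential_of_path raddfD.
- by move=> c x hx; rewrite -{2}hx /path_of_potential linearZ /potential_of_path linearZ.
move=> c _; rewrite -cyc_nword [path_of_potential _]fgliftU1 cyc_nword.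
have := nword_cycle c; case: (nword c) => [|a s] // cs.
have h : is_qpath (tgt a, a :: s).
  rewrite is_cycleP in cs; have /andP[h1 _] := cs.
  by rewrite -cat1s is_qpath_cat is_qpath1.
by rewrite (path_of_qpath K h) [potential_of_path _]fgliftU1.
Qed.

End ChainRule.

Section ChainRuleHom.
Context (K : fieldType) {V : finType} (P P' : quiver V).
Local Notation A := (path_algebra K P).
Local Notation A' := (path_algebra K P').
Variable f : A -> A'.
Hypothesis fh : pa_hom f.

(** By induction on x, one arrow at a time: the Leibniz rule gives the same inner terms on both
    sides, and the new term is the derivative of the image of the arrow with the image of the rest
    inserted. *)
Lemma cder_hom b z x : cder b (f z) (f x) =
  \sum_a cder b (f (cder a z x)) (f (arr K a)).
Proof.
move: x z; apply: pa_arr_ind => [z|x x' hx hx' z|c x hx z|v z|a x hx z].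
- by rewrite (pa_hom0 fh) cder0 big1 // => a _; rewrite cder0 (pa_hom0 fh) cder0r.
- rewrite (pa_homD fh) cderD hx hx' -big_split; apply: eq_bigr => a _ /=.
  by rewrite cderD (pa_homD fh) cderDr.
- rewrite (pa_homZ fh) cderZ hx scaler_sumr; apply: eq_bigr => a _ /=.
  by rewrite cderZ (pa_homZ fh) cderZr.
- rewrite (pa_hom_idem fh) cder_idem big1 // => a _.
  by rewrite cder_idem (pa_hom0 fh) cder0r.
under eq_bigr => a' _ do rewrite cder_arrM (pa_homD fh) cderDr.
rewrite big_split /= -hx (pa_homM fh) cderM -!(pa_homM fh); congr (_ + _).
rewrite (bigD1 a) //= big1 ?addr0 => [|a' /negbTE na]; last first.
  by rewrite cder_arr eq_sym na (pa_hom0 fh) cder0r.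
rewrite cder_arr eqxx; move: (x * z) => y.
rewrite 2![in RHS](pa_homM fh) !(pa_hom_idem fh); exact: cder_typed_arg (pa_hom_typed fh (typed_arr K a)).
Qed.

Lemma pa_hom1 : f 1 = 1.
Proof.
rewrite [1 in LHS](_ : _ = \sum_v idem K P v) // (pa_hom_sum _ _ _ fh).
by apply: eq_bigr => v _; exact: pa_hom_idem.
Qed.

(** By the chain rule, a derivative of [f x] lies in the ideal generated by the images under f of
    the derivatives of x; g brings it back. *)
Lemma der_hom_idl (g : A' -> A) x b : pa_hom g -> cancel f g ->
  idl (fun a => cyclic_derivative a (potential_of_path x))
      (g (cyclic_derivative b (potential_of_path (f x)))).
Proof.
move=> gh fK; rewrite der_potential_of_path -pa_hom1 cder_hom.
rewrite (pa_hom_sum _ _ _ gh); apply: idl_sum => a _.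
have [s ->] := cder_idl b (f (cder a 1 x)) (f (arr K a)).
rewrite (pa_hom_sum _ _ _ gh); apply: idl_sum => t _.
rewrite !(pa_homM gh) fK -der_potential_of_path; apply/idlMr/idlMl.
exact: (idl_gen (fun a => cyclic_derivative a (potential_of_path x))).
Qed.

End ChainRuleHom.

(** * Reduction *)

Section ArrowMap.
Context (K : fieldType) {V : finType} (P U : quiver V) (h : arrow P -> arrow U).
Hypothesis hsrc : forall a, src (h a) = src a.
Hypothesis htgt : forall a, tgt (h a) = tgt a.
Hypothesis hinj : injective h.

Definition arrow_map : path_algebra K P -> path_algebra K U :=
  arrow_hom (fun a => arr K (h a)).

Lemma arrow_map_typed a : typed (idem K U) (tgt a) (src a) (arr K (h a)).
Proof. by rewrite -hsrc -htgt; exact: typed_arr. Qed.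

Lemma arrow_mapP : pa_hom arrow_map.
Proof. exact: arrow_homP arrow_map_typed. Qed.

Lemma arrow_map_arr a : arrow_map (arr K a) = arr K (h a).
Proof. exact: arrow_hom_arr arrow_map_typed a. Qed.

Lemma arrow_map_path_of v s : arrow_map (path_of K v s) = path_of K v (map h s).
Proof.
elim: s v => [|a s IH] v /=; first by rewrite !path_of_nil (pa_hom_idem arrow_mapP).
rewrite !path_of_cons htgt hsrc; case: eqP => _; last exact: pa_hom0 arrow_mapP.
by rewrite (pa_homM arrow_mapP) IH arrow_map_arr.
Qed.

Lemma is_cycle_map s : is_cycle (map h s) = is_cycle s.
Proof.
case: s => [|a s] //=; rewrite /is_cycle /= -map_rcons; move: (rcons s a) => t.
elim: t a => [|b t IH] a //=; by rewrite IH /composable hsrc htgt.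
Qed.

Lemma der_potential_map a W :
  cyclic_derivative (h a) (potential_map h W) = arrow_map (cyclic_derivative a W).
Proof.
apply: (pot_ind (S := fun W => cyclic_derivative (h a) (potential_map h W) =
  arrow_map (cyclic_derivative a W))) => [|x y hx hy|c x hx|c _].
- by rewrite /potential_map raddf0 !der0 (pa_hom0 arrow_mapP).
- by rewrite derD (pa_homD arrow_mapP) -hx -hy -derD /potential_map raddfD.
- by rewrite derZ (pa_homZ arrow_mapP) -hx -derZ /potential_map linearZ.
rewrite -cyc_nword [potential_map _ _]fgliftU1 cyc_nword !der_cyc is_cycle_map nword_cycle.
rewrite /dword /csum (pa_hom_sum _ _ _ arrow_mapP) size_map; apply: eq_bigr => i _.
rewrite -map_rot; case: (rot i _) => [|b s] /=; first by rewrite (pa_hom0 arrow_mapP).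
rewrite (inj_eq hinj); case: eqP => _; last by rewrite (pa_hom0 arrow_mapP).
by rewrite arrow_map_path_of hsrc.
Qed.

Lemma der_potential_map0 (b : arrow U) (W : potential K P) : (forall a, h a != b) ->
  cyclic_derivative b (potential_map h W) = 0.
Proof.
move=> hb; apply: (pot_ind (S := fun W => cyclic_derivative b (potential_map h W) = 0))
  => [|x y hx hy|c x hx|c _].
- by rewrite /potential_map raddf0 der0.
- by rewrite /potential_map raddfD derD [X in X + _]hx [X in _ + X]hy addr0.
- by rewrite /potential_map linearZ derZ [X in _ *: X]hx scaler0.
rewrite -cyc_nword [potential_map _ _]fgliftU1 der_cyc is_cycle_map nword_cycle.
rewrite /dword /csum big1 // => i _; rewrite -map_rot; case: (rot _ _) => [|a s] //=.
by rewrite (negbTE (hb a)).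
Qed.

End ArrowMap.

(** * Consequences of the absence of loops *)

Section LoopFree.
Context (K : fieldType) {V : finType}.
Implicit Types (P : quiver V).

Lemma loop_free_size P (c : necklace P) : loop_free P -> (1 < size (nword c))%N.
Proof.
move=> lf; have := nword_cycle c; case: (nword c) => [|a [|b s]] //.
by rewrite /is_cycle /= /composable andbT => /eqP ac; have := lf a; rewrite ac eqxx.
Qed.

Lemma two_cycle_free_size P (c : necklace P) : loop_free P -> two_cycle_free P ->
  (2 < size (nword c))%N.
Proof.
move=> lf tf; have := loop_free_size c lf; have := nword_cycle c.
case: (nword c) => [|a [|b [|d s]]] //.
rewrite /is_cycle /= /composable andbT => /andP[/eqP ab /eqP ba] _.
have [eab|nab] := eqVneq a b; last by have := tf a b nab; rewrite ab ba !eqxx.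
by have := lf a; rewrite ab eab eqxx.
Qed.

Lemma typed_coeff P u v (x : path_algebra K P) p : typed (idem K P) u v x ->
  coeff p x != 0 -> ptgt p = u /\ psrc p = v.
Proof.
move: x; apply: (typed_ind (P := fun x => coeff p x != 0 -> ptgt p = u /\ psrc p = v)).
- by rewrite coeff0 eqxx.
- move=> x y hx hy; rewrite coeffD; have [->|/hx//] := eqVneq (coeff p x) 0.
  by rewrite add0r.
- by move=> c x hx; rewrite coeffZ mulf_eq0 negb_or => /andP[_ /hx].
by move=> q qu qv; rewrite coeffU mul1r; case: (q =P p) => [<-|_] //; rewrite eqxx.
Qed.

Lemma loop_free_rad2 P v (x : path_algebra K P) : loop_free P ->
  typed (idem K P) v v x -> in_rad 1 x -> in_rad 2 x.
Proof.
move=> lf xt xr p px; have [pt ps] := typed_coeff xt px.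
have := xr p px; case: p {px} pt ps => -[w [|a [|b s]]] // h.
rewrite /psrc /ptgt /word /= => wv sv _; have /andP[/eqP ta _] := h.
by have := lf a; rewrite sv ta [X in X == _]/= -wv eqxx.
Qed.

(** An algebra map fixing the idempotents may send a loop to an element with a scalar part, and so
    need not respect lengths. The image of an arrow between different vertices has no trivial
    path. *)
Lemma pa_hom_arr_rad P P' (f : path_algebra K P -> path_algebra K P') a :
  loop_free P -> pa_hom f -> in_rad 1 (f (arr K a)).
Proof.
move=> lf fh; apply: typed_rad1 (pa_hom_typed fh (typed_arr K a)).
by rewrite eq_sym; exact: lf.
Qed.

(** For a loop b of P', [g b] is a scalar multiple of an idempotent plus an element of length at
    least 1, hence at least 2 as P has no loops. Applying f would write b as a multiple of an
    idempotent plus paths of length at least 2. *)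
Lemma pa_iso_loop_free P P' (f : path_algebra K P -> path_algebra K P')
    (g : path_algebra K P' -> path_algebra K P) :
  pa_hom f -> pa_hom g -> cancel g f -> loop_free P -> loop_free P'.
Proof.
move=> fh gh gK lf b; apply/negP => /eqP sb.
have xt : typed (idem K P) (tgt b) (tgt b) (g (arr K b)).
  by have := pa_hom_typed gh (typed_arr K b); rewrite sb.
set x := g (arr K b) in xt.
have yr := rad1_split xt; set y := x - _ in yr.
have yt : typed (idem K P) (tgt b) (tgt b) y.
  by apply: typedB xt (typedZ _ (typed_idem (@idemE K V P) _)).
have fy : in_rad 2 (f y).
  apply: (pa_hom_rad fh) (loop_free_rad2 lf yt yr) => a; exact: pa_hom_arr_rad.
have : coeff (QPath (is_qpath1 b)) (arr K b) = coeff (QPath (is_qpath1 b)) (f y).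
  rewrite -{1}(gK (arr K b)) -/x -(subrK (scal (tgt b) x *: idem K P (tgt b)) x) -/y.
  rewrite (pa_homD fh) coeffD (pa_homZ fh) (pa_hom_idem fh) coeffZ coeffU.
  by rewrite [_ == _](_ : _ = false) ?mulr0 ?addr0 //; apply/eqP => /(congr1 (@word _ _)).
rewrite arrE coeffU eqxx mulr1 => c1.
by have := fy (QPath (is_qpath1 b)); rewrite -c1 oner_eq0 => /(_ isT).
Qed.

(** A loop [ba] would come from a 2-cycle formed by a and b. *)
Lemma mu_pre_loop_free P k : loop_free P -> two_cycle_free P -> loop_free (mu_pre k P).
Proof.
move=> lf tf [a|p] /=; first by case: ifP => _; [rewrite eq_sym|]; exact: lf.
have /andP[/eqP s1 /eqP t2] := valP p.
have n12 : (val p).2 != (val p).1.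
  by apply: contraTneq (lf (val p).1) => e; rewrite s1 -e t2 eqxx.
by have := tf _ _ n12; rewrite s1 t2 eqxx andbT.
Qed.

End LoopFree.

(** * Removal of a trivial summand *)

Section DirectSum.
Context (K : fieldType) {V : finType} (S T : qp K V).
Local Notation P := (qp_quiver S).
Local Notation N := (qp_quiver T).
Local Notation U := (quiver_sum P N).
Local Notation eP := (idem K P).
Local Notation eU := (idem K U).
Local Notation derS := (fun a => cyclic_derivative a (qp_potential S)).
Local Notation derT := (fun a => cyclic_derivative a (qp_potential T)).
Local Notation derU := (fun a : arrow U => cyclic_derivative a (qp_potential (qp_sum S T))).
Hypothesis lf : loop_free U.
Hypothesis Ttriv : trivial_potential (qp_potential T).

Let hl (a : arrow P) : arrow U := inl a.
Let hr (b : arrow N) : arrow U := inr b.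
Local Notation iota := (@arrow_map K V P U hl).
Local Notation jota := (@arrow_map K V N U hr).
Let iotaP : pa_hom (iota) := @arrow_mapP K V P U hl (fun => erefl) (fun => erefl).
Let jotaP : pa_hom (jota) := @arrow_mapP K V N U hr (fun => erefl) (fun => erefl).
Let iota_arr a : iota (arr K a) = arr K (hl a) :=
  @arrow_map_arr K V P U hl (fun => erefl) (fun => erefl) a.
Let jota_arr a : jota (arr K a) = arr K (hr a) :=
  @arrow_map_arr K V N U hr (fun => erefl) (fun => erefl) a.

Definition kill_arrow (x : arrow U) : path_algebra K P :=
  match x with inl a => arr K a | inr _ => 0 end.

Lemma kill_typed x : typed eP (tgt x) (src x) (kill_arrow x).
Proof. by case: x => [a|b]; [exact: typed_arr | exact: typed0]. Qed.

Local Notation kill := (arrow_hom kill_arrow).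
Let killP : pa_hom kill := arrow_homP kill_typed.

Lemma killK : cancel (iota) kill.
Proof.
apply: pa_arr_ind => [|x y hx hy|c x hx|v|a x hx].
- by rewrite (pa_hom0 iotaP) (pa_hom0 killP).
- by rewrite (pa_homD iotaP) (pa_homD killP) hx hy.
- by rewrite (pa_homZ iotaP) (pa_homZ killP) hx.
- by rewrite (pa_hom_idem iotaP) (pa_hom_idem killP).
by rewrite (pa_homM iotaP) (pa_homM killP) hx iota_arr (arrow_hom_arr kill_typed).
Qed.

Lemma kill_jota x : in_rad 1 x -> kill (jota x) = 0.
Proof.
move: x; apply: in_rad_ind => [|x y hx hy|c x hx|p].
- by rewrite (pa_hom0 jotaP) (pa_hom0 killP).
- by rewrite (pa_homD jotaP) (pa_homD killP) hx hy addr0.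
- by rewrite (pa_homZ jotaP) (pa_homZ killP) hx scaler0.
rewrite pth_path_of; case: (word p) => [|a s] // _; rewrite path_of_cons.
case: eqP => _; last by rewrite (pa_hom0 jotaP) (pa_hom0 killP).
by rewrite (pa_homM jotaP) (pa_homM killP) jota_arr (arrow_hom_arr kill_typed) mul0r.
Qed.

Lemma der_sum_inl a : derU (inl a) = iota (derS a).
Proof.
rewrite /= derD [X in _ + X](der_potential_map0 (h := hr)) ?addr0 //.
by rewrite (der_potential_map (h := hl)) // => x y [].
Qed.

Lemma der_sum_inr b : derU (inr b) = jota (derT b).
Proof.
rewrite /= derD [X in X + _](der_potential_map0 (h := hl)) ?add0r //.
by rewrite (der_potential_map (h := hr)) // => x y [].
Qed.

Lemma summand_loop_free : loop_free P /\ loop_free N.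
Proof. by split=> a; [exact: (lf (inl a)) | exact: (lf (inr a))]. Qed.

(** Triviality makes b congruent to a combination of idempotents; multiplying by the idempotents at
    its two different ends kills the combination and keeps b. *)
Lemma trivial_arrow_idl b : idl derU (arr K (inr b : arrow U)).
Proof.
have [_ lN] := summand_loop_free.
have [c [s cE]] := Ttriv (arr K b).
have E := @idemE K V N; have bt := typed_arr K b.
have : idl derT (arr K b).
  rewrite -bt -[X in _ * X * _](subrK (\sum_v c v *: idem K N v)) cE.
  rewrite mulrDr mulrDl; set y := \sum_(t <- s) _.
  have -> : idem K N (tgt b) * (\sum_v c v *: idem K N v) * idem K N (src b) = 0.
    rewrite mulr_sumr mulr_suml big1 // => v _.
    rewrite -pscalerAr -pscalerAl E; case: eqP => [<-|_]; last by rewrite mul0r scaler0.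
    by rewrite E eq_sym (negbTE (lN b)) scaler0.
  rewrite addr0; apply/idlMr/idlMl; exists s; exact: erefl.
move=> /(pa_hom_idl (r' := derU) jotaP); rewrite jota_arr; apply => a.
by rewrite -der_sum_inr; exact: (idl_gen derU).
Qed.

Lemma kill_idl x : idl derU (x - iota (kill x)).
Proof.
move: x; apply: pa_arr_ind => [|x y hx hy|c x hx|v|a x hx].
- by rewrite (pa_hom0 killP) (pa_hom0 iotaP) subrr; exact: idl0.
- by rewrite (pa_homD killP) (pa_homD iotaP) opprD addrACA; exact: idlD.
- by rewrite (pa_homZ killP) (pa_homZ iotaP) -scalerBr; exact: idlZ.
- by rewrite (pa_hom_idem killP) (pa_hom_idem iotaP) subrr; exact: idl0.
rewrite (pa_homM killP) (pa_homM iotaP) (arrow_hom_arr kill_typed).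
case: a => [a|b] /=; first by rewrite iota_arr -mulrBr; exact: idlMl.
by rewrite (pa_hom0 iotaP) mul0r subr0; exact/idlMr/trivial_arrow_idl.
Qed.

(** Killing the arrows of T is a left inverse of the inclusion of the algebra of S, and also a right
    inverse modulo the Jacobian ideal of the sum, so families pass both ways. *)
Lemma coh_sum (X : Type) (G : X -> V -> int) :
  coh eU (jid derU) G <-> coh eP (jid derS) G.
Proof.
have [lP lN] := summand_loop_free.
split; [apply: (coh_hom killP) | apply: (coh_hom iotaP)].
- move=> [a|b].
    by rewrite der_sum_inl killK; exact: (idl_gen derS).
  rewrite der_sum_inr kill_jota; first exact: idl0.
  by apply: der_rad => c _; exact: loop_free_size.
- move=> M; exists M => x; apply: (pa_hom_rad killP) => -[a|b].
    by rewrite (arrow_hom_arr kill_typed); exact: in_rad_arr.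
  by rewrite (arrow_hom_arr kill_typed); exact: in_rad0.
- move=> u v x' xt; exists (iota x'); first exact: (pa_hom_typed iotaP).
  by rewrite killK subrr; exact: idl0.
- by move=> a; rewrite -der_sum_inl; exact: (idl_gen derU).
- move=> M; exists M => x; apply: (pa_hom_rad iotaP) => a.
  by rewrite iota_arr; exact: in_rad_arr.
- move=> u v x' xt; exists (kill x'); first exact: (pa_hom_typed killP).
  exact: kill_idl.
Qed.

End DirectSum.

Definition qp_coh (K : fieldType) (V : finType) (S : qp K V) (X : Type)
    (G : X -> V -> int) :=
  coh (idem K (qp_quiver S)) (jid (fun a => cyclic_derivative a (qp_potential S))) G.

(** * Compatible families under mutation of quivers with potential *)

Section Mutation.
Context (K : fieldType) {V : finType}.
Implicit Types (S R : qp K V).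

(** The chain rule identifies the Jacobian ideals, and the absence of loops, carried over to the
    second quiver, makes both the isomorphism and its inverse respect lengths. *)
Lemma coh_right_f_equivalent S R : right_f_equivalent S R -> loop_free (qp_quiver S) ->
  loop_free (qp_quiver R) /\
  forall (X : Type) (G : X -> V -> int), qp_coh S G <-> qp_coh R G.
Proof.
case=> phi [phZ [g gK Kg] phe phW] lf.
have fh : pa_hom phi by split; [exact: raddfD | exact: phZ | exact: rmorphM | exact: phe].
have gh := pa_hom_can fh gK Kg; have lf' := pa_iso_loop_free fh gh Kg lf; split=> // X G.
split; [apply: (coh_iso fh gh Kg) | apply: (coh_iso gh fh gK)].
- move=> a; rewrite -[in cyclic_derivative a _](path_of_potentialK (qp_potential S)).
  rewrite -phW -{1}[path_of_potential _]gK.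
  have := der_hom_idl (f := g) gh (phi (path_of_potential (qp_potential S))) a fh Kg.
  by rewrite gK phW.
- by move=> a; exact: pa_hom_arr_rad.
- move=> b; have := der_hom_idl fh (path_of_potential (qp_potential S)) b gh gK.
  by rewrite phW path_of_potentialK.
- by move=> a; exact: pa_hom_arr_rad.
Qed.

(** The premutation, the direct sum equivalent to it and the reduced part R carry the same families.
    So the two directions are those of the premutation, with the arrows into and out of k exchanged
    on the way back. *)
Lemma coh_f_mutation k S R : loop_free (qp_quiver S) -> two_cycle_free (qp_quiver S) ->
  is_f_mutation k S R ->
  forall (X : Type) (G : X -> V -> int),
  (qp_coh S G -> qp_coh R (fun a v => mut_step
     (fun v => (narrows (qp_quiver S) k v)%:Z) (fun v => (narrows (qp_quiver S) v k)%:Z)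
     k (G a) v)) /\
  (qp_coh R G -> qp_coh S (fun a v => mut_step
     (fun v => (narrows (qp_quiver S) v k)%:Z) (fun v => (narrows (qp_quiver S) k v)%:Z)
     k (G a) v)).
Proof.
move=> lf tf [[_ [T Tt eq]] _] X G.
have lfm := mu_pre_loop_free (k := k) lf tf.
have [lfU cohE] := coh_right_f_equivalent eq lfm.
have cohU X' (G' : X' -> V -> int) : qp_coh (qp_mu_pre k S) G' <-> qp_coh R G'.
  by apply: iff_trans (cohE X' G') _; exact: coh_sum.
have nl (a : arrow (qp_quiver S)) : src a == k -> tgt a != k by move=> /eqP <-; rewrite eq_sym; exact: lf.
have Wr a : in_rad 2 (cyclic_derivative a (qp_potential S)).
  by apply: der_rad => c _; exact: two_cycle_free_size.
split=> cG.
- apply/cohU; have := coh_mu_pre nl Wr cG.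
  rewrite (_ : out_count _ k = fun v => (narrows (qp_quiver S) k v)%:Z); last first.
    by apply: funext => v; exact: out_countE.
  rewrite (_ : in_count _ k = fun v => (narrows (qp_quiver S) v k)%:Z) //.
  by apply: funext => v; exact: in_countE.
- move/cohU in cG; have := coh_mu_pre_back nl Wr cG.
  rewrite (_ : out_count _ k = fun v => (narrows (qp_quiver S) v k)%:Z); last first.
    by apply: funext => v; exact: out_count_mu.
  rewrite (_ : in_count _ k = fun v => (narrows (qp_quiver S) k v)%:Z) //.
  by apply: funext => v; exact: in_count_mu.
Qed.

End Mutation.

(** * Quiver mutation *)

Section QuiverMutation.
Context {V : finType}.
Implicit Types (P Q : quiver V) (k u v : V).

Definition bq Q u v : int := (narrows Q u v)%:Z - (narrows Q v u)%:Z.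

Lemma bqN Q u v : bq Q v u = - bq Q u v.
Proof. by rewrite /bq opprB. Qed.

Lemma narrowsE Q u v :
  (narrows Q u v)%:Z = \sum_(a : arrow Q) ((src a == u) && (tgt a == v))%:R.
Proof. by rewrite /narrows card_intE. Qed.

Lemma loop_free_narrows Q u : loop_free Q -> narrows Q u u = 0%N.
Proof.
move=> lf; apply/eqP; rewrite cards_eq0; apply/eqP/setP => a; rewrite !inE.
by apply/negP => /andP[/eqP <- /eqP ta]; have := lf a; rewrite ta eqxx.
Qed.

Lemma two_cycle_free_narrows Q u v : loop_free Q -> two_cycle_free Q ->
  (narrows Q u v == 0%N) || (narrows Q v u == 0%N).
Proof.
move=> lf tf; rewrite !cards_eq0; apply: contraT; rewrite negb_or.
move=> /andP[/set0Pn[a] + /set0Pn[b]]; rewrite !inE =>  /andP[/eqP sa /eqP ta] /andP[/eqP sb /eqP tb].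
have [ab|nab] := eqVneq a b; last by have := tf a b nab; rewrite sa ta sb tb !eqxx.
by have := lf a; rewrite sa ab tb eqxx.
Qed.

(** Without 2-cycles one of the two numbers of arrows is zero, so the skew-symmetric matrix [bq]
    determines both. All later computations can use this matrix, on which the choice of the
    cancelled 2-cycles has no influence. *)
Lemma narrows_bq Q u v : loop_free Q -> two_cycle_free Q ->
  (narrows Q u v)%:Z = pospart (bq Q u v).
Proof.
move=> lf tf; rewrite /pospart /bq.
by have /orP[/eqP->|/eqP->] := two_cycle_free_narrows u v lf tf;
  [rewrite sub0r; case: (narrows Q v u) | rewrite subr0].
Qed.

Lemma quiver_iso_narrows P Q u v : quiver_iso P Q -> narrows P u v = narrows Q u v.
Proof.
case=> f bf hf; apply/eqP; rewrite -eqz_nat !narrowsE; apply/eqP.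
rewrite [RHS](reindex f) /=; last by apply: onW_bij.
by apply: eq_bigr => a _; have [-> ->] := hf a.
Qed.

Lemma quiver_iso_loop_free P Q : quiver_iso P Q -> loop_free Q -> loop_free P.
Proof. by case=> f _ hf lf a; have [<- <-] := hf a. Qed.

Lemma quiver_iso_two_cycle_free P Q :
  quiver_iso P Q -> two_cycle_free Q -> two_cycle_free P.
Proof.
case=> f bf hf tf a b nab; have [<- <-] := hf a; have [<- <-] := hf b.
by apply: tf; rewrite (inj_eq (bij_inj bf)).
Qed.

Section Cancel.
Variable Q : quiver V.
Local Notation C := (max_two_cycles Q).

Lemma max_two_cyclesP : maxset (@disjoint_two_cycles V Q) C.
Proof.
rewrite /max_two_cycles; case: pickP => [D|none] //=.
have : disjoint_two_cycles (set0 : {set {set arrow Q}}).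
  rewrite /disjoint_two_cycles; apply/andP; split; last by apply/trivIsetP => A B; rewrite inE.
  by apply/forall_inP => c; rewrite inE.
by case/maxset_exists => D Dm _; have := none D; rewrite Dm.
Qed.

(** A surviving 2-cycle is disjoint from the cancelled ones and could be added to the collection,
    against its maximality. *)
Lemma cancel_two_cycle_free : loop_free Q -> two_cycle_free (cancel_two_cycles Q).
Proof.
move=> lf a b nab; apply/negP => /andP[/= sa ta].
have [/andP[/forall_inP Cc Ct] Cmax] := maxsetP max_two_cyclesP.
have aC := valP a; have bC := valP b; rewrite /= in aC bC.
set c := [set val a; val b].
have cC : c \notin C.
  apply: contra aC => cC; apply/bigcupP; exists c => //; exact: set21.
suff D : disjoint_two_cycles (c |: C).
  have := setU11 c C; rewrite (Cmax _ D (subsetUr _ _)); exact/negP.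
apply/andP; split.
  apply/forall_inP => d; rewrite !inE => /orP[/eqP->|/Cc//].
  apply/existsP; exists (val a); apply/existsP; exists (val b).
  by rewrite sa ta eqxx !andbT; apply: contraNneq nab => /val_inj ->.
have disj d : d \in C -> [disjoint c & d].
  move=> dC; rewrite disjoints_subset; apply/subsetP => x; rewrite !inE.
  by move=> /orP[] /eqP ->; [apply: contra aC | apply: contra bC] => xd;
    apply/bigcupP; exists d.
apply/trivIsetP => A B; rewrite !inE => /orP[/eqP->|AC] /orP[/eqP->|BC] nAB.
- by rewrite eqxx in nAB.
- exact: disj.
- by rewrite disjoint_sym; exact: disj.
- exact: (trivIsetP Ct).
Qed.

Lemma cancel_loop_free : loop_free Q -> loop_free (cancel_two_cycles Q).
Proof. by move=> lf a; exact: lf. Qed.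

(** Each cancelled 2-cycle contains one arrow in each direction. *)
Lemma cancel_bq u v : bq (cancel_two_cycles Q) u v = bq Q u v.
Proof.
have [/andP[/forall_inP Cc Ct] _] := maxsetP max_two_cyclesP.
pose F (x y : V) (a : arrow Q) : int := ((src a == x) && (tgt a == y))%:R.
have split x y : (narrows Q x y)%:Z =
    (narrows (cancel_two_cycles Q) x y)%:Z + \sum_(a in cover C) F x y a.
  rewrite !narrowsE (bigID (fun a => a \notin cover C)) /=; congr (_ + _).
    exact: esym (sum_sig (fun a => a \notin cover C) (F x y)).
  by apply: eq_bigl => a; rewrite negbK.
have FC : \sum_(a in cover C) F u v a = \sum_(a in cover C) F v u a.
  rewrite !big_trivIset //; apply: eq_bigr => c /Cc /existsP[a /existsP[b]].
  case/and4P => nab /eqP sa /eqP ta /eqP ->.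
  rewrite !big_setU1 ?inE //= !big_set1 /F sa ta addrC.
  by congr (_ + _); congr (nat_of_bool _)%:R; rewrite andbC.
by rewrite /bq !split FC opprD addrACA subrr addr0.
Qed.

End Cancel.

Section Premutation.
Variables (Q : quiver V) (k : V).
Hypothesis lf : loop_free Q.

Lemma mu_pre_narrows u v : (narrows (mu_pre k Q) u v)%:Z =
  (if (u == k) || (v == k) then (narrows Q v u)%:Z else (narrows Q u v)%:Z) +
  (narrows Q u k)%:Z * (narrows Q k v)%:Z.
Proof.
rewrite narrowsE big_sumType /=; congr (_ + _).
  case: ifP => [uvk|/negbT]; rewrite narrowsE; last rewrite negb_or => /andP[uk vk].
    apply: eq_bigr => a _; congr (nat_of_bool _)%:R; rewrite /incident.
    have := lf a; case: (altP (src a =P k)) => [->|sa] /=.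
      by rewrite andbC.
    case: (altP (tgt a =P k)) => [->|ta] /= _; first by rewrite andbC.
    case/orP: uvk => /eqP ->; by rewrite (negbTE sa) (negbTE ta) ?andbF.
  apply: eq_bigr => a _; congr (nat_of_bool _)%:R; rewrite /incident.
  case: (altP (src a =P k)) => [->|sa] /=.
    by rewrite ![k == _]eq_sym (negbTE uk) (negbTE vk) andbF.
  by case: (altP (tgt a =P k)) => [->|ta] //=; rewrite ![k == _]eq_sym (negbTE uk) (negbTE vk) andbF.
rewrite (sum_through k (fun b a => ((src a == u) && (tgt b == v))%:R)).
rewrite mulrC !narrowsE mulr_suml big_mkcond /=; apply: eq_bigr => b _.
case: (src b == k) => /=; last by rewrite mul0r.
rewrite mulr_sumr big_mkcond /=; apply: eq_bigr => a _.
rewrite andbC; case: (tgt a == k); rewrite ?andbF ?mulr0 // andbT.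
by case: (tgt b == v); rewrite ?mul0r ?mul1r ?andbT ?andbF.
Qed.

Lemma mu_bq u v : two_cycle_free Q -> bq (mu k Q) u v =
  if (u == k) || (v == k) then - bq Q u v
  else bq Q u v + (narrows Q u k)%:Z * (narrows Q k v)%:Z -
       (narrows Q v k)%:Z * (narrows Q k u)%:Z.
Proof.
move=> tf; rewrite /mu cancel_bq /bq !mu_pre_narrows [(v == k) || _]orbC.
case: ifP => [/orP[]/eqP->|_]; last by rewrite opprD addrACA addrA.
  by rewrite !(loop_free_narrows k lf) mul0r mulr0 !addr0 opprB.
by rewrite !(loop_free_narrows k lf) mul0r mulr0 !addr0 opprB.
Qed.

End Premutation.

Definition good_quiver Q := loop_free Q /\ two_cycle_free Q.

Lemma good_mu Q k : good_quiver Q -> good_quiver (mu k Q).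
Proof.
case=> lf tf; have lfm := mu_pre_loop_free (k := k) lf tf.
by split; [exact: cancel_loop_free | exact: cancel_two_cycle_free].
Qed.

Lemma good_iso P Q : quiver_iso P Q -> good_quiver Q -> good_quiver P.
Proof.
by move=> i [lf tf]; split; [exact: quiver_iso_loop_free i _ | exact: quiver_iso_two_cycle_free i _].
Qed.

Lemma good_narrows Q u v : good_quiver Q -> (narrows Q u v)%:Z = pospart (bq Q u v).
Proof. by case; exact: narrows_bq. Qed.

Lemma good_mu_bq Q k u v : good_quiver Q -> bq (mu k Q) u v =
  if (u == k) || (v == k) then - bq Q u v
  else bq Q u v + pospart (bq Q u k) * pospart (bq Q k v) -
       pospart (bq Q v k) * pospart (bq Q k u).
Proof. by move=> g; rewrite mu_bq ?good_narrows //; case: g. Qed.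

End QuiverMutation.

Lemma good_framed (I : finType) (Q : quiver I) : good_quiver Q -> good_quiver (framed Q).
Proof.
case=> lf tf; split=> [[a|i]|[a|i] [b|j]] //=; first exact: lf.
  by move=> ab; exact: tf.
by rewrite andbF.
Qed.

(** * Tropical duality *)

(* [true] stands for the sign -1. *)
Definition sgb (s : bool) : int := (-1) ^+ s.

Lemma sgb_neg s : sgb (~~ s) = - sgb s.
Proof. by case: s. Qed.

Lemma sgb_sq s : sgb s * sgb s = 1.
Proof. by case: s. Qed.

Section TropicalDuality.
Context {n : nat}.
Local Notation I := 'I_n.
Local Notation M := 'M[int]_n.
Implicit Types (b B X Y : M) (k : I) (s : bool).

Definition skew B := forall u v, B v u = - B u v.

Definition mut_b k B : M := \matrix_(u, v)
  if (u == k) || (v == k) then - B u v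
  else B u v + pospart (B u k) * pospart (B k v) - pospart (B v k) * pospart (B k u).

Definition trop_step B k X : M := \matrix_(v, a)
  mut_step (fun v => pospart (B k v)) (fun v => pospart (B v k)) k (X^~ a) v.

(* The matrices E of Nakanishi and Zelevinsky. *)
Definition elem s B k : M := \matrix_(v, j)
  if j == k then (if v == k then -1 else pospart (sgb s * B k v)) else (v == j)%:R.

Definition row_sign s X k := forall a, 0 <= sgb s * X k a.

Lemma elem_mulE s B k X v a : (elem s B k *m X) v a =
  if v == k then - X k a else X v a + pospart (sgb s * B k v) * X k a.
Proof.
rewrite mxE (bigD1 k) //= !mxE eqxx.
have [vk|vk] := eqVneq v k.
  by rewrite mulN1r big1 ?addr0 // => j jk; rewrite !mxE vk (negbTE jk) eq_sym (negbTE jk) mul0r.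
rewrite addrC; congr (_ + _); rewrite (bigD1 v) //= big1 ?addr0 => [|j /andP[jk jv]].
  by rewrite !mxE (negbTE vk) eqxx mul1r.
by rewrite !mxE (negbTE jk) eq_sym (negbTE jv) mul0r.
Qed.

Lemma mul_elemE s B k X u a : (X *m elem s B k) u a =
  if a == k then - X u k + \sum_(v | v != k) X u v * pospart (sgb s * B k v) else X u a.
Proof.
rewrite mxE; have [->|ak] := eqVneq a k.
  rewrite (bigD1 k) //= !mxE !eqxx mulrN1; congr (_ + _); apply: eq_bigr => v vk.
  by rewrite !mxE eqxx (negbTE vk).
rewrite (bigD1 a) //= !mxE (negbTE ak) eqxx mulr1 big1 ?addr0 // => v va.
by rewrite !mxE (negbTE ak) (negbTE va) mulr0.
Qed.

Lemma pospart_sub (x : int) : pospart x - pospart (- x) = x.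
Proof. by rewrite /pospart; lia. Qed.

(** When the row k has a constant sign, the same one of the two positive parts vanishes in every
    column, and the piecewise linear rule becomes linear. *)
Lemma trop_stepE s B k X : skew B -> row_sign s X k ->
  trop_step B k X = elem s B k *m X.
Proof.
move=> Bs Xs; apply/matrixP => v a; rewrite elem_mulE mxE /mut_step.
case: eqP => // _; rewrite (Bs k v); have := Xs a; rewrite /sgb /pospart.
by case: s {Xs}; rewrite ?expr0 ?expr1; nia.
Qed.

Lemma elemK s B k : elem s B k *m elem s B k = 1%:M.
Proof.
apply/matrixP => v a; rewrite elem_mulE !mxE eqxx.
case: (eqVneq v k) => [vk|vk]; case: (eqVneq a k) => [ak|ak]; rewrite ?vk ?ak.
- by rewrite eqxx opprK.
- by rewrite eq_sym (negbTE ak) oppr0.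
- by rewrite mulrN1 subrr (negbTE vk).
by rewrite mulr0 addr0.
Qed.

(** The matrices for the two signs differ only in the column k, by the row k of B, since x is the
    difference of the positive parts of x and -x. The product is a transvection: the discrepancy
    caused by a flip of the sign. *)
Lemma elem_mulN s B k : skew B -> elem s B k *m elem (~~ s) B k =
  1%:M - sgb s *: ((row k B)^T *m delta_mx 0 k).
Proof.
move=> Bs; have Bk : B k k = 0 by have := Bs k k; lia.
apply/matrixP => v a; rewrite elem_mulE !mxE big_ord1 !mxE eqxx /= sgb_neg.
case: (eqVneq v k) => [vk|vk]; case: (eqVneq a k) => [ak|ak]; rewrite ?vk ?ak ?eqxx.
- by rewrite Bk mul0r mulr0 subr0 opprK.
- by rewrite Bk mul0r mulr0 subr0 oppr0 eq_sym (negbTE ak).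
- by rewrite (negbTE vk) mulrN1 mulr1 sub0r mulNr -opprB -[in RHS](pospart_sub (sgb s * B k v)) opprB.
by rewrite !mulr0 subr0.
Qed.

Lemma mut_b_skew k B : skew B -> skew (mut_b k B).
Proof.
by move=> Bs u v; rewrite !mxE [(v == k) || _]orbC; case: ifP => _; rewrite (Bs u v) //; lia.
Qed.

(** Matrix mutation is a congruence, for either sign; this freedom allows [R_congr] to use the sign
    of the current row of R. *)
Lemma elem_mut_b s k B : skew B ->
  elem s B k *m mut_b k B *m (elem s B k)^T = B.
Proof.
move=> Bs; have Bk : B k k = 0 by have := Bs k k; lia.
apply/matrixP => u v.
have -> : elem s B k *m mut_b k B *m (elem s B k)^T =
    (elem s B k *m (elem s B k *m mut_b k B)^T)^T.
  by rewrite trmx_mul trmxK.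
rewrite mxE elem_mulE ![(_ *m mut_b k B)^T _ _]mxE !elem_mulE !mxE eqxx /= !orbT /=.
rewrite Bk (Bs k v) (Bs k u) !opprK.
case: (eqVneq u k) => [uk|uk]; case: (eqVneq v k) => [vk|vk]; rewrite ?uk ?vk /= ?Bk.
- by rewrite oppr0.
- by rewrite mulr0 addr0.
- by rewrite mulr0 addr0 (Bs k u).
rewrite /sgb /pospart; case: s; rewrite ?expr0 ?expr1.
  move: (B k u) (B k v) (B u v) => x y z; nia.
move: (B k u) (B k v) (B u v) => x y z; nia.
Qed.

(** An integer with an integral inverse is 1 or -1. So a row with a single nonzero entry is a unit
    vector up to sign, and it determines the corresponding row of the inverse. *)
Lemma mulmx1_row X Y k l : X *m Y = 1%:M -> (forall j, j != l -> X k j = 0) ->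
  [/\ X k l = 1 \/ X k l = -1, forall j, Y l j = X k l * (k == j)%:R &
      forall j, X k j = X k l * (j == l)%:R].
Proof.
move=> XY Xk; have XYk j : X k l * Y l j = (k == j)%:R.
  have := congr1 (fun A : M => A k j) XY; rewrite !mxE (bigD1 l) //= big1 ?addr0 //.
  by move=> i /Xk->; rewrite mul0r.
have Xu : X k l = 1 \/ X k l = -1.
  have /unitrPr : exists y, X k l * y = 1 by exists (Y l k); rewrite XYk eqxx.
  by rewrite qualifE /= => /orP[]/eqP; [left | right].
split=> // j; first by rewrite -XYk; case: Xu => ->; rewrite ?mul1r // !mulN1r opprK.
by case: (eqVneq j l) => [->|/Xk->]; rewrite ?mulr1 ?mulr0.
Qed.

Lemma row_sign_eq s s' X Y k j : X k j != 0 -> Y k j = X k j ->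
  row_sign s X k -> row_sign s' Y k -> s' = s.
Proof.
move=> Xj YX Xs Ys; have := Xs j; have := Ys j; rewrite YX /sgb.
by case: s {Xs}; case: s' {Ys}; rewrite ?expr0 ?expr1 //; lia.
Qed.

(* The extension of a window at both ends: unless the row [k] of [X] is a unit
   vector up to sign, the signs on both sides agree; otherwise they both flip. *)
Lemma window_step X Y B B' k l s s' t t' : skew B -> skew B' ->
  X *m Y = 1%:M -> X *m B' *m X^T = mut_b k B ->
  row_sign s X k -> row_sign t Y l ->
  row_sign s' (X *m elem t B' l) k -> row_sign t' (Y *m elem s B k) l ->
  elem s' B k *m (X *m elem t B' l) *m (elem t' B' l *m (Y *m elem s B k)) = 1%:M.
Proof.
move=> Bs Bs' XY XB Xs Yt Xs' Yt'; have YX := mulmx1C XY.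
pose T := elem t B' l *m elem t' B' l.
have -> : elem s' B k *m (X *m elem t B' l) *m (elem t' B' l *m (Y *m elem s B k)) =
    elem s' B k *m (X *m T *m Y) *m elem s B k by rewrite /T !mulmxA.
case: (altP ([forall j, (j != l) ==> (X k j == 0)] =P true)) => [/forallP Xl|nX].
  have Xl' j : j != l -> X k j = 0 by move=> jl; apply/eqP; have := Xl j; rewrite jl.
  have [Xu Yl Xk] := mulmx1_row XY Xl'.
  have Yu : Y l k = X k l by rewrite Yl eqxx mulr1.
  have sX : X k l = sgb s by have := Xs l; case: Xu => ->; case: (s).
  have ts : t = s by have := Yt k; rewrite Yu sX; case: (s); case: (t).
  have s's : s' = ~~ s.
    have := Xs' l; rewrite mul_elemE eqxx big1 ?addr0 => [|v /Xl'->]; last by rewrite mul0r.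
    by rewrite sX; case: (s); case: (s').
  have t's : t' = ~~ s.
    have := Yt' k; rewrite mul_elemE eqxx big1 ?addr0 => [|v vk]; last first.
      by rewrite Yl [k == v]eq_sym (negbTE vk) mulr0 mul0r.
    by rewrite Yu sX; case: (s); case: (t').
  rewrite /T ts t's s's elem_mulN //.
  (* Row k of the congruence, in which the row k of X is a signed unit vector. It says that
     conjugation by X turns the transvection at l into the one at k. *)
  have XbE : X *m (row l B')^T = - sgb s *: (row k B)^T.
    have : row k (X *m B' *m X^T) = - row k B.
      by rewrite XB; apply/rowP => j; rewrite !mxE eqxx.
    have -> : row k (X *m B' *m X^T) = sgb s *: (X *m (row l B')^T)^T.
      rewrite !row_mul trmx_mul trmxK scalemxAl; congr (_ *m _).
      apply/rowP => j; rewrite !mxE (bigD1 l) //= big1 ?addr0 => [|i il].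
        by rewrite mxE sX.
      by rewrite mxE Xl' // mul0r.
    move=> h; apply: trmx_inj; rewrite linearZ /= trmxK scaleNr -scalerN -h.
    by rewrite scalerA sgb_sq scale1r.
  have YlE : delta_mx 0 l *m Y = sgb s *: delta_mx 0 k :> 'rV_n.
    by rewrite -rowE; apply/rowP => j; rewrite !mxE Yl sX eqxx [k == j]eq_sym.
  have -> : X *m (1%:M - sgb s *: ((row l B')^T *m delta_mx 0 l)) *m Y =
      elem (~~ s) B k *m elem (~~ ~~ s) B k.
    rewrite elem_mulN // mulmxBr mulmx1 mulmxBl XY; congr (_ - _).
    rewrite -scalemxAr -scalemxAl mulmxA XbE -mulmxA YlE -scalemxAr -scalemxAl.
    by rewrite !scalerA; congr (_ *: _); case: (s).
  by rewrite negbK !mulmxA elemK mul1mx elemK.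
(* Right multiplication by [elem] at l changes only the column l, so a nonzero entry of the row k of
   X outside l survives and forces s' = s. Likewise t' = t, since by Y X = 1 the row l of Y cannot
   be concentrated at k either. *)
have [j jl Xj] : exists2 j, j != l & X k j != 0.
  apply/exists_inP; move: nX; rewrite eqb_id negb_forall => /existsP[j].
  by rewrite negb_imply => h; apply/existsP; exists j.
have [i ik Yi] : exists2 i, i != k & Y l i != 0.
  apply/exists_inP; apply: contraT; rewrite negb_exists => /forallP Yl.
  have Yl' i : i != k -> Y l i = 0.
    by move=> ik; apply/eqP; have := Yl i; rewrite ik /= negbK.
  have [Yu Xk _] := mulmx1_row YX Yl'.
  by case/eqP: Xj; rewrite Xk eq_sym (negbTE jl) mulr0.
have -> : s' = s by apply: row_sign_eq Xj _ Xs Xs'; rewrite mul_elemE (negbTE jl).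
have tt : t' = t by apply: row_sign_eq Yi _ Yt Yt'; rewrite mul_elemE (negbTE ik).
by rewrite /T tt elemK mulmx1 XY mulmx1 elemK.
Qed.

Lemma mulmx_inv_eq X Y (Z : M) : X *m Z = 1%:M -> Z *m Y = 1%:M -> X = Y.
Proof. by move=> XZ ZY; rewrite -[X]mulmx1 -ZY mulmxA XZ mul1mx. Qed.

(** * Duality for all windows of the mutation sequence *)

Section Windows.
Variables (T : nat) (k : nat -> I) (B : nat -> M) (D R : nat -> nat -> M).
Hypothesis B0 : skew (B 0%N).
Hypothesis BS : forall t, (t < T)%N -> B t.+1 = mut_b (k t) (B t).
Hypothesis D0 : forall s : nat, (s <= T)%N -> D s s = 1%:M.
Hypothesis DS : forall s t : nat, (s <= t)%N -> (t < T)%N ->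
  D s t.+1 = trop_step (B t) (k t) (D s t).
Hypothesis R0 : forall s : nat, (s <= T)%N -> R s s = 1%:M.
Hypothesis RS : forall s t : nat, (s < t)%N -> (t <= T)%N ->
  R s t = trop_step (B s) (k s) (R s.+1 t).
Hypothesis Dc : forall s t : nat, (s <= t)%N -> (t <= T)%N -> forall v, exists e, row_sign e (D s t) v.
Hypothesis Rc : forall s t : nat, (s <= t)%N -> (t <= T)%N -> forall v, exists e, row_sign e (R s t) v.

Lemma B_skew t : (t <= T)%N -> skew (B t).
Proof. by elim: t => // t IH tT; rewrite BS //; apply/mut_b_skew/IH/ltnW. Qed.

(** R is a product of matrices E, each of which is a congruence between consecutive exchange
    matrices. *)
Lemma R_congr (s t : nat) : (s <= t)%N -> (t <= T)%N -> R s t *m B t *m (R s t)^T = B s.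
Proof.
move=> + tT; have [m] := ubnP (t - s); elim: m s => // m IH s ms st.
have [->|nst] := eqVneq s t; first by rewrite R0 // mul1mx trmx1 mulmx1.
have lst : (s < t)%N by rewrite ltn_neqAle nst.
have sT := leq_trans lst tT.
have [e es] := Rc lst tT (k s).
rewrite RS // (trop_stepE (B_skew (ltnW sT)) es) trmx_mul !mulmxA.
rewrite -(mulmxA (elem _ _ _)) -(mulmxA (elem _ _ _)) IH //; last by lia.
by rewrite BS // elem_mut_b //; exact/B_skew/ltnW.
Qed.

(** For the window from s to t + 1, the duality on the two windows shorter by one shows how R grows
    at its end and D at its start, starting from the common inner window. Now both are known in two
    ways, and [window_step] compares the four signs involved. *)
Lemma tropical_duality (s t : nat) : (s <= t)%N -> (t <= T)%N -> R s t *m D s t = 1%:M.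
Proof.
have [m] := ubnP (t - s); elim: m s t => // m IH s t ms st tT.
have [est|nst] := eqVneq s t; first by rewrite est R0 // D0 // mulmx1.
have lst : (s < t)%N by rewrite ltn_neqAle nst.
have sT := leq_trans lst tT; have Bs := B_skew (ltnW sT).
case: t ms st tT nst lst => // t ms st tT nst lst.
have [est|nst'] := eqVneq s t.
  subst t; have [e es] := Rc lst tT (k s).
  rewrite R0 // in es.
  rewrite RS // R0 // DS // D0; last exact: ltnW.
  by rewrite (trop_stepE Bs es) !mulmx1 elemK.
have lst' : (s < t)%N by rewrite ltn_neqAle nst' -ltnS.
have Bt := B_skew (ltnW tT).
have [t0 Yt] := Dc lst' (ltnW tT) (k t); have [s0 Xs] := Rc lst' (ltnW tT) (k s).
have XY := IH s.+1 t _ lst' (ltnW tT).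
have {}XY : R s.+1 t *m D s.+1 t = 1%:M by apply: XY; lia.
have RE : R s.+1 t.+1 = R s.+1 t *m elem t0 (B t) (k t).
  have h : R s.+1 t.+1 *m D s.+1 t.+1 = 1%:M by apply: IH; lia.
  rewrite DS // (trop_stepE Bt Yt) in h; apply: (mulmx_inv_eq h).
  by rewrite mulmxA -(mulmxA (elem _ _ _)) (mulmx1C XY) mulmx1 elemK.
have DE : D s t = D s.+1 t *m elem s0 (B s) (k s).
  have h : R s t *m D s t = 1%:M by apply: IH; lia.
  rewrite (RS lst' (ltnW tT)) (trop_stepE Bs Xs) in h; apply/esym/(mulmx_inv_eq _ h).
  by rewrite mulmxA -(mulmxA (D _ _)) elemK mulmx1 (mulmx1C XY).
have [s1 Xs1] := Rc lst tT (k s); have [t1 Yt1] := Dc (ltnW lst') (ltnW tT) (k t).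
rewrite (RS lst tT) (DS (ltnW lst') tT) (trop_stepE Bs Xs1) (trop_stepE Bt Yt1).
move: Xs1 Yt1; rewrite RE DE => Xs1 Yt1.
apply: (window_step Bs Bt XY _ Xs Yt Xs1 Yt1).
by rewrite (R_congr lst' (ltnW tT)) BS //; lia.
Qed.

(** As D grows by left multiplication with an involution, its inverse R grows by right
    multiplication with the same matrix: the recursion of the g-vectors along the mutation
    sequence. *)
Lemma R_succ (s t : nat) e : (s <= t)%N -> (t < T)%N -> row_sign e (D s t) (k t) ->
  R s t.+1 = R s t *m elem e (B t) (k t).
Proof.
move=> st tT es; have RD := tropical_duality st (ltnW tT).
have h := tropical_duality (leqW st) tT.
rewrite (DS st tT) (trop_stepE (B_skew (ltnW tT)) es) in h.
by apply: (mulmx_inv_eq h); rewrite mulmxA -(mulmxA (elem _ _ _)) (mulmx1C RD) mulmx1 elemK.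
Qed.

End Windows.

End TropicalDuality.

(** * Evaluation of cluster variables *)

Section Evaluation.
Context {m : nat}.
Implicit Types (x : 'I_m -> rat) (r : ratfun m) (p q : {mpoly rat[m]}).

(** A relation, because a rational function has a value at x only through a fraction whose
    denominator does not vanish there; [evalsto_uniq] shows that the value is unique. *)
Definition evalsto x r (v : rat) := exists p q : {mpoly rat[m]},
  [/\ q.@[x] != 0, r = tofrac p / tofrac q & v = p.@[x] / q.@[x]].

Lemma tofrac_eq p q p' q' : q != 0 -> q' != 0 ->
  tofrac p / tofrac q = tofrac p' / tofrac q' -> p * q' = p' * q.
Proof.
move=> q0 q0' /eqP; rewrite eqr_div ?tofrac_eq0 // -!tofracM tofrac_eq => /eqP->.
by [].
Qed.

Lemma meval_neq0 x q : q.@[x] != 0 -> q != 0.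
Proof. by apply: contraNneq => ->; rewrite meval0. Qed.

Lemma evalsto_uniq x r v v' : evalsto x r v -> evalsto x r v' -> v = v'.
Proof.
move=> [p [q [qx -> ->]]] [p' [q' [qx' /tofrac_eq e ->]]].
have {}e := e (meval_neq0 qx) (meval_neq0 qx').
apply/eqP; rewrite eqr_div //; apply/eqP.
by have := congr1 (meval x) e; rewrite !mevalM.
Qed.

Lemma evalsto_poly x p : evalsto x (tofrac p) p.@[x].
Proof. by exists p, 1; rewrite meval1 oner_neq0 tofrac1 !divr1. Qed.

Lemma evalstoD x r r' v v' : evalsto x r v -> evalsto x r' v' -> evalsto x (r + r') (v + v').
Proof.
move=> [p [q [qx -> ->]]] [p' [q' [qx' -> ->]]].
exists (p * q' + p' * q), (q * q'); split; first by rewrite mevalM mulf_neq0.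
  by rewrite addf_div ?tofrac_eq0 ?(meval_neq0 qx) ?(meval_neq0 qx') // tofracD !tofracM.
by rewrite addf_div // mevalD !mevalM.
Qed.

Lemma evalstoM x r r' v v' : evalsto x r v -> evalsto x r' v' -> evalsto x (r * r') (v * v').
Proof.
move=> [p [q [qx -> ->]]] [p' [q' [qx' -> ->]]].
exists (p * p'), (q * q'); split; first by rewrite mevalM mulf_neq0.
  by rewrite mulf_div !tofracM.
by rewrite mulf_div !mevalM.
Qed.

Lemma evalstoV x r v : v != 0 -> evalsto x r v -> evalsto x r^-1 v^-1.
Proof.
move=> v0 [p [q [qx -> vE]]]; exists q, p; split; last by rewrite vE invf_div.
  by apply: contra v0 => /eqP px; rewrite vE px mul0r.
by rewrite invf_div.
Qed.

Lemma evalsto_prod x (T : Type) (s : seq T) (F : T -> ratfun m) (f : T -> rat) :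
  (forall i, evalsto x (F i) (f i)) -> evalsto x (\prod_(i <- s) F i) (\prod_(i <- s) f i).
Proof.
move=> h; apply: (big_ind2 (fun r v => evalsto x r v)) => //.
  by have := evalsto_poly x 1; rewrite tofrac1 meval1.
by move=> *; exact: evalstoM.
Qed.

Lemma evalsto_sum x (T : Type) (s : seq T) (F : T -> ratfun m) (f : T -> rat) :
  (forall i, evalsto x (F i) (f i)) -> evalsto x (\sum_(i <- s) F i) (\sum_(i <- s) f i).
Proof.
move=> h; apply: (big_ind2 (fun r v => evalsto x r v)) => //.
  by have := evalsto_poly x 0; rewrite tofrac0 meval0.
by move=> *; exact: evalstoD.
Qed.

Lemma evalstoX x r v j : evalsto x r v -> evalsto x (r ^+ j) (v ^+ j).
Proof.
move=> h; elim: j => [|j IH]; last by rewrite !exprS; exact: evalstoM.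
by have := evalsto_poly x 1; rewrite tofrac1 meval1 !expr0.
Qed.

Lemma evalstoXz x r v (j : int) : v != 0 -> evalsto x r v -> evalsto x (r ^ j) (v ^ j).
Proof.
move=> v0 h; case: j => j; first exact: evalstoX.
by rewrite !NegzE -!exprnN; apply: evalstoV; [rewrite expf_neq0 | exact: evalstoX].
Qed.

Lemma evalsto_int x (z : int) : evalsto x z%:~R z%:~R.
Proof.
have := evalsto_poly x z%:~R; rewrite rmorph_int; congr evalsto.
by rewrite rmorph_int.
Qed.

Lemma evalsto_ratr x (c : rat) : evalsto x (ratr c) c.
Proof.
rewrite /ratr -[X in evalsto _ _ X]divq_num_den; apply: evalstoM; first exact: evalsto_int.
by apply: evalstoV; [rewrite intr_eq0 denq_eq0 | exact: evalsto_int].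
Qed.

Lemma evalsto_mmap x l (h : 'I_l -> ratfun m) (z : 'I_l -> rat) (F : {mpoly rat[l]}) :
  (forall j, evalsto x (h j) (z j)) -> evalsto x (mmap ratr h F) F.@[z].
Proof.
move=> hz; rewrite mevalE /mmap; apply: evalsto_sum => mm.
apply: evalstoM; first exact: evalsto_ratr.
by apply: evalsto_prod => i; exact: evalstoX.
Qed.

Definition monomial_at x (g : 'I_m -> int) : rat := \prod_i x i ^ g i.

End Evaluation.

Section Monomials.
Context {n : nat}.
Implicit Types (x : 'I_n -> rat) (g : 'I_n -> int).

Lemma evalsto_xmonomial x g : (forall i, x i != 0) ->
  evalsto x (xmonomial g) (monomial_at x g).
Proof.
move=> x0; apply: evalsto_prod => i; apply: evalstoXz => //.
by have := evalsto_poly x 'X_i; rewrite mevalXU.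
Qed.

Lemma monomial_at_gt0 x g : (forall i, 0 < x i) -> 0 < monomial_at x g.
Proof. by move=> x0; apply: prodr_gt0 => i _; exact: exprz_gt0. Qed.

Lemma monomial_atD x g g' : (forall i, 0 < x i) ->
  monomial_at x (fun i => g i + g' i) = monomial_at x g * monomial_at x g'.
Proof.
move=> x0; rewrite /monomial_at -big_split; apply: eq_bigr => i _.
by rewrite expfzDr // gt_eqF.
Qed.

Lemma monomial_atM x g (c : int) :
  monomial_at x (fun i => g i * c) = monomial_at x g ^ c.
Proof.
rewrite /monomial_at; elim/big_rec2: _ => [|i y1 y2 _ ->]; first by rewrite exp1rz.
by rewrite expfzMl exprz_exp.
Qed.

Lemma monomial_atN x g : monomial_at x (fun i => - g i) = (monomial_at x g)^-1.
Proof.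
by rewrite /monomial_at -prodfV; apply: eq_bigr => i _; rewrite invr_expz.
Qed.

Lemma eq_monomial_at x g g' : g =1 g' -> monomial_at x g = monomial_at x g'.
Proof. by move=> e; apply: eq_bigr => i _; rewrite e. Qed.

Lemma monomial_at_sum x (T : Type) (s : seq T) (g : T -> 'I_n -> int) (c : T -> int) :
  (forall i, 0 < x i) ->
  monomial_at x (fun i => \sum_(j <- s) g j i * c j) =
  \prod_(j <- s) monomial_at x (g j) ^ c j.
Proof.
move=> x0; elim: s => [|j s IH].
  by rewrite big_nil /monomial_at big1 // => i _; rewrite big_nil expr0z.
rewrite big_cons -IH -monomial_atM -monomial_atD //.
by apply: eq_monomial_at => i; rewrite big_cons.
Qed.

(** The point with coordinate 2 at j and 1 elsewhere isolates the exponent at j. *)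
Lemma monomial_at_inj g g' :
  (forall x, (forall i, 0 < x i) -> monomial_at x g = monomial_at x g') -> g =1 g'.
Proof.
move=> h j; pose x i : rat := if i == j then 2 else 1.
have xE f : monomial_at x f = 2 ^ f j.
  rewrite /monomial_at (bigD1 j) //= /x eqxx big1 ?mulr1 // => i /negbTE->.
  by rewrite exp1rz.
have /h : forall i, 0 < x i by move=> i; rewrite /x; case: ifP.
rewrite !xE => /eqP; rewrite (inj_eq (ieexprIz _ _)) //.
by move/eqP.
Qed.

End Monomials.

Section SeedQuivers.
Context {V : finType} {F : fieldType}.
Implicit Types (s : @seed V F) (k : V).

Lemma seed_mu_quiver k s : seed_quiver (seed_mu k s) = mu k (seed_quiver s).
Proof. by case: s. Qed.

Lemma seed_mu_var k s j : seed_var (seed_mu k s) j =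
  if j == k then (seed_var s k)^-1 *
    (\prod_i seed_var s i ^+ narrows (seed_quiver s) i k +
     \prod_i seed_var s i ^+ narrows (seed_quiver s) k i)
  else seed_var s j.
Proof. by case: s. Qed.

End SeedQuivers.

(** * The separation formula at positive rational points *)

Section Numeric.
Context {n : nat} (Q : quiver 'I_n) (ks : seq 'I_n) (i0 : 'I_n).
Local Notation M := 'M[int]_n.
Local Notation T := (size ks).
Local Notation k := (nth i0 ks).
Variables (B D G : nat -> M).
Hypothesis Qg : good_quiver Q.
Hypothesis B0E : forall u v, B 0%N u v = bq Q u v.
Hypothesis BS : forall t, (t < T)%N -> B t.+1 = mut_b (k t) (B t).
Hypothesis D0 : D 0%N = 1%:M.
Hypothesis DS : forall t, (t < T)%N -> D t.+1 = trop_step (B t) (k t) (D t).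
Hypothesis G0 : G 0%N = 1%:M.
Hypothesis GS : forall t, (t < T)%N -> exists2 e, row_sign e (D t) (k t) &
  G t.+1 = G t *m elem e (B t) (k t).
Hypothesis GD : forall t, (t <= T)%N -> G t *m D t = 1%:M.
Hypothesis GBG : forall t, (t <= T)%N -> G t *m B t *m (G t)^T = B 0%N.

Definition seed_at t := seed_mu_seq (take t ks)
  (Seed Q (fun j => tofrac 'X_j) : @seed 'I_n (ratfun n)).

Definition pf_seed_at t := seed_mu_seq [seq inl j | j <- take t ks]
  (Seed (framed Q) (fun v => match v with
                             | inl j => tofrac 'X_(lshift n j)
                             | inr j => tofrac 'X_(rshift n j)
                             end) : @seed ('I_n + 'I_n)%type (ratfun (n + n))).

Lemma seed_atS t : (t < T)%N -> seed_at t.+1 = seed_mu (k t) (seed_at t).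
Proof.
by move=> tT; rewrite /seed_at /seed_mu_seq (take_nth i0) // -cats1 foldl_cat.
Qed.

Lemma pf_seed_atS t : (t < T)%N -> pf_seed_at t.+1 = seed_mu (inl (k t)) (pf_seed_at t).
Proof.
by move=> tT; rewrite /pf_seed_at /seed_mu_seq (take_nth i0) // -cats1 map_cat foldl_cat.
Qed.

Lemma seed_at_quiver t : (t <= T)%N ->
  good_quiver (seed_quiver (seed_at t)) /\
  forall u v, bq (seed_quiver (seed_at t)) u v = B t u v.
Proof.
elim: t => [|t IH] tT; first by rewrite /seed_at take0; split=> // u v; rewrite B0E.
have [gt bt] := IH (ltnW tT); rewrite seed_atS // seed_mu_quiver.
split=> [|u v]; first exact: good_mu.
by rewrite good_mu_bq // !bt BS // mxE.
Qed.

Lemma narrows_framed_inr (a v : 'I_n) :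
  narrows (framed Q) (inr a) (inl v) = (v == a) /\ narrows (framed Q) (inl v) (inr a) = 0%N.
Proof.
split; apply/eqP; rewrite -eqz_nat narrowsE big_sumType /=.
  rewrite [X in X + _]big1 ?add0r // (bigD1 a) //= eqxx big1 ?addr0 => [|j ja].
    by rewrite (inj_eq (@inl_inj _ _)) natz [v == a]eq_sym.
  by rewrite (inj_eq (@inr_inj _ _)) (negbTE ja).
rewrite !big1 // => b _; by rewrite andbF.
Qed.

Lemma narrows_framed_inl (u v : 'I_n) : narrows (framed Q) (inl u) (inl v) = narrows Q u v.
Proof.
apply/eqP; rewrite -eqz_nat !narrowsE big_sumType /= [X in _ + X]big1 ?addr0 //.
Qed.

(** The signed numbers of arrows from the framing vertices to the others form the C-matrix: it
    starts at the identity and matrix mutation acts on it by [trop_step], hence it is D. *)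
Lemma pf_seed_at_quiver t : (t <= T)%N ->
  [/\ good_quiver (seed_quiver (pf_seed_at t)),
      forall u v, bq (seed_quiver (pf_seed_at t)) (inl u) (inl v) = B t u v &
      forall a v, bq (seed_quiver (pf_seed_at t)) (inr a) (inl v) = D t v a].
Proof.
elim: t => [|t IH] tT.
  rewrite /pf_seed_at take0 /=; split=> [|u v|a v]; first exact: good_framed.
    by rewrite /bq !narrows_framed_inl B0E.
  by have [h1 h2] := narrows_framed_inr a v; rewrite /bq h1 h2 D0 mxE subr0 natz.
have [gt bt ct] := IH (ltnW tT); rewrite pf_seed_atS // seed_mu_quiver.
split=> [|u v|a v]; first exact: good_mu.
  by rewrite good_mu_bq // !bt BS // mxE !(inj_eq (@inl_inj _ _)).
rewrite good_mu_bq // (bqN _ (inr a) (inl (k t))) !ct !bt DS // mxE /mut_step !(inj_eq (@inl_inj _ _)) /=.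
by case: eqP => [->|_] //; congr (_ + _ - _); exact: mulrC.
Qed.

Lemma B_antisym t u v : (t <= T)%N -> B t v u = - B t u v.
Proof. by move=> /seed_at_quiver[_ h]; rewrite -!h bqN. Qed.

(* The monomial factor of the exchange relation at the cluster [t]. *)
Lemma exchange_exponents t e j : (t <= T)%N -> row_sign e (D t) (k t) ->
  \sum_v G t j v * pospart (sgb e * B t (k t) v) +
    \sum_a B 0%N j a * pospart (D t (k t) a) =
    \sum_v G t j v * pospart (B t v (k t)) /\
  \sum_v G t j v * pospart (sgb e * B t (k t) v) +
    \sum_a B 0%N j a * pospart (- D t (k t) a) =
    \sum_v G t j v * pospart (B t (k t) v).
Proof.
(* G B G^T = B_0 and G D = 1 give B_0 D^T = G B, whose entry at (j, k) links the exponents of the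
   coefficients with those of the g-vectors. *)
move=> tT es; have key : \sum_a B 0%N j a * D t (k t) a = \sum_v G t j v * B t v (k t).
  have : B 0%N *m (D t)^T = G t *m B t.
    by rewrite -(GBG tT) -mulmxA -trmx_mul (mulmx1C (GD tT)) trmx1 mulmx1.
  move/(congr1 (fun A : M => A j (k t))); rewrite !mxE => <-.
  by apply: eq_bigr => a _; rewrite mxE.
have sub (X Y : 'I_n -> int) : \sum_v G t j v * X v + \sum_v G t j v * Y v =
    \sum_v G t j v * (X v + Y v).
  by rewrite -big_split; apply: eq_bigr => v _; rewrite mulrDr.
case: e es => es.
  have -> : \sum_a B 0%N j a * pospart (D t (k t) a) = 0.
    apply: big1 => a _; have := es a; rewrite /sgb expr1 mulN1r oppr_ge0 => h.
    by rewrite /pospart max_r // mulr0.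
  have -> : \sum_a B 0%N j a * pospart (- D t (k t) a) = \sum_v G t j v * - B t v (k t).
    transitivity (\sum_a - (B 0%N j a * D t (k t) a)).
      apply: eq_bigr => a _; have := es a; rewrite /sgb expr1 mulN1r => h.
      by rewrite /pospart max_l // mulrN.
    by rewrite sumrN key -sumrN; apply: eq_bigr => v _; rewrite mulrN.
  rewrite addr0 sub; split; apply: eq_bigr => v _; congr (_ * _).
    by rewrite (B_antisym v (k t) tT) /sgb expr1 mulN1r opprK.
  by rewrite (B_antisym v (k t) tT) /sgb expr1 mulN1r /pospart; lia.
have -> : \sum_a B 0%N j a * pospart (- D t (k t) a) = 0.
  apply: big1 => a _; have := es a; rewrite /sgb expr0 mul1r => h.
  by rewrite /pospart max_r ?oppr_le0 // mulr0.
have -> : \sum_a B 0%N j a * pospart (D t (k t) a) = \sum_v G t j v * B t v (k t).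
  rewrite -key; apply: eq_bigr => a _; have := es a; rewrite /sgb expr0 mul1r => h.
  by rewrite /pospart max_l.
rewrite addr0 sub; split; apply: eq_bigr => v _; congr (_ * _).
  by rewrite (B_antisym v (k t) tT) /sgb expr0 mul1r /pospart; lia.
by rewrite /sgb expr0 mul1r.
Qed.

Section AtPoint.
Variable x : 'I_n -> rat.
Hypothesis x0 : forall i, 0 < x i.

(** The inverse of y_j at the point x, since [bq] is minus [Qbar]. *)
Definition zval (j : 'I_n) : rat := monomial_at x (fun i => B 0%N i j).
Definition pf_point (v : 'I_(n + n)) : rat :=
  match split v with inl _ => 1 | inr j => zval j end.
Definition gmon t i := monomial_at x (fun j => G t j i).

(** Multiplication by the monomial P turns the two coefficient monomials of the framed exchange
    relation into the factors by which the columns of G rescale the unframed one, and the new column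
    of G is worth P divided by the old monomial. *)
Lemma gmonS t e (f : 'I_n -> rat) : (t < T)%N -> row_sign e (D t) (k t) ->
  G t.+1 = G t *m elem e (B t) (k t) ->
  gmon t.+1 (k t) *
    (\prod_i f i ^ pospart (B t i (k t)) * \prod_a zval a ^ pospart (D t (k t) a) +
     \prod_i f i ^ pospart (B t (k t) i) * \prod_a zval a ^ pospart (- D t (k t) a)) =
  (gmon t (k t))^-1 *
    (\prod_i (gmon t i * f i) ^ pospart (B t i (k t)) +
     \prod_i (gmon t i * f i) ^ pospart (B t (k t) i)).
Proof.
move=> tT es GE; pose P := monomial_at x
  (fun j => \sum_v G t j v * pospart (sgb e * B t (k t) v)).
have mon (g : M) (c : 'I_n -> int) : \prod_i monomial_at x (g^~ i) ^ c i =
    monomial_at x (fun j => \sum_i g j i * c i).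
  by rewrite -(monomial_at_sum _ (fun i => g^~ i)).
have g'E : gmon t.+1 (k t) = (gmon t (k t))^-1 * P.
  rewrite /gmon -monomial_atN -monomial_atD //; apply: eq_monomial_at => j.
  rewrite GE mul_elemE eqxx [in RHS](bigD1 (k t)) //=.
  have -> : B t (k t) (k t) = 0 by have := B_antisym (k t) (k t) (ltnW tT); lia.
  by rewrite !mulr0 add0r.
have dist (c : 'I_n -> int) : \prod_i (gmon t i * f i) ^ c i =
    \prod_i gmon t i ^ c i * \prod_i f i ^ c i.
  by rewrite -big_split; apply: eq_bigr => i _; rewrite expfzMl.
have P1 : P * \prod_a zval a ^ pospart (D t (k t) a) = \prod_i gmon t i ^ pospart (B t i (k t)).
  rewrite !mon -monomial_atD //; apply: eq_monomial_at => j.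
  by have [] := exchange_exponents j (ltnW tT) es.
have P2 : P * \prod_a zval a ^ pospart (- D t (k t) a) = \prod_i gmon t i ^ pospart (B t (k t) i).
  rewrite !mon -monomial_atD //; apply: eq_monomial_at => j.
  by have [] := exchange_exponents j (ltnW tT) es.
rewrite g'E !dist -P1 -P2; ring.
Qed.

(** The separation formula at a point: an unframed variable is the framed one, evaluated with
    framing variables [zval] and the others 1, times the monomial of a column of G. The induction
    carries positivity, which keeps every denominator nonzero. *)
Lemma seed_values t : (t <= T)%N -> exists f : 'I_n -> rat,
  [/\ forall i, 0 < f i,
      forall i, evalsto pf_point (seed_var (pf_seed_at t) (inl i)) (f i),
      forall j, evalsto pf_point (seed_var (pf_seed_at t) (inr j)) (zval j) &
      forall i, evalsto x (seed_var (seed_at t) i) (gmon t i * f i)].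
Proof.
have z0 a : 0 < zval a by exact: monomial_at_gt0.
elim: t => [|t IH] tT.
  exists (fun _ => 1); rewrite /seed_at /pf_seed_at !take0 /=; split=> // i.
  - have := evalsto_poly pf_point 'X_(lshift n i); rewrite mevalXU /pf_point.
    by rewrite (unsplitK (inl i)).
  - have := evalsto_poly pf_point 'X_(rshift n i); rewrite mevalXU /pf_point.
    by rewrite (unsplitK (inr i)).
  have := evalsto_poly x 'X_i; rewrite mevalXU mulr1 /gmon /monomial_at G0.
  rewrite (bigD1 i) //= mxE eqxx expr1z big1 ?mulr1 // => j /negbTE ji.
  by rewrite mxE ji expr0z.
have [f [f0 fv zv xv]] := IH (ltnW tT); have [e es GE] := GS tT.
have [gq bE] := seed_at_quiver (ltnW tT).
have [pgq pbE pcE] := pf_seed_at_quiver (ltnW tT).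
pose fk := (f (k t))^-1 *
  (\prod_i f i ^ pospart (B t i (k t)) * \prod_a zval a ^ pospart (D t (k t) a) +
   \prod_i f i ^ pospart (B t (k t) i) * \prod_a zval a ^ pospart (- D t (k t) a)).
have nn (r : rat) (m : nat) : r ^+ m = r ^ m%:Z by [].
exists (fun i => if i == k t then fk else f i); split.
- move=> i; case: eqP => // _; apply: mulr_gt0; first by rewrite invr_gt0.
  by apply: addr_gt0; apply: mulr_gt0; apply: prodr_gt0 => j _; exact: exprz_gt0.
- move=> i; rewrite pf_seed_atS // seed_mu_var (inj_eq (@inl_inj _ _)).
  case: eqP => // _; apply: evalstoM; first by apply: evalstoV; rewrite ?gt_eqF.
  rewrite !big_sumType /=; apply: evalstoD; apply: evalstoM; apply: evalsto_prod => j.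
  + by rewrite -pbE -good_narrows //; exact: evalstoX.
  + by rewrite -pcE -good_narrows //; exact: evalstoX.
  + by rewrite -pbE -good_narrows //; exact: evalstoX.
  + by rewrite -pcE -bqN -good_narrows //; exact: evalstoX.
- by move=> j; rewrite pf_seed_atS // seed_mu_var; exact: zv.
move=> i; rewrite seed_atS // seed_mu_var; case: eqP => [->|/eqP ik].
  rewrite /fk mulrCA (gmonS f tT es GE) mulrA -invfM [f _ * _]mulrC.
  apply: evalstoM; first by apply: evalstoV; rewrite // mulf_neq0 // gt_eqF // monomial_at_gt0.
  apply: evalstoD; apply: evalsto_prod => j; rewrite -bE -good_narrows //; exact: evalstoX.
rewrite (_ : gmon t.+1 i = gmon t i) //; apply: eq_monomial_at => j.
by rewrite GE mul_elemE (negbTE ik).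
Qed.

End AtPoint.

(** The defining identity, evaluated at x, is compared with [seed_values]: the value of the
    F-polynomial is a common positive factor and cancels, and monomials that agree at all positive
    rational points have the same exponents. *)
Lemma g_vectorE (i : 'I_n) (g : 'cV[int]_n) : is_g_vector Q ks i g ->
  forall j, g j 0 = G T j i.
Proof.
case=> F [p [q [q0 pE FE]]] gE.
apply: monomial_at_inj => x x0; have x0' j : x j != 0 by rewrite gt_eqF.
have [f [f0 fv _ xv]] := seed_values x0 (leqnn T).
have := fv i; rewrite /pf_seed_at take_size -[seed_var _ _]/(FZ_pf Q ks i).
move=> [p1 [q1 [q1x pE1 vE]]].
(* After the substitution q is nonzero as a polynomial but may vanish at the point, whereas q1 does
   not vanish there. As both fractions represent the same variable, F can be evaluated through
   q1. *)
have pq : p * q1 = p1 * q.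
  apply: tofrac_eq; rewrite -?pE //; last exact: meval_neq0 q1x.
  by apply: contraNneq q0 => ->; rewrite comp_mpoly0.
have sub_eval (r : {mpoly rat[n + n]}) :
    (r \mPo pf_subst).@[zval x] = r.@[pf_point x].
  rewrite comp_mpoly_meval; apply: meval_eq => v; rewrite tnth_mktuple /pf_point.
  by case: (split v) => j; rewrite ?meval1 ?mevalXU.
have Fq : F * (q1 \mPo pf_subst) = p1 \mPo pf_subst.
  apply: (mulIf q0); rewrite mulrAC FE -!rmorphM; congr (_ \mPo _); exact: pq.
have FvE : F.@[zval x] = f i.
  rewrite vE; apply: (canRL (mulfK q1x)).
  by rewrite -!sub_eval -mevalM Fq.
have ev1 := xv i; rewrite /seed_at take_size -[seed_var _ _]/(FZ Q ks i) gE in ev1.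
have ev2 : evalsto x (mmap ratr (fun j => (yvar Q j)^-1) F) (f i).
  rewrite -FvE; apply: evalsto_mmap => j.
  have -> : zval x j = (monomial_at x (fun l => Qbar Q l j))^-1.
    rewrite -monomial_atN; apply: eq_monomial_at => l.
    by rewrite B0E /bq /Qbar opprB.
  by apply: evalstoV; [rewrite gt_eqF // monomial_at_gt0 | exact: evalsto_xmonomial].
have := evalsto_uniq ev1 (evalstoM (evalsto_xmonomial _ x0') ev2).
by move/(mulIf (lt0r_neq0 (f0 i))) => <-.
Qed.

End Numeric.

(** * Coherence along a mutation sequence *)

Lemma mutation_sequence (K : fieldType) (V : finType) (S0 : qp K V) (ks : seq V) (d : V) :
  successively_f_mutatable S0 ks -> exists2 S : nat -> qp K V, S 0%N = S0 &
    forall t, (t < size ks)%N -> is_f_mutation (nth d ks t) (S t) (S t.+1).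
Proof.
elim: ks S0 => [|k ks IH] S0 /=; first by exists (fun _ => S0).
case=> R R1 /IH[S SR Sm]; exists (fun t => if t is t'.+1 then S t' else S0) => //.
by case=> [_|t /Sm] //; rewrite SR.
Qed.

Section Runs.
Context (K : fieldType) {n : nat} (S : nat -> qp K ('I_n + 'I_n)%type).
Variables (T : nat) (k : nat -> 'I_n).
Local Notation M := 'M[int]_n.
Hypothesis S0g : good_quiver (qp_quiver (S 0%N)).
Hypothesis Sm : forall t, (t < T)%N -> is_f_mutation (inl (k t)) (S t) (S t.+1).

Definition run_b t : M := \matrix_(u, v) bq (qp_quiver (S t)) (inl u) (inl v).

Lemma run_good t : (t <= T)%N -> good_quiver (qp_quiver (S t)).
Proof.
elim: t => // t IH tT; have [_ iso] := Sm tT.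
exact/(good_iso iso)/good_mu/IH/ltnW.
Qed.

Lemma run_b_skew t : skew (run_b t).
Proof. by move=> u v; rewrite !mxE bqN. Qed.

Lemma run_bS t : (t < T)%N -> run_b t.+1 = mut_b (k t) (run_b t).
Proof.
move=> tT; have [_ iso] := Sm tT; apply/matrixP => u v; rewrite !mxE.
rewrite {1}/bq !(quiver_iso_narrows _ _ iso) -/(bq _ _ _) good_mu_bq ?(inj_eq (@inl_inj _ _)) //.
exact/run_good/ltnW.
Qed.

Fixpoint run_fwd s m : M :=
  if m is m'.+1 then trop_step (run_b (s + m')) (k (s + m')) (run_fwd s m') else 1%:M.

Fixpoint run_bwd s m : M :=
  if m is m'.+1 then trop_step (run_b s) (k s) (run_bwd s.+1 m') else 1%:M.

Definition run_D s t := run_fwd s (t - s).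
Definition run_R s t := run_bwd s (t - s).

(** The weights at the framing vertices mutate as well but need not be recorded: the new weight at v
    depends only on those at v and k. *)
Lemma run_fwd_coh s m : (s + m <= T)%N -> exists2 G : 'I_n -> 'I_n + 'I_n -> int,
  qp_coh (S (s + m)) G & forall v a, G a (inl v) = run_fwd s m v a.
Proof.
elim: m => [|m IH] smT.
  exists (fun a v => (-1) ^+ false * (v == inl a)%:R); first exact: coh_init.
  by move=> v a; rewrite mul1r mxE (inj_eq (@inl_inj _ _)).
rewrite addnS in smT *; have [G cG GE] := IH (ltnW smT).
have [lf tf] := run_good (ltnW smT).
have [/(_ cG) cG' _] := coh_f_mutation lf tf (Sm smT) G.
eexists; first exact: cG'.
move=> v a; rewrite mxE /mut_step (inj_eq (@inl_inj _ _)) !GE !good_narrows //.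
by rewrite !mxE.
Qed.

(** Mutating back exchanges the arrows into and out of k, and negating the weights exchanges the two
    positive parts; so minus the weights again follow [trop_step]. *)
Lemma run_bwd_coh s m : (s + m <= T)%N -> exists2 G : 'I_n -> 'I_n + 'I_n -> int,
  qp_coh (S s) G & forall v a, G a (inl v) = - run_bwd s m v a.
Proof.
elim: m s => [|m IH] s smT.
  exists (fun a v => (-1) ^+ true * (v == inl a)%:R); first exact: coh_init.
  by move=> v a; rewrite mulN1r mxE (inj_eq (@inl_inj _ _)).
rewrite addnS -addSn in smT; have [G cG GE] := IH _ smT.
have sT : (s < T)%N by apply: leq_trans smT; rewrite leq_addr.
have [lf tf] := run_good (ltnW sT).
have [_ /(_ cG) cG'] := coh_f_mutation lf tf (Sm sT) G.
eexists; first exact: cG'.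
move=> v a; rewrite mxE /mut_step (inj_eq (@inl_inj _ _)) !GE !good_narrows //.
by rewrite !mxE !opprK; case: eqP => // _; ring.
Qed.

Lemma run_coherent t (G : 'I_n -> 'I_n + 'I_n -> int) v : (t <= T)%N ->
  qp_coh (S t) G ->
  (forall a, 0 <= G a (inl v)) \/ (forall a, G a (inl v) <= 0).
Proof.
move=> /run_good[lf tf] cG.
have rr a : in_rad 1 (cyclic_derivative a (qp_potential (S t))).
  by apply: der_rad => c _; exact: loop_free_size.
exact: (coh_coherent rr cG (inl v)).
Qed.

Lemma run_D_sign (s t : nat) v : (s <= t)%N -> (t <= T)%N -> exists e, row_sign e (run_D s t) v.
Proof.
move=> st tT; have smT : (s + (t - s) <= T)%N by rewrite subnKC.
have [G cG GE] := run_fwd_coh smT.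
have [h|h] := run_coherent v smT cG.
  by exists false => a; rewrite mul1r /run_D -GE.
by exists true => a; rewrite mulN1r oppr_ge0 /run_D -GE.
Qed.

Lemma run_R_sign (s t : nat) v : (s <= t)%N -> (t <= T)%N -> exists e, row_sign e (run_R s t) v.
Proof.
move=> st tT; have smT : (s + (t - s) <= T)%N by rewrite subnKC.
have [G cG GE] := run_bwd_coh smT.
have [h|h] := run_coherent v (leq_trans st tT) cG.
  by exists true => a; rewrite mulN1r /run_R -GE.
by exists false => a; rewrite mul1r -oppr_le0 /run_R -GE.
Qed.

End Runs.

Theorem theorem8p11 (R : realType) (n : nat) (Q : quiver 'I_n)
    (W : potential (R[i])%C Q) (ks : seq 'I_n) (G : 'M[int]_n) :
  loop_free Q -> two_cycle_free Q ->
  successively_f_mutatable (framed_qp W) [seq inl k | k <- ks] ->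
  (forall i : 'I_n, is_g_vector Q ks i (col i G)) ->
  forall i : 'I_n,
    (forall j : 'I_n, 0 <= row i G 0 j) \/ (forall j : 'I_n, row i G 0 j <= 0).
Proof.
move=> lf tf mutable gG i; have [S S0 Sm] := mutation_sequence (inl i) mutable.
rewrite size_map in Sm; pose k := nth i ks.
have {}Sm t : (t < size ks)%N -> is_f_mutation (inl (k t)) (S t) (S t.+1).
  by move=> tT; rewrite -(nth_map i (inl i) inl tT); exact: Sm.
have Qg : good_quiver Q by [].
have S0g : good_quiver (qp_quiver (S 0%N)) by rewrite S0; exact: good_framed.
pose B := run_b S; pose D := run_D S k; pose RR := run_R S k.
have B0 : skew (B 0%N) by exact: run_b_skew.
have BS t : (t < size ks)%N -> B t.+1 = mut_b (k t) (B t) by exact: run_bS.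
have D0 s : (s <= size ks)%N -> D s s = 1%:M by rewrite /D /run_D subnn.
have R0 s : (s <= size ks)%N -> RR s s = 1%:M by rewrite /RR /run_R subnn.
have DS (s t : nat) : (s <= t)%N -> (t < size ks)%N ->
    D s t.+1 = trop_step (B t) (k t) (D s t).
  by move=> st _; rewrite /D /run_D subSn //= subnKC.
have RS (s t : nat) : (s < t)%N -> (t <= size ks)%N ->
    RR s t = trop_step (B s) (k s) (RR s.+1 t).
  by move=> st _; rewrite /RR /run_R -(subnSK st).
have Dc (s t : nat) : (s <= t)%N -> (t <= size ks)%N -> forall v, exists e, row_sign e (D s t) v.
  by move=> st tT v; exact: (run_D_sign S0g Sm).
have Rc (s t : nat) : (s <= t)%N -> (t <= size ks)%N -> forall v, exists e, row_sign e (RR s t) v.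
  by move=> st tT v; exact: (run_R_sign S0g Sm).
have GE : G = RR 0%N (size ks).
  apply/matrixP => u v.
  rewrite -[RHS](g_vectorE (i0 := i) (ks := ks) (B := B) (D := D 0%N) (G := RR 0%N) Qg
    _ _ _ _ _ _ _ _ (gG v)) ?mxE //.
  - by move=> a b; rewrite mxE S0 /bq !narrows_framed_inl.
  - by move=> t; exact: DS.
  - move=> t tT; have [e es] := Dc 0%N t (leq0n t) (ltnW tT) (k t).
    by exists e => //; exact: (R_succ B0 BS D0 DS R0 RS Dc Rc).
  - by move=> t; exact: (tropical_duality B0 BS D0 DS R0 RS Dc Rc).
  - by move=> t; exact: (R_congr B0 BS R0 RS Rc).
have [e es] := Rc 0%N (size ks) (leq0n _) (leqnn _) i.
case: e es => es; [right | left] => j; have := es j; rewrite mxE GE.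
  by rewrite mulN1r oppr_ge0.
by rewrite mul1r.
Qed.
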